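(* Let $(M_p)_{p\in\mathbb N}$ be a weight sequence and let $\mathcal{V} = (v_n)_{n\in\mathbb N}$ be a decreasing weight system on $\mathbb{R}^d$. Consider the following conditions: (i) $\mathcal{V}$ satisfies $(\Omega)$. (ii) $\mathcal{B}^{(M_p)}_\mathcal{V}(\mathbb{R}^d)$ is boundedly retractive. (iii) $\mathcal{B}^{(M_p)}_\mathcal{V}(\mathbb{R}^d)$ is complete. (iv) $\mathcal{B}^{(M_p)}_\mathcal{V}(\mathbb{R}^d)$ is regular. (v) $\mathcal{B}^{(M_p)}_\mathcal{V}(\mathbb{R}^d)$ satisfies $(wQ)$. Then (i) $\Rightarrow$ (ii) $\Rightarrow$ (iii) $\Rightarrow$ (iv) $\Rightarrow$ (v) and, if $\mathcal{V}$ is regularly decreasing, (v) $\Rightarrow$ (ii). Moreover, if $M_p$ satisfies $(M.1)$, $(M.2)$, and $(M.3)$, and $\mathcal{V}$ satisfies $$\forall n \in \mathbb{N} \; \exists m \geq n \; \exists C > 0 \; \forall x \in \mathbb{R}^d : \; \sup_{y \in [-1,1]^d} v_m(x +y) \leq Cv_n(x),$$ then (v) $\Rightarrow$ (i).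
   Context: Weight sequences. For a sequence $(M_p)_{p\in\mathbb{N}}$ of positive reals ($\mathbb N=\{0,1,2,\dots\}$) put $m_p := M_p/M_{p-1}$, $p\ge 1$. It is a weight sequence if $m_p\to\infty$. Write $M_\alpha=M_{|\alpha|}$ for $\alpha\in\mathbb{N}^d$. Conditions: $(M.1)$ $M_p^2\le M_{p-1}M_{p+1}$, $p\ge1$; $(M.2)$ $M_{p+q}\le C_0H^{p+q}M_pM_q$ for all $p,q\in\mathbb N$, for some $C_0,H\ge1$; $(M.3)$ $\sum_{p=q}^\infty 1/m_p< Cq/m_q$ for all $q\ge1$, for some $C\ge1$. Weight systems. A decreasing weight system on $\mathbb{R}^d$ is a pointwise decreasing sequence $\mathcal{V}=(v_n)_{n\in\mathbb N}$ of positive continuous functions on $\mathbb{R}^d$. It satisfies $(\Omega)$ if $\forall n\,\exists m>n\,\forall k>m\,\exists\theta\in(0,1)\,\exists C>0\,\forall x\in\mathbb{R}^d:\ v_m(x)\le C v_n(x)^{1-\theta}v_k(x)^\theta$. It is regularly decreasing if for every $n$ there is $m\ge n$ such that for every $k>m$ and every subset $Y$ of $\mathbb{R}^d$: $\inf_{y\in Y}v_m(y)/v_n(y)>0$ implies $\inf_{y\in Y}v_k(y)/v_n(y)>0$. Spaces. For a positive continuous function $w$ on $\mathbb R^d$ and $h>0$, $\mathcal{B}^{M_p,h}_w(\mathbb{R}^d)$ is the Banach space of all $\varphi\in C^\infty(\mathbb{R}^d)$ with $\|\varphi\|_{\mathcal{B}^{M_p,h}_w}:=\sup_{\alpha\in\mathbb{N}^d}\sup_{x\in\mathbb{R}^d}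 h^{|\alpha|}|\varphi^{(\alpha)}(x)|w(x)/M_\alpha<\infty$. Put $\mathcal{B}^{(M_p)}_w(\mathbb{R}^d):=\varprojlim_{h\to\infty}\mathcal{B}^{M_p,h}_w(\mathbb{R}^d)$ (a Fréchet space) and $\mathcal{B}^{(M_p)}_\mathcal{V}(\mathbb{R}^d):=\varinjlim_{n\in\mathbb N}\mathcal{B}^{(M_p)}_{v_n}(\mathbb{R}^d)$ (an $(LF)$-space). $(LF)$-spaces. A Hausdorff locally convex space $E$ is an $(LF)$-space, written $E=\varinjlim E_n$, if there is a sequence of Fréchet spaces $E_n\subset E_{n+1}$ with continuous inclusions, $E=\bigcup_n E_n$, carrying the finest locally convex topology making all inclusions $E_n\to E$ continuous. $E$ is regular if every bounded set of $E$ is contained and bounded in some $E_n$. $E$ is boundedly retractive if for every bounded set $B$ of $E$ there is $n$ such that $B\subset E_n$ and $E$ and $E_n$ induce the same topology on $B$. $E$ satisfies $(wQ)$ if for every $n$ there are a neighborhood $U$ of $0$ in $E_n$ and $m>n$ such that for every $k>m$ and every neighborhood $W$ of $0$ in $E_m$ there are a neighborhood $V$ of $0$ in $E_k$ and $C>0$ with $V\cap U\subseteq CW$. These notions do not depend on the choice of defining spectrum. *)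

(* Defs.v *)
From HB Require Import structures.
From mathcomp Require Import all_boot all_order all_algebra.
From mathcomp Require Import complex.
From mathcomp Require Import interval_inference.
From mathcomp Require Import boolp classical_sets functions reals ereal convex.
From mathcomp Require Import topology normedtype sequences derive exp.

Set Implicit Arguments.
Unset Strict Implicit.
Unset Printing Implicit Defensive.

Import Order.TTheory GRing.Theory Num.Theory.
Import numFieldNormedType.Exports.

Local Open Scope classical_set_scope.
Local Open Scope ring_scope.

Section AbsolutelyConvex.
Context (K : numFieldType) (E : lmodType K).
Implicit Types (W : set E) (x y : E).

Definition balanced W :=
  forall (a : K) x, `|a| <= 1 -> W x -> W (a *: x).

Definition absolutely_convex W :=
  convex_set (W : set (convex_lmodType E)) /\ balanced W.

Lemma convex_setP W : convex_set (W : set (convex_lmodType E)) <->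
  (forall x y (l : K), 0 <= l -> l <= 1 -> W x -> W y ->
     W (l *: x + (1 - l) *: y)).
Proof.
split=> [cW x y l l0 l1 Wx Wy|cW x y l].
  have h01 : Itv.spec (@Itv.num_sem K) (Itv.Real `[0%Z, 1%Z]%R) l.
    by rewrite /Itv.spec/= /Itv.num_sem/= in_itv/= l0 l1 ger0_real.
  have := cW x y (Itv.mk h01) (mem_set Wx) (mem_set Wy).
  rewrite inE; exact.
rewrite !inE => Wx Wy.
exact: cW.
Qed.

Lemma absolutely_convexD W x y : absolutely_convex W ->
  W (2%:R *: x) -> W (2%:R *: y) -> W (x + y).
Proof.
move=> [/convex_setP cW _] Wx Wy.
have h0 : 0 <= 2%:R^-1 :> K by rewrite invr_ge0 ler0n.
have h1 : 2%:R^-1 <= 1 :> K by rewrite invf_le1 ?ltr0n// ler1n.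
have := cW _ _ _ h0 h1 Wx Wy.
have -> : 1 - 2%:R^-1 = 2%:R^-1 :> K.
  by rewrite {1}[1](splitr (1 : K)) mul1r addrK.
by rewrite !scalerA mulVf ?pnatr_eq0// !scale1r.
Qed.

Lemma balanced0 W x : balanced W -> W x -> W 0.
Proof. by move=> bW Wx; rewrite -(scale0r x); apply: bW; rewrite ?normr0. Qed.

End AbsolutelyConvex.

(* A base of absolutely convex neighborhoods of 0 for a locally convex topology
   on [E]. *)
Record lc_base (K : numFieldType) (E : lmodType K) := LcBase {
  lc_nbhs0 : set_system E;
  lc_nbhs0T : exists W, lc_nbhs0 W;
  lc_nbhs0I : forall W1 W2, lc_nbhs0 W1 -> lc_nbhs0 W2 ->
    exists2 W, lc_nbhs0 W & W `<=` W1 `&` W2;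
  lc_nbhs0_convex : forall W, lc_nbhs0 W -> absolutely_convex W;
  lc_nbhs0_absorbing : forall W x, lc_nbhs0 W ->
    exists2 r : K, 0 < r & W (r *: x);
  lc_nbhs0_scale : forall W (r : K), lc_nbhs0 W -> 0 < r ->
    exists2 W', lc_nbhs0 W' & W' `<=` [set x | W (r *: x)]
}.

(* [E] equipped with the locally convex topology given by the base [b]. *)
Definition lc_space (K : numFieldType) (E : lmodType K) (b : lc_base E) : Type :=
  E.

Section LcSpace.
Context (K : numFieldType) (E : lmodType K) (b : lc_base E).

HB.instance Definition _ := GRing.Lmodule.on (lc_space b).

Local Notation L := (lc_space b).
Implicit Types (x y : L) (U : set L).

Definition lc_nbhs x : set_system L :=
  [set U | exists2 W, lc_nbhs0 b W & forall w, W w -> U (x + w)].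

HB.instance Definition _ := hasNbhs.Build L lc_nbhs.

Lemma lc0 W : lc_nbhs0 b W -> W 0.
Proof.
move=> bW; have [r _ Wr] := lc_nbhs0_absorbing 0 bW.
by apply: balanced0 Wr; case: (lc_nbhs0_convex bW).
Qed.

Lemma lc_half W : lc_nbhs0 b W ->
  exists2 W', lc_nbhs0 b W' & forall u w, W' u -> W' w -> W (u + w).
Proof.
move=> bW; have [W' bW' WW'] := lc_nbhs0_scale bW (ltr0Sn K 1).
exists W' => // u w /WW' Wu /WW' Ww.
exact: absolutely_convexD (lc_nbhs0_convex bW) Wu Ww.
Qed.

Let lc_filter x : ProperFilter (nbhs x).
Proof.
split.
  by move=> [W bW /(_ 0 (lc0 bW))].
split.
- by have [W bW] := lc_nbhs0T b; exists W.
- move=> P Q [W1 b1 P1] [W2 b2 Q2]; have [W bW W12] := lc_nbhs0I b1 b2.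
  by exists W => // w /W12 [/P1 ? /Q2 ?].
- by move=> P Q PQ [W bW PW]; exists W => // w /PW /PQ.
Qed.

Let lc_singleton x U : nbhs x U -> U x.
Proof. by move=> [W bW]; move/(_ _ (lc0 bW)); rewrite addr0. Qed.

Let lc_nbhs_nbhs x U : nbhs x U -> nbhs x (nbhs^~ U).
Proof.
move=> [W /lc_half [W' bW' WW'] WU]; exists W' => // u Wu.
by exists W' => // w Ww; rewrite -addrA; apply: WU; exact: WW'.
Qed.

HB.instance Definition _ := Nbhs_isNbhsTopological.Build L
  lc_filter lc_singleton lc_nbhs_nbhs.

Let lc_add_continuous : continuous (fun x : L * L => x.1 + x.2).
Proof.
move=> [x y] U /= [W /lc_half [W' bW' WW'] WU].
exists ((fun u => W' (u - x)), (fun u => W' (u - y))) => /=.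
  by split; exists W' => // w Ww /=; rewrite addrC addKr.
move=> [u v] /= [Wu Wv].
rewrite (_ : u + v = (x + y) + ((u - x) + (v - y))).
  by apply: WU; exact: WW'.
by rewrite addrACA ![_ + (_ - _)]addrC !subrK.
Qed.

Let lc_scale_continuous : continuous (fun z : K^o * L => z.1 *: z.2).
Proof.
move=> [k x] U /= [W /lc_half [W' bW' WW'] WU].
have [r r0 Wr] := @lc_nbhs0_absorbing K E b W' x bW'.
have [_ balW'] := lc_nbhs0_convex bW'.
have s0 : 0 < `|k| + 1 by rewrite ltr_wpDl.
have [W2 bW2 W2W'] := lc_nbhs0_scale bW' s0.
exists ((fun l : K => `|l - k| <= 1 /\ `|l - k| <= r), (fun u => W2 (u - x))) => /=.
  split; last by exists W2 => // w Ww /=; rewrite addrC addKr.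
  apply: filterI.
    apply/nbhs_ballP; exists 1 => //= l; rewrite -ball_normE/= distrC.
    exact: ltW.
  apply/nbhs_ballP; exists r => //= l; rewrite -ball_normE/= distrC.
  exact: ltW.
move=> [l u] /= [[l1 lr] Wu].
rewrite (_ : l *: u = k *: x + (l *: (u - x) + (l - k) *: x)); last first.
  by rewrite scalerBr scalerBl [RHS]addrC -addrA subrK subrK.
apply: WU; apply: WW'.
  rewrite (_ : l *: (u - x) = (l / (`|k| + 1)) *: ((`|k| + 1) *: (u - x))).
    apply: balW'; last exact: W2W'.
    rewrite normrM normfV (gtr0_norm s0) ler_pdivrMr// mul1r.
    have := ler_normD k (l - k); rewrite [k + _]addrC subrK => /le_trans; apply.
    by rewrite lerD2l.
  by rewrite scalerA divfK// gt_eqF.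
rewrite (_ : (l - k) *: x = ((l - k) / r) *: (r *: x)).
  apply: balW' => //.
  by rewrite normrM normfV (gtr0_norm r0) ler_pdivrMr// mul1r.
by rewrite scalerA divfK// gt_eqF.
Qed.

Let lc_locally_convex : exists2 B : set_system L,
  (forall U, U \in B -> convex_set (U : set (convex_lmodType L))) & basis B.
Proof.
exists [set U | open U /\ convex_set (U : set (convex_lmodType L))].
  by move=> U; rewrite inE => -[].
split=> [U [] //|x U [W bW WU]].
have xW : nbhs x [set y | W (y - x)].
  by exists W => // w Ww /=; rewrite addrC addKr.
exists (interior [set y | W (y - x)]); last first.
  move=> y /interior_subset /= /WU; by rewrite addrC subrK.
split=> //; split; first exact: open_interior.
apply/convex_setP => y z l l0 l1 [W1 b1 y1] [W2 b2 z2].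
have [W3 b3 W123] := lc_nbhs0I b1 b2.
exists W3 => // w /W123 [/y1/= Wy /z2/= Wz].
have [/convex_setP cW _] := lc_nbhs0_convex bW.
have := cW _ _ _ l0 l1 Wy Wz.
congr W; rewrite -(addrA y) -(addrA z) !(scalerDr _ _ (w - x)) addrACA -scalerDl.
by rewrite [l + _]addrC subrK scale1r addrA.
Qed.

HB.instance Definition _ := PreTopologicalLmod_isTvs.Build K L
  lc_add_continuous lc_scale_continuous lc_locally_convex.
HB.instance Definition _ :=
  PreTopologicalNmodule_isTopologicalNmodule.Build L lc_add_continuous.
HB.instance Definition _ :=
  TopologicalNmodule_isTopologicalLmodule.Build K L lc_scale_continuous.
HB.instance Definition _ := Uniform_isTvs.Build K L lc_locally_convex.

Lemma lc_nbhs0E U : nbhs (0 : L) U <-> exists2 W, lc_nbhs0 b W & W `<=` U.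
Proof.
by split=> -[W bW WU]; exists W => // w /WU; rewrite add0r.
Qed.

(* Cauchy filters are those of the translation-invariant uniformity. *)
Lemma lc_entourageE (A : set (L * L)) : entourage A <->
  exists2 U, nbhs (0 : L) U & forall x y, U (x - y) -> A (x, y).
Proof.
split=> [[U [U0 UA]]|[U U0 UA]]; exists U => //.
  by move=> x y Uxy; apply/set_mem/(UA (x, y))/mem_set.
by split=> // -[x y] /set_mem /UA /mem_set.
Qed.

End LcSpace.

Section TvsLemmas.
Context (K : numFieldType) (E : tvsType K).

Lemma nbhs0_absorbing (U : set E) x : nbhs 0 U ->
  exists2 r : K, 0 < r & U (r *: x).
Proof.
move=> U0; have := @scale_continuous K E (0, x) U; rewrite /= scale0r.
move=> /(_ U0) [[A B] /= [A0 Bx] AB].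
have [r r0 rA] := (nbhs_ballP _ _).1 A0.
exists (r / 2%:R); first by rewrite divr_gt0// ltr0n.
apply: (AB (_, _)); split => /=; last exact: nbhs_singleton.
apply: rA; rewrite -ball_normE/= sub0r normrN gtr0_norm ?divr_gt0 ?ltr0n//.
by rewrite ltr_pdivrMr ?ltr0n// ltr_pMr// ltr1n.
Qed.

Lemma nbhs0_scale (U : set E) (r : K) : nbhs 0 U -> nbhs 0 [set x | U (r *: x)].
Proof.
move=> U0; have := @scale_continuous K E (r, 0) U; rewrite /= scaler0.
move=> /(_ U0) [[A B] /= [A0 Bx] AB].
apply: filterS Bx => y By; apply: (AB (_, _)); split => //=.
exact: nbhs_singleton.
Qed.

Lemma nbhs0_absolutely_convex (U : set E) : nbhs 0 U ->
  exists W, [/\ nbhs 0 W, absolutely_convex W & W `<=` U].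
Proof.
move=> U0; have [B Bc [Bo Bb]] := @locally_convex K E.
have [C [BC C0] CU] := Bb 0 U U0.
have nC : nbhs 0 C by apply: open_nbhs_nbhs; split => //; exact: Bo.
have /convex_setP cC := Bc _ (mem_set BC).
exists [set x | forall a : K, `|a| <= 1 -> C (a *: x)]; split.
- have := @scale_continuous K E (0, 0) C; rewrite /= scaler0.
  move=> /(_ nC) [[A V] /= [A0 V0] AV].
  have [r r0 rA] := (nbhs_ballP _ _).1 A0.
  have q0 : 0 < r / 2%:R by rewrite divr_gt0// ltr0n.
  apply: filterS (nbhs0_scale (r / 2%:R)^-1 V0) => y Vy a a1.
  have -> : a *: y = (a * (r / 2%:R)) *: ((r / 2%:R)^-1 *: y).
    by rewrite scalerA mulfK// gt_eqF.
  apply: (AV (_, _)); split => //=; apply: rA.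
  rewrite -ball_normE/= sub0r normrN normrM (gtr0_norm q0).
  rewrite (@le_lt_trans _ _ (r / 2%:R))//; first by rewrite ler_piMl// ltW.
  by rewrite ltr_pdivrMr ?ltr0n// ltr_pMr// ltr1n.
- split.
    apply/convex_setP => x y l l0 l1 Wx Wy a a1.
    rewrite scalerDr !scalerA ![a * _]mulrC -!scalerA.
    by apply: cC => //; [exact: Wx|exact: Wy].
  move=> c x c1 Wx a a1; rewrite scalerA; apply: Wx.
  by rewrite normrM mulr_ile1.
- by move=> x /(_ 1); rewrite normr1 scale1r => /(_ (lexx _)) /CU.
Qed.

End TvsLemmas.

(* An increasing sequence of locally convex subspaces exhausting [E]: [step n]
   is the n-th space, [link n] its continuous inclusion in the next one and
   [incl n] its inclusion in [E]. *)
Record lc_spectrum (K : numFieldType) (E : lmodType K) := LcSpectrum {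
  step : nat -> tvsType K;
  incl : forall n, {linear step n -> E};
  link : forall n, {linear step n -> step n.+1};
  incl_inj : forall n, injective (incl n);
  incl_link : forall n x, incl n.+1 (link n x) = incl n x;
  link_continuous : forall n, continuous (link n);
  incl_cover : forall x, exists n, range (incl n) x
}.

Section InductiveLimit.
Context (K : numFieldType) (E : lmodType K) (S : lc_spectrum E).

(* The absolutely convex sets having a neighborhood of 0 of every step as
   preimage; they form a base at 0 of the finest locally convex topology on [E]
   that makes all inclusions continuous, see [incl_continuous] and
   [indlim_finest]. *)
Definition indlim_nbhs0 : set_system E :=
  [set W | absolutely_convex W /\
           forall n, nbhs (0 : step S n) (incl S n @^-1` W)].

Let indlim_nbhs0T : exists W, indlim_nbhs0 W.
Proof.
exists setT; split; last by move=> n; rewrite preimage_setT; exact: filterT.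
by split => //; apply/convex_setP.
Qed.

Let indlim_nbhs0I W1 W2 : indlim_nbhs0 W1 -> indlim_nbhs0 W2 ->
  exists2 W, indlim_nbhs0 W & W `<=` W1 `&` W2.
Proof.
move=> [[/convex_setP c1 b1] n1] [[/convex_setP c2 b2] n2].
exists (W1 `&` W2) => //; split; last by move=> n; exact: filterI.
split; last by move=> a x a1 [? ?]; split; [exact: b1|exact: b2].
apply/convex_setP => x y l l0 l1 [? ?] [? ?].
by split; [exact: c1|exact: c2].
Qed.

Let indlim_nbhs0_convex W : indlim_nbhs0 W -> absolutely_convex W.
Proof. by case. Qed.

Let indlim_nbhs0_absorbing W x : indlim_nbhs0 W ->
  exists2 r : K, 0 < r & W (r *: x).
Proof.
move=> [_ nW]; have [n [y _ <-]] := incl_cover S x.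
by have [r r0 Wr] := nbhs0_absorbing y (nW n); exists r; rewrite -?linearZ.
Qed.

Let indlim_nbhs0_scale W (r : K) : indlim_nbhs0 W -> 0 < r ->
  exists2 W', indlim_nbhs0 W' & W' `<=` [set x | W (r *: x)].
Proof.
move=> [[/convex_setP cW bW] nW] r0; exists [set x | W (r *: x)] => //.
split; last first.
  move=> n; apply: filterS (nbhs0_scale r (nW n)) => x /=.
  by rewrite linearZ.
split; last by move=> a x a1 /= Wx; rewrite scalerA mulrC -scalerA; exact: bW.
apply/convex_setP => x y l l0 l1 /= Wx Wy.
by rewrite scalerDr !scalerA ![r * _]mulrC -!scalerA; exact: cW.
Qed.

Definition indlim_base : lc_base E := LcBase indlim_nbhs0T indlim_nbhs0I
  indlim_nbhs0_convex indlim_nbhs0_absorbing indlim_nbhs0_scale.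

Definition indlim : tvsType K := lc_space indlim_base.

Lemma incl_continuous n : continuous (incl S n : step S n -> indlim).
Proof.
move=> x U [W [_ /(_ n) nW] WU].
have := nbhsT x nW; apply: filterS => _ [w Ww <-] /=.
by rewrite linearD; exact: WU.
Qed.

Lemma indlim_finest (F : tvsType K) (f : {linear E -> F}) :
  (forall n, continuous (f \o incl S n)) -> continuous (f : indlim -> F).
Proof.
move=> cf x U Ux.
have nU : nbhs 0 [set y | U (f x + y)].
  have := nbhsB (- f x) Ux; rewrite addNr; apply: filterS => _ [y Uy <-] /=.
  by rewrite addrA subrr add0r.
have [W [nW [/convex_setP cW bW] WU]] := nbhs0_absolutely_convex nU.
exists (f @^-1` W); last by move=> w /WU /=; rewrite linearD.
split; last first.
  move=> n; have := cf n 0; rewrite /continuous_at /= !linear0; exact.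
split; last by move=> a y a1 /= Wy; rewrite linearZ; exact: bW.
by apply/convex_setP => y z l l0 l1 /= Wy Wz; rewrite linearD !linearZ; exact: cW.
Qed.

End InductiveLimit.

Definition tvs_bounded (K : numFieldType) (E : tvsType K) (B : set E) :=
  forall U, nbhs 0 U -> exists2 r : K, 0 < r & B `<=` [set r *: x | x in U].

Section LFProperties.
Context (K : numFieldType) (E : lmodType K) (S : lc_spectrum E).

Definition lf_complete :=
  forall F : set_system (indlim S), ProperFilter F -> cauchy F ->
    exists x : indlim S, F --> x.

Definition lf_regular :=
  forall B : set (indlim S), tvs_bounded B ->
    exists n, exists2 A : set (step S n), tvs_bounded A & B = incl S n @` A.

Definition boundedly_retractive :=
  forall B : set (indlim S), tvs_bounded B ->
    exists n, B `<=` range (incl S n) /\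
      (forall A : set (indlim S),
         (exists2 O : set (indlim S), open O & A = O `&` B) <->
         (exists2 O : set (step S n), open O & A = (incl S n @` O) `&` B)).

Definition lf_wQ :=
  forall n, exists2 U : set (step S n), nbhs 0 U &
    exists2 m, (n < m)%N & forall k, (m < k)%N ->
      forall W : set (step S m), nbhs 0 W ->
        exists2 V : set (step S k), nbhs 0 V & exists2 C : K, 0 < C &
          (incl S k @` V) `&` (incl S n @` U) `<=`
          incl S m @` [set C *: x | x in W].

End LFProperties.

(* $m_p$, only meaningful for [0 < p]. *)
Definition ratio (R : realType) (M : nat -> R) (p : nat) := M p / M p.-1.

Record weight_sequence (R : realType) := WeightSequence {
  wseq :> nat -> R;
  wseq_gt0 : forall p, 0 < wseq p;
  wseq_ratio : ratio wseq p @[p --> \oo] --> +oo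
}.

Section WeightSequenceConditions.
Context (R : realType) (M : nat -> R).

Definition M1 := forall p, (0 < p)%N -> M p ^+ 2 <= M p.-1 * M p.+1.

Definition M2 := exists C0 H : R, [/\ 1 <= C0, 1 <= H &
  forall p q, M (p + q)%N <= C0 * H ^+ (p + q) * M p * M q].

Definition M3 := exists2 C : R, 1 <= C & forall q, (0 < q)%N ->
  (\sum_(q <= p <oo) ((ratio M p)^-1)%:E < (C * q%:R / ratio M q)%:E)%E.

End WeightSequenceConditions.

Record weight (R : realType) (d : nat) := Weight {
  weight_fun :> 'rV[R]_d -> R;
  weight_gt0 : forall x, 0 < weight_fun x;
  weight_continuous : continuous weight_fun
}.

Record weight_system (R : realType) (d : nat) := WeightSystem {
  wsys :> nat -> weight R d;
  wsys_decr : forall n x, wsys n.+1 x <= wsys n x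
}.

Section WeightSystemConditions.
Context (R : realType) (d : nat) (v : weight_system R d).

Definition Omega := forall n, exists2 m, (n < m)%N &
  forall k, (m < k)%N -> exists2 theta : R, 0 < theta < 1 &
    exists2 C : R, 0 < C &
      forall x, v m x <= C * (v n x `^ (1 - theta) * v k x `^ theta).

Definition regularly_decreasing := forall n, exists2 m, (n <= m)%N &
  forall k, (m < k)%N -> forall Y : set 'rV[R]_d,
    (0 < ereal_inf [set (v m y / v n y)%:E | y in Y] ->
     0 < ereal_inf [set (v k y / v n y)%:E | y in Y])%E.

Definition translation_controlled := forall n, exists2 m, (n <= m)%N &
  exists2 C : R, 0 < C & forall x,
    (ereal_sup [set (v m (x + y))%:E | y in
                [set y : 'rV[R]_d | forall i, (-1 <= y 0 i <= 1)%R]]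
     <= (C * v n x)%:E)%E.

End WeightSystemConditions.

Section SmoothFunctions.
Context (R : realType) (d : nat).
Implicit Types (f g : 'rV[R]_d -> R) (s : seq 'I_d).

Definition partial (i : 'I_d) f : 'rV[R]_d -> R := 'D_(delta_mx 0 i) f.

Definition partials s f := foldr partial f s.

Definition smooth f := forall s,
  continuous (partials s f) /\
  forall i x, derivable (partials s f) x (delta_mx 0 i).

Lemma partials_lin s f g (a : R) : smooth f -> smooth g ->
  partials s (a *: f + g) = a *: partials s f + partials s g.
Proof.
move=> sf sg; elim: s => //= i s ->; apply/funext => x.
have [_ /(_ i x) df] := sf s; have [_ /(_ i x) dg] := sg s.
rewrite /partial deriveD//; last exact: derivableZ.
by rewrite deriveZ.
Qed.

Lemma smooth_lin f g (a : R) : smooth f -> smooth g -> smooth (a *: f + g).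
Proof.
move=> sf sg s; rewrite partials_lin//.
have [cf df] := sf s; have [cg dg] := sg s; split => [x|i x].
  exact: (cvgD (cvgZl_tmp (k := a) (cf x)) (cg x)).
by apply: derivableD => //; exact: derivableZ.
Qed.

Lemma partials0 s : partials s 0 = 0.
Proof.
by elim: s => //= i s ->; apply/funext => x; exact: derive_cst.
Qed.

Lemma smooth0 : smooth 0.
Proof.
move=> s; rewrite partials0; split=> [x|i x]; last exact: (@derivable_cst _ _ _ (0 : R)).
exact: (@cst_continuous _ _ (0 : R)).
Qed.

End SmoothFunctions.

Section ComplexSmoothFunctions.
Context (R : realType) (d : nat).
Local Notation C := R[i].
Implicit Types (f g : 'rV[R]_d -> C) (alpha : {ffun 'I_d -> nat}).

Definition re f x := complex.Re (f x).
Definition im f x := complex.Im (f x).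

Definition csmooth f := smooth (re f) /\ smooth (im f).

Definition morder alpha := (\sum_i alpha i)%N.

Definition directions alpha : seq 'I_d :=
  flatten [seq nseq (alpha i) i | i <- enum 'I_d].

(* The order in which the partial derivatives are taken is irrelevant for the
   smooth functions to which this is applied. *)
Definition cderiv alpha f x : C :=
  Complex (partials (directions alpha) (re f) x)
          (partials (directions alpha) (im f) x).

Lemma Re_lin (a z w : C) : complex.Re (a * z + w) =
  complex.Re a * complex.Re z + (- complex.Im a * complex.Im z + complex.Re w).
Proof. by case: a z w => [a1 a2] [z1 z2] [w1 w2] /=; rewrite addrA mulNr. Qed.

Lemma Im_lin (a z w : C) : complex.Im (a * z + w) =
  complex.Re a * complex.Im z + (complex.Im a * complex.Re z + complex.Im w).
Proof. by case: a z w => [a1 a2] [z1 z2] [w1 w2] /=; rewrite addrA. Qed.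

Lemma re_lin (a : C) f g : re (a *: f + g) =
  complex.Re a *: re f + (- complex.Im a *: im f + re g).
Proof. by apply/funext => x; exact: Re_lin. Qed.

Lemma im_lin (a : C) f g : im (a *: f + g) =
  complex.Re a *: im f + (complex.Im a *: re f + im g).
Proof. by apply/funext => x; exact: Im_lin. Qed.

Lemma csmooth_lin (a : C) f g : csmooth f -> csmooth g -> csmooth (a *: f + g).
Proof.
move=> [rf jf] [rg jg]; split; rewrite ?re_lin ?im_lin;
  by do 2! [apply: smooth_lin => //].
Qed.

Lemma cderiv_lin alpha (a : C) f g x : csmooth f -> csmooth g ->
  cderiv alpha (a *: f + g) x = a * cderiv alpha f x + cderiv alpha g x.
Proof.
move=> [rf jf] [rg jg]; rewrite /cderiv re_lin im_lin.
rewrite !partials_lin//; [|exact: smooth_lin..].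
by apply/eqP; rewrite eq_complex Re_lin Im_lin !eqxx.
Qed.

Lemma csmooth0 : csmooth 0.
Proof. by split; exact: smooth0. Qed.

Lemma cderiv0 alpha x : cderiv alpha 0 x = 0.
Proof. by rewrite /cderiv !partials0. Qed.

End ComplexSmoothFunctions.

Section NormC.
Context (R : realType).
Implicit Types z w : R[i].

Definition cabs z : R := complex.Re `|z|.

Lemma cabsE z : `|z| = (cabs z)%:C%C.
Proof. by []. Qed.

Lemma cabs_ge0 z : 0 <= cabs z.
Proof. by rewrite -ler0c -cabsE. Qed.

Lemma cabs0 : cabs 0 = 0.
Proof. by rewrite /cabs normr0. Qed.

Lemma cabsM z w : cabs (z * w) = cabs z * cabs w.
Proof. by apply: complexI; rewrite rmorphM/= -!cabsE normrM. Qed.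

Lemma cabsD z w : cabs (z + w) <= cabs z + cabs w.
Proof. by rewrite -lecR rmorphD/= -!cabsE ler_normD. Qed.

End NormC.

Section Norms.
Context (R : realType) (d : nat) (M : nat -> R).
Local Notation C := R[i].
Implicit Types (f g : 'rV[R]_d -> C) (w : 'rV[R]_d -> R) (h : R).

Definition bnorm w h f : \bar R :=
  ereal_sup [set (h ^+ morder t.1 * cabs (cderiv t.1 f t.2) * w t.2
                  / M (morder t.1))%:E | t in [set: {ffun 'I_d -> nat} * 'rV[R]_d]].

(* The Banach space $\mathcal{B}^{M_p,h}_w$. *)
Definition banach_B w h : set ('rV[R]_d -> C) :=
  [set f | csmooth f /\ (bnorm w h f < +oo)%E].

(* The Frechet space $\mathcal{B}^{(M_p)}_w$. *)
Definition frechet_B w : set ('rV[R]_d -> C) :=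
  \bigcap_(h in [set h : R | 0 < h]) banach_B w h.

Lemma bnorm_leP w h f (e : R) : (bnorm w h f <= e%:E)%E <->
  forall alpha x,
    h ^+ morder alpha * cabs (cderiv alpha f x) * w x / M (morder alpha) <= e.
Proof.
split=> [fe alpha x|fe].
  rewrite -lee_fin; apply: le_trans fe; apply: ereal_sup_ubound.
  by exists (alpha, x).
by apply: ub_ereal_sup => _ [[alpha x] _ <-]; rewrite lee_fin.
Qed.

Lemma bnorm_ltyP w h f : (bnorm w h f < +oo)%E <->
  exists2 e : R, 0 < e & (bnorm w h f <= e%:E)%E.
Proof.
split=> [|[e _ /le_lt_trans]]; last by apply; exact: ltry.
case: (bnorm w h f) => [r _| |_] //; last by exists 1 => //; exact: leNye.
by exists (`|r| + 1); [rewrite ltr_wpDl|rewrite lee_fin (le_trans (ler_norm _))// lerDl].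
Qed.

End Norms.

Section FrechetSpace.
Context (R : realType) (d : nat) (M : weight_sequence R) (w : weight R d).
Local Notation C := R[i].
Implicit Types (f g : 'rV[R]_d -> C) (h e : R).

Lemma bnorm_lin (a : C) f g h e1 e2 : 0 < h -> csmooth f -> csmooth g ->
  (bnorm M w h f <= e1%:E)%E -> (bnorm M w h g <= e2%:E)%E ->
  (bnorm M w h (a *: f + g)%R <= (cabs a * e1 + e2)%:E)%E.
Proof.
move=> h0 sf sg /bnorm_leP fe /bnorm_leP ge; apply/bnorm_leP => alpha x.
apply: le_trans (lerD (ler_wpM2l (cabs_ge0 a) (fe alpha x)) (ge alpha x)).
have h1 : 0 <= h ^+ morder alpha by rewrite exprn_ge0// ltW.
have w1 : 0 <= w x / M (morder alpha).
  by rewrite divr_ge0// ltW ?weight_gt0 ?wseq_gt0.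
set F := cderiv alpha f x; set G := cderiv alpha g x.
rewrite -!(mulrA _ (w x)) [cabs a * _]mulrA -mulrDl ler_wpM2r//.
rewrite mulrCA -mulrDr ler_wpM2l// -cabsM cderiv_lin//.
exact: cabsD.
Qed.

Lemma bnorm0 h e : 0 <= e -> (bnorm M w h 0%R <= e%:E)%E.
Proof.
move=> e0; apply/bnorm_leP => alpha x.
by rewrite cderiv0 cabs0 mulr0 !mul0r.
Qed.

End FrechetSpace.

Lemma bnorm_mono (R : realType) (d : nat) (M : weight_sequence R)
    (w u : weight R d) (h k : R) f :
  0 < h -> h <= k -> (forall x, w x <= u x) ->
  (bnorm M w h f <= bnorm M u k f)%E.
Proof.
move=> h0 hk wu; apply: ub_ereal_sup => _ [[alpha x] _ <-] /=.
apply: le_trans (ereal_sup_ubound _); last by exists (alpha, x).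
rewrite lee_fin /= ler_wpM2r ?invr_ge0 ?(ltW (wseq_gt0 _ _))//.
have w0 := weight_gt0 w x.
rewrite ler_pM ?(ltW w0)// ?mulr_ge0 ?exprn_ge0 ?cabs_ge0//; [exact: ltW|].
rewrite ler_wpM2r ?cabs_ge0// lerXn2r// nnegrE ltW//.
exact: lt_le_trans hk.
Qed.

Section FunctionSpaces.
Context (R : realType) (d : nat) (M : weight_sequence R).
Local Notation C := R[i].

Definition frechet_pred (w : weight R d) : {pred 'rV[R]_d -> C} :=
  [pred f | `[< frechet_B M w f >]].

Lemma frechet_lin (w : weight R d) (a : C) f g :
  frechet_B M w f -> frechet_B M w g -> frechet_B M w (a *: f + g).
Proof.
move=> Bf Bg h h0; have [sf /bnorm_ltyP[e1 _ fe]] := Bf h h0.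
have [sg /bnorm_ltyP[e2 _ ge]] := Bg h h0; split; first exact: csmooth_lin.
exact: le_lt_trans (bnorm_lin a h0 sf sg fe ge) (ltry _).
Qed.

Lemma frechet0 (w : weight R d) : frechet_B M w 0.
Proof.
move=> h h0; split; first exact: csmooth0.
exact: le_lt_trans (bnorm0 M w h (lexx 0)) (ltry _).
Qed.

Lemma frechet_submod w : submod_closed (frechet_pred w).
Proof.
split=> [|a f g]; first by apply/asboolP; exact: frechet0.
by move=> /asboolP Bf /asboolP Bg; apply/asboolP; exact: frechet_lin.
Qed.

HB.instance Definition _ w :=
  GRing.isSubmodClosed.Build C ('rV[R]_d -> C) (frechet_pred w)
    (frechet_submod w).

Record frechet_vect (w : weight R d) := FrechetVect {
  frechet_fun :> 'rV[R]_d -> C;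
  frechet_funP : frechet_fun \in frechet_pred w
}.

HB.instance Definition _ w := [isSub for @frechet_fun w].
HB.instance Definition _ w := [Choice of frechet_vect w by <:].
HB.instance Definition _ w := [SubChoice_isSubLmodule of frechet_vect w by <:].

Variable V : weight_system R d.

Definition union_B : set ('rV[R]_d -> C) := \bigcup_n frechet_B M (V n).

Definition union_pred : {pred 'rV[R]_d -> C} := [pred f | `[< union_B f >]].

Lemma frechet_mono (m n : nat) : (m <= n)%N ->
  frechet_B M (V m) `<=` frechet_B M (V n).
Proof.
move=> mn f Bf h h0; have [sf fy] := Bf h h0; split=> //.
apply: le_lt_trans fy; apply: bnorm_mono => // x.
elim: n mn => [|n IH]; first by rewrite leqn0 => /eqP ->.
rewrite leq_eqVlt => /predU1P[->//|/IH]; apply: le_trans.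
exact: wsys_decr.
Qed.

Lemma union_submod : submod_closed union_pred.
Proof.
split=> [|a f g].
  by apply/asboolP; exists 0%N => //; exact: frechet0.
move=> /asboolP[m _ Bf] /asboolP[n _ Bg]; apply/asboolP.
exists (maxn m n) => //; apply: frechet_lin.
  exact: frechet_mono (leq_maxl m n) _ Bf.
exact: frechet_mono (leq_maxr m n) _ Bg.
Qed.

HB.instance Definition _ :=
  GRing.isSubmodClosed.Build C ('rV[R]_d -> C) union_pred union_submod.

Record union_vect := UnionVect {
  union_fun :> 'rV[R]_d -> C;
  union_funP : union_fun \in union_pred
}.

HB.instance Definition _ := [isSub for union_fun].
HB.instance Definition _ := [Choice of union_vect by <:].
HB.instance Definition _ := [SubChoice_isSubLmodule of union_vect by <:].

End FunctionSpaces.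

(* The projective limit topology: as the norms increase with [h], finite
   intersections of balls of different norms are not needed in the base. *)
Section FrechetTopology.
Context (R : realType) (d : nat) (M : weight_sequence R) (w : weight R d).
Local Notation C := R[i].
Local Notation X := (frechet_vect M w).

Definition frechet_ball (h e : R) : set X :=
  [set f | (bnorm M w h (f : X) <= e%:E)%E].

Definition frechet_nbhs0 : set_system X :=
  [set W | exists2 h, 0 < h & exists2 e, 0 < e & W = frechet_ball h e].

Lemma frechet_vect_smooth (f : X) : csmooth f.
Proof. by have /asboolP/(_ 1 ltr01)[] := frechet_funP f. Qed.

Lemma frechet_vect_lty (f : X) h : 0 < h ->
  exists2 e : R, 0 < e & (bnorm M w h f <= e%:E)%E.
Proof. by move=> h0; have /asboolP/(_ h h0)[_ /bnorm_ltyP] := frechet_funP f. Qed.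

Lemma frechet_ball_lin (a : C) (f g : X) h e1 e2 : 0 < h ->
  frechet_ball h e1 f -> frechet_ball h e2 g ->
  frechet_ball h (cabs a * e1 + e2) (a *: f + g).
Proof.
move=> h0 fe ge; exact: bnorm_lin h0 (frechet_vect_smooth f)
  (frechet_vect_smooth g) fe ge.
Qed.

Lemma frechet_ballZ (a : C) (f : X) h e : 0 < h ->
  frechet_ball h e f -> frechet_ball h (cabs a * e) (a *: f).
Proof.
move=> h0 fe; rewrite -[a *: f]addr0 -[cabs a * e]addr0.
by apply: frechet_ball_lin => //; exact: bnorm0.
Qed.

Let frechet_nbhs0T : exists W, frechet_nbhs0 W.
Proof. by exists (frechet_ball 1 1); exists 1 => //; exists 1. Qed.

Let frechet_nbhs0I W1 W2 : frechet_nbhs0 W1 -> frechet_nbhs0 W2 ->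
  exists2 W, frechet_nbhs0 W & W `<=` W1 `&` W2.
Proof.
move=> [h1 h10 [e1 e10 ->]] [h2 h20 [e2 e20 ->]].
exists (frechet_ball (Num.max h1 h2) (Num.min e1 e2)).
  exists (Num.max h1 h2); first by rewrite lt_max h10.
  by exists (Num.min e1 e2) => //; rewrite lt_min e10.
move=> f Wf; split.
- apply: le_trans (_ : (Num.min e1 e2)%:E <= _)%E; last first.
    by rewrite lee_fin ge_min lexx.
  apply: le_trans Wf; apply: bnorm_mono => //; by rewrite le_max lexx.
- apply: le_trans (_ : (Num.min e1 e2)%:E <= _)%E; last first.
    by rewrite lee_fin ge_min lexx orbT.
  apply: le_trans Wf; apply: bnorm_mono => //; by rewrite le_max lexx orbT.
Qed.

Let frechet_nbhs0_convex W : frechet_nbhs0 W -> absolutely_convex W.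
Proof.
move=> [h h0 [e e0 ->]]; split; last first.
  move=> a f a1 /(frechet_ballZ a h0) /le_trans; apply; rewrite lee_fin.
  by rewrite ler_piMl ?(ltW e0)// -lecR -cabsE.
apply/convex_setP => f g l l0 l1 fe ge.
apply: le_trans (frechet_ball_lin l h0 fe (frechet_ballZ (1 - l) h0 ge)) _.
rewrite lee_fin -mulrDl ler_piMl ?(ltW e0)// -lecR rmorphD/= -!cabsE.
by rewrite !ger0_norm ?subr_ge0// addrC subrK.
Qed.

Let frechet_nbhs0_absorbing W (f : X) : frechet_nbhs0 W ->
  exists2 r : C, 0 < r & W (r *: f).
Proof.
move=> [h h0 [e e0 ->]]; have [c c0 fc] := frechet_vect_lty f h0.
have ec : 0 < e / c by rewrite divr_gt0.
exists (e / c)%:C%C; first by rewrite ltcR.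
apply: le_trans (frechet_ballZ _ h0 fc) _; rewrite lee_fin.
have -> : cabs (e / c)%:C%C = e / c.
  by apply: complexI; rewrite -cabsE ger0_norm// lecR ltW.
by rewrite divfK// gt_eqF.
Qed.

Let frechet_nbhs0_scale W (r : C) : frechet_nbhs0 W -> 0 < r ->
  exists2 W', frechet_nbhs0 W' & W' `<=` [set f | W (r *: f)].
Proof.
move=> [h h0 [e e0 ->]] r0.
have cr : 0 < cabs r by rewrite -ltcR -cabsE normr_gt0 gt_eqF.
exists (frechet_ball h (e / cabs r)).
  by exists h => //; exists (e / cabs r) => //; rewrite divr_gt0.
move=> f /(frechet_ballZ r h0) /le_trans; apply; rewrite lee_fin.
by rewrite mulrC divfK// gt_eqF.
Qed.

Definition frechet_base : lc_base X := LcBase frechet_nbhs0T frechet_nbhs0I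
  frechet_nbhs0_convex frechet_nbhs0_absorbing frechet_nbhs0_scale.

Definition frechet_space : tvsType C := lc_space frechet_base.

End FrechetTopology.

Section Spectrum.
Context (R : realType) (d : nat) (M : weight_sequence R) (V : weight_system R d).
Local Notation C := R[i].

Lemma frechet_inclP n (f : frechet_vect M (V n)) :
  (f : 'rV[R]_d -> C) \in union_pred M V.
Proof. by apply/asboolP; exists n => //; apply/asboolP/frechet_funP. Qed.

Lemma frechet_linkP n (f : frechet_vect M (V n)) :
  (f : 'rV[R]_d -> C) \in frechet_pred M (V n.+1).
Proof.
apply/asboolP; apply: (frechet_mono (leqnSn n)).
exact/asboolP/frechet_funP.
Qed.

Definition frechet_incl n (f : frechet_space M (V n)) : union_vect M V :=
  UnionVect (frechet_inclP f).

Definition frechet_link n (f : frechet_space M (V n)) : frechet_space M (V n.+1) :=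
  FrechetVect (frechet_linkP f).

Lemma frechet_incl_is_linear n : linear (@frechet_incl n).
Proof. by move=> a f g; apply: val_inj. Qed.

HB.instance Definition _ n := GRing.isLinear.Build C
  (frechet_space M (V n)) (union_vect M V) _ (@frechet_incl n)
  (@frechet_incl_is_linear n).

Lemma frechet_link_is_linear n : linear (@frechet_link n).
Proof. by move=> a f g; apply: val_inj. Qed.

HB.instance Definition _ n := GRing.isLinear.Build C
  (frechet_space M (V n)) (frechet_space M (V n.+1)) _ (@frechet_link n)
  (@frechet_link_is_linear n).

Lemma frechet_incl_inj n : injective (@frechet_incl n).
Proof. by move=> f g /(congr1 val) fg; apply: val_inj. Qed.

Lemma frechet_incl_link n f :
  frechet_incl (@frechet_link n f) = frechet_incl f.
Proof. exact: val_inj. Qed.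

Lemma frechet_link_continuous n : continuous (@frechet_link n).
Proof.
move=> f U [W [h h0 [e e0 ->]] WU].
exists (frechet_ball h e); first by exists h => //; exists e.
move=> g ge /=; rewrite linearD; apply: WU.
apply: le_trans ge; apply: bnorm_mono => //; exact: wsys_decr.
Qed.

Lemma frechet_incl_cover (f : union_vect M V) :
  exists n, range (@frechet_incl n) f.
Proof.
have /asboolP[n _ Bf] := union_funP f; exists n.
have fB : (f : 'rV[R]_d -> C) \in frechet_pred M (V n) by exact/asboolP.
by exists (FrechetVect fB) => //; exact: val_inj.
Qed.

Definition B_spectrum : lc_spectrum (union_vect M V) :=
  LcSpectrum frechet_incl_inj frechet_incl_link frechet_link_continuous
    frechet_incl_cover.

End Spectrum.

(* Main.v *)
(* Everything is read off condition (Q): for every n there are a 0-neighborhood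
   of the step n and m > n such that on this neighborhood each norm of the step
   m is at most e + C * (some norm of the step k), for all k and e > 0.
   Interpolating v_m <= C v_n^(1-t) v_k^t turns Omega into (Q); in a regularly
   decreasing system every n admits m with v_m <= e v_n + D v_k for all k > m
   and e > 0 (D depending on k and e), so that (wQ) already gives (Q).
   Bounded retractivity also implies (Q). Condition (Q) yields, following
   Retakh, increasing absolutely convex 0-neighborhoods of the steps on which the
   topologies of all later steps agree, whence completeness and bounded
   retractivity.
   A gliding hump shows that completeness implies regularity, and a bounded
   double sequence contradicts regularity if (wQ) fails.
   For the converse, (wQ) is tested with cos(xi x_1) + sin(xi x_1) times a
   compactly supported function equal to 1 near the point under consideration,
   which exists by (M.3). With xi chosen through the associated function of M,
   this gives v_m <= D (v_n / r + r^L v_k) for all r >= 1, hence Omega by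
   optimizing r. *)
Require Import Defs.
From mathcomp Require Import all_boot all_order all_algebra.
From mathcomp Require Import complex.
From mathcomp Require Import ring lra.
From mathcomp Require Import boolp classical_sets functions reals ereal.
From mathcomp Require Import topology normedtype sequences derive exp trigo.

Set Implicit Arguments.
Unset Strict Implicit.
Unset Printing Implicit Defensive.

Import Defs.
Import Order.TTheory GRing.Theory Num.Theory.
Import numFieldNormedType.Exports.

Local Open Scope classical_set_scope.
Local Open Scope ring_scope.

(** All steps sit in one vector space, and topological statements are reduced to inequalities
    between the values [q n j f]. In these terms (wQ) bounds a norm of the step m by a multiple of
    the other two norms, while (Q) makes the coefficient of the first one arbitrarily small; only
    such smallness allows a term to be absorbed or a reduction to be repeated along infinitely many
    steps. The obstacle to completeness is that no member of a Cauchy filter need lie in one step.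
    What can be forced into one fixed set of Retakh's sequence is, for each member and each
    neighborhood of 0, some difference b - o of their elements; suitable differences form a Cauchy
    sequence in a single Frechet space. In the converse, the norms of the test function at frequency
    xi are bounded by a value of [assoc M] at a multiple of xi, times a weight. (M.2) puts a product
    of two such values on the left: one cancels against the term of V_n, the other becomes r. The
    index l given by (wQ) may be much larger than the index i of the first norm; (M.3), used a
    second time, bounds the value at the larger multiple of xi by a power of the value at the
    smaller one, whence r^L. *)

Section AbsolutelyConvexSets.
Context (R : realType) (E : lmodType R[i]).
Implicit Types (A W : set E) (x y : E).

Lemma cabs_real (a : R) : cabs a%:C%C = `|a|.
Proof. by rewrite /cabs normc_def /= expr0n/= addr0 sqrtr_sqr. Qed.

Lemma acxN A x : absolutely_convex A -> A x -> A (- x).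
Proof. by move=> [_ bA] Ax; rewrite -scaleN1r; apply: bA; rewrite ?normrN1. Qed.

Lemma acx_half A x y : absolutely_convex A -> A x -> A y ->
  A (2%:R^-1 *: (x + y)).
Proof.
move=> [/convex_setP cA _] Ax Ay.
have h0 : 0 <= 2%:R^-1 :> R[i] by rewrite invr_ge0 ler0n.
have h1 : 2%:R^-1 <= 1 :> R[i] by rewrite invf_le1 ?ltr0n// ler1n.
have := cA _ _ _ h0 h1 Ax Ay.
have -> : 1 - 2%:R^-1 = 2%:R^-1 :> R[i].
  by rewrite {1}[1](splitr (1 : R[i])) mul1r addrK.
by rewrite scalerDr.
Qed.

Lemma normC_le1 (t : R) : 0 <= t -> t <= 1 -> `|t%:C%C : R[i]| <= 1.
Proof. by move=> t0 t1; rewrite ger0_norm ?ler0c// lecR. Qed.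

Lemma acxZ A x (t : R) : absolutely_convex A -> 0 <= t -> t <= 1 -> A x ->
  A (t%:C%C *: x).
Proof. by move=> [_ bA] t0 t1; apply: bA; exact: normC_le1. Qed.

Lemma acx_shrink A x (s t : R) : absolutely_convex A -> 0 <= s -> s <= t ->
  A (t%:C%C *: x) -> A (s%:C%C *: x).
Proof.
move=> cA s0 st At; have [t0|t0] := leP t 0.
  have -> : s = t by apply/eqP; rewrite eq_le st (le_trans t0).
  by [].
rewrite -(divfK (lt0r_neq0 t0) s) rmorphM -scalerA; apply: acxZ => //.
  by rewrite divr_ge0// ltW.
by rewrite ler_pdivrMr// mul1r.
Qed.

Lemma acx_setI A W : absolutely_convex A -> absolutely_convex W ->
  absolutely_convex (A `&` W).
Proof.
move=> [/convex_setP cA bA] [/convex_setP cW bW]; split.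
  by apply/convex_setP => x y l l0 l1 [? ?] [? ?]; split; [exact: cA|exact: cW].
by move=> a x a1 [? ?]; split; [exact: bA|exact: bW].
Qed.

Lemma acx_preimageZ A (a : R[i]) : absolutely_convex A ->
  absolutely_convex [set x | A (a *: x)].
Proof.
move=> [/convex_setP cA bA]; split.
  apply/convex_setP => x y l l0 l1 Ax Ay /=.
  by rewrite scalerDr !scalerA ![a * _]mulrC -!scalerA; exact: cA.
by move=> c x c1 Ax /=; rewrite scalerA mulrC -scalerA; exact: bA.
Qed.

End AbsolutelyConvexSets.

(* The norms defining a sequence of Frechet spaces inside [E]: the n-th one is
   [stepset n], its topology is given by the norms [gnorm n j], [j : nat]. *)
Record norm_grid (R : realType) (E : lmodType R[i]) := NormGrid {
  gnorm :> nat -> nat -> E -> \bar R;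
  gnorm0 : forall n j, gnorm n j 0 = 0%E;
  gnorm_ge0 : forall n j f, (0 <= gnorm n j f)%E;
  gnormD : forall n j f g (a b : R), (gnorm n j f <= a%:E)%E ->
    (gnorm n j g <= b%:E)%E -> (gnorm n j (f + g)%R <= (a + b)%:E)%E;
  gnormZ : forall n j (c : R[i]) f (a : R), (gnorm n j f <= a%:E)%E ->
    (gnorm n j (c *: f)%R <= (cabs c * a)%:E)%E;
  gnorm_incr : forall n j f, (gnorm n j f <= gnorm n j.+1 f)%E;
  gnorm_decr : forall n j f, (gnorm n.+1 j f <= gnorm n j f)%E;
  gnorm_cover : forall f, exists n, forall j, (gnorm n j f < +oo)%E
}.

Section NormGridTheory.
Context (R : realType) (E : lmodType R[i]) (q : norm_grid E).
Implicit Types (f g x y : E) (n m k i j l : nat) (A W O : set E) (e s t : R).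

Definition stepset n : set E := [set f | forall j, (q n j f < +oo)%E].

Lemma gnorm_lty n j f : (q n j f < +oo)%E ->
  exists e, [/\ 0 <= e, q n j f = e%:E & forall a, (q n j f <= a%:E)%E = (e <= a)].
Proof.
have := gnorm_ge0 q n j f; case: (q n j f) => [e| |]//; rewrite lee_fin => e0 _.
by exists e; split => // a; rewrite lee_fin.
Qed.

Lemma gnorm_bounded n f j : stepset n f -> exists2 e, 0 < e & (q n j f <= e%:E)%E.
Proof.
move=> /(_ j) /gnorm_lty[e [e0 -> _]]; exists (e + 1).
  by rewrite ltr_wpDl.
by rewrite lee_fin lerDl.
Qed.

Lemma gnorm_le_trans n j f e s : (q n j f <= e%:E)%E -> e <= s ->
  (q n j f <= s%:E)%E.
Proof. by move=> /le_trans + es; apply; rewrite lee_fin. Qed.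

Lemma gnorm_mono n m i j f : (n <= m)%N -> (i <= j)%N ->
  (q m i f <= q n j f)%E.
Proof.
move=> nm ij; apply: (@le_trans _ _ (q n i f)).
  elim: m nm => [|m IH]; first by rewrite leqn0 => /eqP ->.
  by rewrite leq_eqVlt => /predU1P[->//|/IH]; apply: le_trans; exact: gnorm_decr.
elim: j ij => [|j IH]; first by rewrite leqn0 => /eqP ->.
rewrite leq_eqVlt => /predU1P[->//|/IH] /le_trans; apply; exact: gnorm_incr.
Qed.

Lemma gnormZr n j t f e : 0 <= t -> (q n j f <= e%:E)%E ->
  (q n j (t%:C%C *: f)%R <= (t * e)%:E)%E.
Proof. by move=> t0 /(gnormZ t%:C%C); rewrite cabs_real ger0_norm. Qed.

Lemma gnormZr_inv n j t f e : 0 < t -> (q n j (t%:C%C *: f)%R <= e%:E)%E ->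
  (q n j f <= (e / t)%:E)%E.
Proof.
move=> t0 /(gnormZr (t := t^-1)); rewrite invr_ge0 (ltW t0) => /(_ isT).
by rewrite scalerA -rmorphM/= mulVf ?gt_eqF// scale1r mulrC.
Qed.

Lemma stepset0 n : stepset n 0.
Proof. by move=> j; rewrite gnorm0. Qed.

Lemma stepsetD n f g : stepset n f -> stepset n g -> stepset n (f + g).
Proof.
move=> nf ng j; have [a _ fa] := gnorm_bounded j nf.
have [b _ gb] := gnorm_bounded j ng.
exact: le_lt_trans (gnormD fa gb) (ltry _).
Qed.

Lemma stepsetZ n (c : R[i]) f : stepset n f -> stepset n (c *: f).
Proof.
move=> nf j; have [a _ fa] := gnorm_bounded j nf.
exact: le_lt_trans (gnormZ c fa) (ltry _).
Qed.

Lemma stepsetN n f : stepset n f -> stepset n (- f).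
Proof. by rewrite -scaleN1r; exact: stepsetZ. Qed.

Lemma stepsetB n f g : stepset n f -> stepset n g -> stepset n (f - g).
Proof. by move=> nf /stepsetN; exact: stepsetD. Qed.

Lemma stepset_mono n m : (n <= m)%N -> stepset n `<=` stepset m.
Proof. by move=> nm f nf j; apply: le_lt_trans (nf j); exact: gnorm_mono. Qed.

Lemma gnormN n j f : q n j (- f) = q n j f.
Proof.
have H g : (q n j (- g)%R <= q n j g)%E.
  have [->|] := eqVneq (q n j g) +oo%E; first exact: leey.
  rewrite -ltey => /gnorm_lty[a [_ ga _]]; rewrite ga -scaleN1r.
  have := @gnormZ _ _ q n j (-1) g a; rewrite ga lexx => /(_ isT).
  by rewrite /cabs normrN1 mul1r.
by apply/eqP; rewrite eq_le H/= -{1}(opprK f) H.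
Qed.

Lemma gnormB n j f g (a b : R) : (q n j f <= a%:E)%E -> (q n j g <= b%:E)%E ->
  (q n j (f - g)%R <= (a + b)%:E)%E.
Proof. by move=> fa gb; apply: gnormD; rewrite ?gnormN. Qed.

Lemma gball_acx n j e : absolutely_convex [set f | (q n j f <= e%:E)%E].
Proof.
split=> [|a f a1 /= fe].
  apply/convex_setP => f g l l0 l1 fe ge.
  have := gnormD (gnormZ l fe) (gnormZ (1 - l) ge).
  have -> : cabs l * e + cabs (1 - l) * e = e; last by [].
  rewrite -mulrDl; have -> : cabs l + cabs (1 - l) = 1; last by rewrite mul1r.
  apply: complexI; rewrite rmorphD/= -!cabsE !ger0_norm ?subr_ge0//.
  by rewrite addrC subrK.
(* For negative [e] the ball is empty, the norms being nonnegative. *)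
have [e0|e0] := leP 0 e.
  by apply: le_trans (gnormZ a fe) _; rewrite lee_fin ler_piMl// -lecR -cabsE.
by have := le_trans (gnorm_ge0 q n j f) fe; rewrite lee_fin leNgt e0.
Qed.

Lemma stepset_acx n : absolutely_convex (stepset n).
Proof.
split=> [|a f _]; last exact: stepsetZ.
by apply/convex_setP => f g l _ _ nf ng; apply: stepsetD; exact: stepsetZ.
Qed.

End NormGridTheory.

(** * Neighborhoods of 0 in the steps and in their union *)

Section Neighborhoods.
Context (R : realType) (E : lmodType R[i]) (q : norm_grid E).
Implicit Types (f g x y : E) (n m k i j l : nat) (A W O : set E) (e s t : R).

(** A single ball suffices, since the norms of a step increase with their index. *)
Definition step_nbhs n W :=
  exists l, exists2 e : R, 0 < e &
    forall f, stepset q n f -> (q n l f <= e%:E)%E -> W f.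

Definition union_nbhs W := absolutely_convex W /\ forall n, step_nbhs n W.

Lemma step_nbhsI n A W : step_nbhs n A -> step_nbhs n W -> step_nbhs n (A `&` W).
Proof.
move=> [l [e e0 Ae]] [k [s s0 Ws]]; exists (maxn l k), (Num.min e s).
  by rewrite lt_min e0.
move=> f nf fe; split.
- apply: Ae => //; apply: le_trans (gnorm_mono q f (leqnn n) (leq_maxl l k)) _.
  by apply: gnorm_le_trans fe _; rewrite ge_min lexx.
- apply: Ws => //; apply: le_trans (gnorm_mono q f (leqnn n) (leq_maxr l k)) _.
  by apply: gnorm_le_trans fe _; rewrite ge_min lexx orbT.
Qed.

Lemma step_nbhsW n A W : A `<=` W -> step_nbhs n A -> step_nbhs n W.
Proof. by move=> AW [l [e e0 Ae]]; exists l, e => // f nf /Ae => /(_ nf) /AW. Qed.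

Lemma step_nbhs_mono n m W : (n <= m)%N -> step_nbhs m W -> step_nbhs n W.
Proof.
move=> nm [l [e e0 We]]; exists l, e => // f nf fe.
apply: We; first exact: stepset_mono nf.
exact: le_trans (gnorm_mono q f nm (leqnn l)) fe.
Qed.

Lemma step_nbhs_ball n l e : 0 < e -> step_nbhs n [set f | (q n l f <= e%:E)%E].
Proof. by move=> e0; exists l, e. Qed.

Lemma union_nbhsI A W : union_nbhs A -> union_nbhs W -> union_nbhs (A `&` W).
Proof.
move=> [cA nA] [cW nW]; split; first exact: acx_setI.
by move=> n; exact: step_nbhsI.
Qed.

Lemma union_nbhsZ W (a : R) : union_nbhs W -> 0 < a ->
  union_nbhs [set x | W (a%:C%C *: x)].
Proof.
move=> [cW nW] a0; split; first exact: acx_preimageZ.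
move=> n; have [l [e e0 We]] := nW n; exists l, (e / a).
  by rewrite divr_gt0.
move=> f nf fe /=; apply: We; first exact: stepsetZ.
by apply: gnorm_le_trans (gnormZr (ltW a0) fe) _; rewrite mulrC divfK// gt_eqF.
Qed.

Lemma union_nbhs_half W : union_nbhs W ->
  exists2 O, union_nbhs O & forall x y, O x -> O y -> W (x + y).
Proof.
move=> nW; exists [set x | W ((2%:R : R)%:C%C *: x)].
  exact: union_nbhsZ.
move=> x y /= Wx Wy; apply: absolutely_convexD; first exact: nW.1.
  by move: Wx; rewrite rmorph_nat.
by move: Wy; rewrite rmorph_nat.
Qed.

Lemma union_nbhs0 W : union_nbhs W -> W 0.
Proof.
move=> [cW nW]; have [l [e e0 We]] := nW 0%N.
by apply: We; [exact: stepset0|rewrite gnorm0 lee_fin ltW].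
Qed.

Lemma union_nbhs_absorb W x : union_nbhs W ->
  exists2 r : R, 0 < r & W (r%:C%C *: x).
Proof.
move=> [cW nW]; have [n nx] := gnorm_cover q x.
have [l [e e0 We]] := nW n; have [s s0 xs] := gnorm_bounded l nx.
exists (e / s); first by rewrite divr_gt0.
apply: We; first exact: stepsetZ.
have es : 0 <= e / s by rewrite divr_ge0// ltW.
by apply: gnorm_le_trans (gnormZr es xs) _; rewrite divfK// gt_eqF.
Qed.

Definition finite_sums (V : nat -> set E) : set E :=
  [set x | exists K (v : nat -> E),
     (forall i, V i (v i)) /\ x = \sum_(i < K) v i].

(** Sums with one nonzero term already contain each [V i], and every step lies below some [n i].
    Convexity is checked termwise, after padding both sums with zeros to a common length. *)
Lemma finite_sums_nbhs (V : nat -> set E) (n : nat -> nat) :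
  (forall i, absolutely_convex (V i)) -> (forall i, step_nbhs (n i) (V i)) ->
  (forall N, exists i, (N <= n i)%N) -> union_nbhs (finite_sums V).
Proof.
move=> cV nV nC.
have V0 i : V i 0.
  have [l [e e0 Ve]] := nV i.
  by apply: Ve; [exact: stepset0|rewrite gnorm0 lee_fin ltW].
have ext K L (v : nat -> E) : (K <= L)%N ->
    \sum_(i < K) v i = \sum_(i < L) (if (i < K)%N then v i else 0).
  by move=> KL; rewrite -big_mkcond/= (big_ord_widen_cond L (fun=> true)).
split; last first.
  move=> N; have [i Ni] := nC N; apply: (step_nbhs_mono Ni).
  apply: step_nbhsW (nV i) => x Vx.
  exists i.+1, (fun j => if j == i then x else 0); split.
    by move=> j; case: eqP => [->|].
  rewrite big_ord_recr/= eqxx big1 ?add0r// => j _.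
  by rewrite ltn_eqF.
split; last first.
  move=> a _ a1 [K [v [Vv ->]]]; exists K, (fun i => a *: v i).
  split; last by rewrite scaler_sumr.
  by move=> i; have [_ bV] := cV i; exact: bV.
apply/convex_setP => x y c c0 c1 [K [v [Vv ->]]] [L [w [Vw ->]]].
pose u (M : nat) (v : nat -> E) i := if (i < M)%N then v i else 0.
exists (maxn K L), (fun i => c *: u K v i + (1 - c) *: u L w i); split.
  move=> i; have [/convex_setP cVi _] := cV i; apply: cVi => //;
    by rewrite /u; case: ifP.
rewrite (ext K (maxn K L) v) ?leq_maxl// (ext L (maxn K L) w) ?leq_maxr//.
by rewrite big_split/= !scaler_sumr.
Qed.

End Neighborhoods.

(** * Retakh's condition and nested sets with coinciding topologies *)

Section RetakhSequence.
Context (R : realType) (E : lmodType R[i]) (q : norm_grid E).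
Implicit Types (f g x y : E) (n m k i j l : nat) (A W O : set E) (e s t : R).

(** The scales [s] and [t] stand for the two norms on the right, so that the estimate avoids
    arithmetic with infinite values and stays homogeneous. *)
Definition cond_Q := forall n, exists i m, (n < m)%N /\
  forall k j e, 0 < e -> exists l, exists2 C : R, 0 < C &
    forall f s t, stepset q n f -> 0 < s -> 0 < t ->
      (q n i f <= s%:E)%E -> (q k l f <= t%:E)%E ->
      (q m j f <= (e * s + C * t)%:E)%E.

(* On absolutely convex [A]: the topology of the step [m] is that of every
   later step. *)
Definition coinciding m A := forall k j e, 0 < e ->
  exists l, exists2 C : R, 0 < C &
    forall f t, A f -> 0 < t -> (q k l f <= t%:E)%E ->
      (q m j f <= (e + C * t)%:E)%E.

Definition retakh_set n m A :=
  [/\ (n < m)%N, absolutely_convex A, A `<=` stepset q n, step_nbhs q n A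
    & coinciding m A].

Hypothesis Q : cond_Q.

Lemma retakh_first : exists n m A, retakh_set n m A.
Proof.
have [i [m [m0 Qm]]] := Q 0; exists 0%N, m.
exists (stepset q 0 `&` [set f | (q 0%N i f <= 1%:E)%E]).
split=> //.
- by apply: acx_setI; [exact: stepset_acx|exact: gball_acx].
- by exists i, 1.
- move=> k j e e0; have [l [C C0 H]] := Qm k j e e0; exists l, C => //.
  by move=> f t [f0 f1] t0 ft; have := H f 1 t f0 ltr01 t0 f1 ft; rewrite mulr1.
Qed.

(* The given neighborhoods in condition (Q) need not be nested. The set [A] is
   enlarged by a neighborhood of 0 in the step [m] which is small already in the
   step [m']; absorbing the norm of the step [m'] then yields coincidence with
   all later steps. *)
Lemma retakh_next n m A : retakh_set n m A ->
  exists m' A', retakh_set m m' A' /\ (forall x y, A x -> A y -> A' (x + y)).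
Proof.
move=> [nm cA An nA coA]; have [i [m' [mm' Qm]]] := Q m.
have [l1 [C1 C10 A1]] := coA m' i 1 ltr01.
pose G := stepset q m `&` ([set f | (q m i f <= 1%:E)%E] `&`
                           [set f | (q m' l1 f <= C1^-1%:E)%E]).
have cG : absolutely_convex G.
  by apply: acx_setI; [exact: stepset_acx|apply: acx_setI; exact: gball_acx].
have nG : step_nbhs q m G.
  apply: step_nbhsI; first by exists 0%N, 1.
  apply: step_nbhsI; first exact: step_nbhs_ball.
  apply: (step_nbhs_mono (ltnW mm')); apply: step_nbhs_ball.
  by rewrite invr_gt0.
pose A' := [set x | exists a b, [/\ A a, G b & x = 2%:R *: a + b]].
have G0 : G 0.
  split; first exact: stepset0.
  by split; rewrite /= gnorm0 lee_fin ?invr_ge0 ?(ltW C10).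
have A0 : A 0.
  have [l [e e0 Ae]] := nA; apply: Ae; first exact: stepset0.
  by rewrite gnorm0 lee_fin ltW.
exists m', A'; split; last first.
  move=> x y Ax Ay; exists (2%:R^-1 *: (x + y)), 0; split=> //.
    exact: acx_half.
  by rewrite scalerA mulfV ?pnatr_eq0// scale1r addr0.
split=> //.
- split.
    apply/convex_setP => x y c c0 c1 [a [b [Aa Gb ->]]] [a' [b' [Aa' Gb' ->]]].
    exists (c *: a + (1 - c) *: a'), (c *: b + (1 - c) *: b').
    have [/convex_setP cA' _] := cA; have [/convex_setP cG' _] := cG.
    split; [exact: cA'|exact: cG'|].
    rewrite !scalerDr !scalerA ![_ * 2%:R]mulrC.
    by rewrite addrACA.
  move=> c x c1 [a [b [Aa Gb ->]]]; exists (c *: a), (c *: b).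
  split; [by have [_] := cA; apply|by have [_] := cG; apply|].
  by rewrite scalerDr !scalerA [_ * 2%:R]mulrC.
- move=> _ [a [b [Aa [mb _] ->]]]; apply: stepsetD => //; apply: stepsetZ.
  by apply: (stepset_mono (ltnW nm)); exact: An.
- by apply: step_nbhsW nG => b Gb; exists 0, b; rewrite scaler0 add0r.
(* For x = 2a + b the norm [q m' l1] of a is at most (t + 1/C1)/2, so coincidence on [A] with
   tolerance 1 gives 2 (1 + (C1 t + 1)/2) + 1 = 4 + C1 t. *)
have key x t : A' x -> 0 < t -> (q m' l1 x <= t%:E)%E ->
    (q m i x <= (5 + C1 * t)%:E)%E.
  move=> [a [b [Aa [mb [b1 bC]] ->]]] t0 xt.
  have at_ : (q m' l1 a <= ((t + C1^-1) / 2%:R)%:E)%E.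
    apply: gnormZr_inv => //; rewrite rmorph_nat.
    by have := gnormB xt bC; rewrite addrK.
  have tC : 0 < (t + C1^-1) / 2%:R by rewrite divr_gt0// addr_gt0 ?invr_gt0.
  have := gnormD (gnormZr (ltW (ltr0Sn R 1)) (A1 _ _ Aa tC at_)) b1.
  rewrite rmorph_nat => /gnorm_le_trans; apply.
  rewrite -[X in _ <= _ + X]addr0 mulrDr mulr1 mulrCA [C1 * _]mulrC.
  have := mulVf (lt0r_neq0 C10); nra.
have memA' x : A' x -> stepset q m x.
  move=> [a [b [Aa [mb _] ->]]]; apply: stepsetD => //; apply: stepsetZ.
  by apply: (stepset_mono (ltnW nm)); exact: An.
(* With u the norm [q m' l1] of x, (Q) and [key] give u <= d (5 + C1 u) + C t. Since d C1 <= 1/2 the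
   term in u is absorbed, and d <= e/20 leaves 10 d + 2 C t <= e + 2 C t. *)
have boot k e : 0 < e -> exists l, exists2 C : R, 0 < C &
    forall x t, A' x -> 0 < t -> (q k l x <= t%:E)%E ->
      (q m' l1 x <= (e + C * t)%:E)%E.
  move=> e0; pose d := Num.min ((2%:R * C1)^-1) (e / 20%:R).
  have d0 : 0 < d by rewrite lt_min invr_gt0 mulr_gt0// divr_gt0.
  have [l [C C0 H]] := Qm k l1 d d0; exists l, (2%:R * C); first by rewrite mulr_gt0.
  move=> x t A'x t0 xt; have mx := memA' _ A'x.
  have [u [u0 xu ule]] := gnorm_lty (stepset_mono (ltnW mm') mx l1).
  (* The norm u may vanish, whereas [key] wants a positive scale; hence the slack r. *)
  rewrite ule; apply/ler_addgt0Pr => r r0.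
  have ur : 0 < u + r by rewrite ltr_wpDl.
  have xr : (q m' l1 x <= (u + r)%:E)%E by rewrite ule lerDl ltW.
  have sp : 0 < 5 + C1 * (u + r) by rewrite addr_gt0 ?mulr_gt0.
  have := H x _ t mx sp t0 (key x _ A'x ur xr) xt; rewrite ule => H1.
  have dC : 0 <= 2%:R^-1 - d * C1.
    by rewrite subr_ge0 -ler_pdivlMr// -invfM ge_min lexx.
  have de : d <= e / 20%:R by rewrite ge_min lexx orbT.
  have := mulr_ge0 dC u0; have := mulr_ge0 dC (ltW r0); nra.
(* With [boot] at tolerance 1/C1, [key] bounds the norm [q m i] by 6 + C1 C3 t, and e/12 times this
   is at most e + e C1 C3 t. *)
move=> k j e e0; have e2 : 0 < e / 12%:R by rewrite divr_gt0.
have [l2 [C2 C20 H2]] := Qm k j _ e2.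
have [l3 [C3 C30 H3]] := boot k _ (eqbRL (invr_gt0 C1) C10).
exists (maxn l2 l3), (e * C1 * C3 + C2).
  by rewrite addr_gt0// !mulr_gt0.
move=> f t A'f t0 ft; have mf := memA' _ A'f.
have f2 : (q k l2 f <= t%:E)%E.
  exact: le_trans (gnorm_mono q f (leqnn k) (leq_maxl _ _)) ft.
have f3 : (q k l3 f <= t%:E)%E.
  exact: le_trans (gnorm_mono q f (leqnn k) (leq_maxr _ _)) ft.
have p3 : 0 < C1^-1 + C3 * t by rewrite addr_gt0 ?invr_gt0// mulr_gt0.
have p5 : 0 < 5 + C1 * (C1^-1 + C3 * t) by rewrite addr_gt0 ?mulr_gt0.
have := H2 f _ t mf p5 t0 (key f _ A'f p3 (H3 f t A'f t0 f3)) f2.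
move=> /gnorm_le_trans; apply.
rewrite [C1 * (C1^-1 + _)]mulrDr mulfV ?gt_eqF//.
have : 0 < e * (C1 * (C3 * t)) by rewrite !mulr_gt0.
nra.
Qed.

End RetakhSequence.

Section RetakhChain.
Context (R : realType) (E : lmodType R[i]) (q : norm_grid E).
Implicit Types (f g x y : E) (n m k i j l : nat) (A W O : set E) (e s t : R).

Definition retakh_chain (n : nat -> nat) (A : nat -> set E) :=
  (forall j, retakh_set q (n j) (n j.+1) (A j)) /\
  (forall j x y, A j x -> A j y -> A j.+1 (x + y)).

(** The step from which the topologies on [A j] agree is taken as the home of [A j.+1]; the relation
    [rel] glues consecutive triples in this way. *)
Lemma retakh_chain_exists : cond_Q q ->
  exists (n : nat -> nat) (A : nat -> set E), retakh_chain n A.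
Proof.
move=> Q; pose T := {z : nat * nat * set E | retakh_set q z.1.1 z.1.2 z.2}.
pose rel (z z' : T) := (sval z).1.2 = (sval z').1.1 /\
  forall x y, (sval z).2 x -> (sval z).2 y -> (sval z').2 (x + y).
have next z : {z' : T | rel z z'}.
  apply: cid; case: z => -[[n m] A] /= nmA.
  have [m' [A' [mA' AA']]] := retakh_next Q nmA.
  by exists (exist _ (m, m', A') mA').
have [n [m [A nmA]]] := retakh_first Q.
have [z [_ zr]] := dependent_choice next (exist _ (n, m, A) nmA).
exists (fun j => (sval (z j)).1.1), (fun j => (sval (z j)).2); split=> j.
  by have [<- _] := zr j; exact: svalP (z j).
by have [_] := zr j.
Qed.

Context (n : nat -> nat) (A : nat -> set E) (nA : retakh_chain n A).

Lemma chain_acx j : absolutely_convex (A j). Proof. by case: (nA.1 j). Qed.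

Lemma chain_nbhs j : step_nbhs q (n j) (A j). Proof. by case: (nA.1 j). Qed.

Lemma chain_step j : A j `<=` stepset q (n j). Proof. by case: (nA.1 j). Qed.

Lemma chainD j x y : A j x -> A j y -> A j.+1 (x + y).
Proof. exact: nA.2. Qed.

Lemma chain_ge j : (j <= n j)%N.
Proof.
elim: j => // j IH; apply: leq_ltn_trans IH _.
by case: (nA.1 j).
Qed.

Lemma chain0 j : A j 0.
Proof.
have [l [e e0 Ae]] := chain_nbhs j.
by apply: Ae; [exact: stepset0|rewrite gnorm0 lee_fin ltW].
Qed.

Lemma chain_mono i j : (i <= j)%N -> A i `<=` A j.
Proof.
move=> + x Ax; elim: j => [|j IH]; first by rewrite leqn0 => /eqP <-.
rewrite leq_eqVlt => /predU1P[<-//|/IH Aj].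
by rewrite -[x]addr0; apply: chainD => //; exact: chain0.
Qed.

Lemma chain_sum K (v : nat -> E) : (forall i, A i (v i)) ->
  A K (\sum_(i < K) v i).
Proof.
move=> Av; elim: K => [|K IH]; first by rewrite big_ord0; exact: chain0.
by rewrite big_ord_recr/=; exact: chainD.
Qed.

(** By [chainD] the set [A j.+1] contains twice [A j]. Once 2^-s [B] lies in [A m], the set [B] lies
    in [A (m + s)]. *)
Lemma chain_absorb m (B : set E) : B `<=` stepset q m ->
  (forall l, exists e, forall f, B f -> (q m l f <= e%:E)%E) ->
  exists j, B `<=` A j.
Proof.
move=> Bm Bb; have [l [e e0 Ae]] := step_nbhs_mono (chain_ge m) (chain_nbhs m).
have [b Be] := Bb l.
have [s bs] : exists s : nat, b <= e * 2%:R ^+ s.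
  exists (Num.bound `|b / e|); rewrite -ler_pdivrMl// mulrC.
  apply: le_trans (ler_norm _) _.
  apply: le_trans (ltW (archi_boundP (normr_ge0 _))) _.
  by rewrite -natrX ler_nat ltnW// ltn_expl.
have : forall p f, A m ((2%:R ^- p) *: f) -> A (m + p)%N f.
  elim=> [|p IH] f; first by rewrite expr0 invr1 scale1r addn0.
  move=> H; rewrite addnS.
  have -> : f = 2%:R^-1 *: f + 2%:R^-1 *: f.
    by rewrite -scalerDl -[2%:R^-1]div1r -splitr scale1r.
  by apply: chainD; apply: IH; rewrite scalerA -invfM -exprSr.
move=> H; exists (m + s)%N => f Bf; apply: H; apply: Ae.
  by apply: stepsetZ; exact: Bm.
have -> : 2%:R ^- s = (2%:R ^- s)%:C%C :> R[i].
  by rewrite fmorphV rmorphXn rmorph_nat.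
apply: gnorm_le_trans (gnormZr _ (Be _ Bf)) _.
  by rewrite invr_ge0 exprn_ge0.
by rewrite mulrC ler_pdivrMr// exprn_gt0.
Qed.

Lemma chain_cover x : exists j, A j x.
Proof.
have [m mx] := gnorm_cover q x.
have [||j xA] := @chain_absorb m [set x].
- by move=> _ ->.
- move=> l; have [e _ xe] := gnorm_bounded l mx; exists e => _ ->; exact: xe.
- by exists j; exact: xA.
Qed.

(** On [A j] the topology of the whole limit is that of the step [n j.+1]. Comparing two consecutive
    steps at a time yields norm indices and radii [p i]; the neighborhood consists of sums whose
    i-th term is small for the norm [p i.+1], and smallness is carried back from the last term to
    the whole sum. *)
Lemma chain_coincide j l e : 0 < e -> exists2 O, union_nbhs q O &
  forall x, A j x -> O x -> (q (n j.+1) l x <= e%:E)%E.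
Proof.
move=> e0.
(* Twice the new radius is allowed, to leave room for one summand plus the remaining tail. The
   premise on the old radius only makes the choice function total. *)
have /choice[F FP] (Np : nat * (nat * R)) : exists p : nat * R, 0 < Np.2.2 ->
    0 < p.2 /\ forall f, A Np.1 f -> (q (n Np.1.+2) p.1 f <= (p.2 + p.2)%:E)%E ->
      (q (n Np.1.+1) Np.2.1 f <= Np.2.2%:E)%E.
  case: Np => N [i r] /=; have [r0|_] := boolP (0 < r); last by exists (0%N, 0).
  have [_ _ _ _ /(_ (n N.+2) i _ (divr_gt0 r0 (ltr0Sn R 1)))] := nA.1 N.
  move=> [i' [C C0 H]]; exists (i', r / (4%:R * C)) => _ /=.
  have r4 : 0 < r / (4%:R * C) by rewrite divr_gt0// mulr_gt0.
  split=> // f Af /(H _ _ Af (addr_gt0 r4 r4)) /gnorm_le_trans; apply.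
  have -> : C * (r / (4%:R * C) + r / (4%:R * C)) = r / 2%:R.
    by field; rewrite gt_eqF.
  by rewrite -splitr.
pose p := fix p i := if i is i'.+1 then F ((j + i')%N, p i') else (l, e).
have p0 i : 0 < (p i).2.
  by elim: i => //= i IH; have [] := FP ((j + i)%N, p i) IH.
have pP i f : A (j + i)%N f ->
    (q (n (j + i).+2) (p i.+1).1 f <= ((p i.+1).2 + (p i.+1).2)%:E)%E ->
    (q (n (j + i).+1) (p i).1 f <= (p i).2%:E)%E.
  by have [_] := FP ((j + i)%N, p i) (p0 i); exact.
pose V i := A (j + i)%N `&`
  [set f | (q (n (j + i).+2) (p i.+1).1 f <= (p i.+1).2%:E)%E].
exists (finite_sums V).
  apply: (@finite_sums_nbhs _ _ q V (fun i => n (j + i)%N)).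
  - by move=> i; apply: acx_setI; [exact: chain_acx|exact: gball_acx].
  - move=> i; apply: step_nbhsI; first exact: chain_nbhs.
    apply: step_nbhs_mono (step_nbhs_ball _ _ _ (p0 _)).
    have n1 : (n (j + i) < n (j + i).+1)%N by case: (nA.1 (j + i)%N).
    have n2 : (n (j + i).+1 < n (j + i).+2)%N by case: (nA.1 (j + i).+1).
    exact: ltnW (ltn_trans n1 n2).
  - by move=> N; exists N; apply: leq_trans (chain_ge _); exact: leq_addl.
move=> x Ax [K [v [Vv xv]]].
(* The tail [r i] is x minus i summands, so it lies in [A (j + i)], where the comparison [pP]
   applies. *)
pose r i := \sum_(i <= a < K) v a.
have rS i : (i < K)%N -> r i = v i + r i.+1 by move=> iK; rewrite /r big_ltn.
have Ar i : (i <= K)%N -> A (j + i)%N (r i).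
  elim: i => [|i IH] iK; first by rewrite addn0 /r big_mkord -xv.
  have -> : r i.+1 = r i - v i by rewrite (rS i)// addrC addKr.
  rewrite addnS.
  apply: chainD; first exact: IH (ltnW iK).
  by apply: (acxN (chain_acx _)); case: (Vv i).
(* Descending induction from the empty tail [r K] to [r 0], which is x. *)
suff H i : (i <= K)%N -> (q (n (j + (K - i)).+1) (p (K - i)%N).1 (r (K - i)%N)
    <= (p (K - i)%N).2%:E)%E.
  by have := H K (leqnn K); rewrite subnn addn0 /r big_mkord -xv.
elim: i => [_|i IH iK].
  by rewrite subn0 /r big_geq// gnorm0 lee_fin ltW.
have iK' : (K - i.+1 < K)%N by rewrite ltn_subrL (leq_ltn_trans _ iK).
apply: pP; first by apply: Ar; exact: ltnW.
rewrite (rS (K - i.+1)%N)//; apply: gnormD; first by case: (Vv (K - i.+1)%N).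
by have := IH (ltnW iK); rewrite -subnSK// addnS.
Qed.

End RetakhChain.

(** * Translation of the inductive limit topology into norms *)

Section InductiveLimitNorms.
Context (R : realType) (E : lmodType R[i]) (S : lc_spectrum E) (q : norm_grid E).
Implicit Types (f g x y : E) (n m k i j l : nat) (A W O : set E) (e s t : R).

Definition spectrum_norms :=
  (forall n x, range (incl S n) x <-> stepset q n x) /\
  (forall n (W : set (step S n)), nbhs (0 : step S n) W <->
     exists l, exists2 e : R, 0 < e &
       forall x : step S n, (q n l (incl S n x) <= e%:E)%E -> W x).

Hypothesis Sq : spectrum_norms.

Lemma incl_stepset n (x : step S n) : stepset q n (incl S n x).
Proof. by apply/Sq.1; exists x. Qed.

Lemma indlim_nbhs0P W : indlim_nbhs0 S W <-> union_nbhs q W.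
Proof.
split=> -[cW nW]; split=> // n.
  have /Sq.2[l [e e0 H]] := nW n; exists l, e => // f /Sq.1[y _ <-]; exact: H.
apply/Sq.2; have [l [e e0 H]] := nW n; exists l, e => // y ye /=.
apply: H ye; exact: incl_stepset.
Qed.

Lemma indlim_nbhsP (x : indlim S) (U : set (indlim S)) :
  nbhs x U <-> exists2 W, union_nbhs q W & forall w, W w -> U (x + w).
Proof. by split=> -[W /indlim_nbhs0P nW WU]; exists W. Qed.

Definition union_bounded (B : set E) := forall W, union_nbhs q W ->
  exists2 r : R, 0 < r & forall b, B b -> W (r%:C%C *: b).

Lemma gt0_complexE (c : R[i]) : 0 < c -> exists2 r : R, 0 < r & c = r%:C%C.
Proof.
case: c => a b; rewrite ltcE/= => /andP[/eqP b0 a0]; exists a => //.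
by apply/eqP; rewrite eq_complex/= b0 !eqxx.
Qed.

Lemma indlim_boundedP (B : set (indlim S)) : tvs_bounded B <-> union_bounded B.
Proof.
split=> bB U.
  move=> nU; have [|c /gt0_complexE[r r0 ->] BU] := bB U.
    by apply/indlim_nbhsP; exists U => // w; rewrite add0r.
  exists r^-1; first by rewrite invr_gt0.
  move=> b /BU[x Ux <-]; rewrite scalerA -rmorphM/= mulVf ?gt_eqF//.
  by rewrite scale1r.
move=> /indlim_nbhsP[W nW WU]; have [r r0 BW] := bB W nW.
exists r^-1%:C%C; first by rewrite ltcR invr_gt0.
move=> b /BW Wb; exists (r%:C%C *: b); first by rewrite -[_ *: b]add0r; exact: WU.
by rewrite scalerA -rmorphM/= mulVf ?gt_eqF// scale1r.
Qed.

Lemma step_boundedP n (B : set (step S n)) : tvs_bounded B <->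
  forall l, exists e, forall b, B b -> (q n l (incl S n b) <= e%:E)%E.
Proof.
split=> bB.
  move=> l; have [|c /gt0_complexE[r r0 ->] BU] :=
    bB [set x | (q n l (incl S n x) <= 1%:E)%E].
    by apply/Sq.2; exists l, 1.
  exists (r * 1) => b /BU[x x1 <-]; rewrite linearZ; apply: gnormZr => //.
  exact: ltW.
move=> U /Sq.2[l [e e0 eU]]; have [d Bd] := bB l.
pose r := Num.max 1 (d / e).
have r0 : 0 < r by rewrite lt_max ltr01.
exists r%:C%C; first by rewrite ltcR.
move=> b /Bd bd; exists (r^-1%:C%C *: b); last first.
  by rewrite scalerA -rmorphM/= mulfV ?gt_eqF// scale1r.
apply: eU; rewrite linearZ/=; have ri : 0 <= r^-1 by rewrite invr_ge0 ltW.
apply: gnorm_le_trans (gnormZr ri bd) _.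
by rewrite mulrC ler_pdivrMr// mulrC -ler_pdivrMr// le_max lexx orbT.
Qed.

Lemma indlim_cauchyP (F : set_system (indlim S)) W : ProperFilter F ->
  cauchy F -> union_nbhs q W ->
  exists2 B, F B & forall x y, B x -> B y -> W (x - y).
Proof.
move=> FF cF nW.
have /cF[[P Q] /= [FP FQ] PQ] :
    entourage [set xy : indlim S * indlim S | W (xy.1 - xy.2)].
  apply/lc_entourageE; exists W => //.
  by apply/indlim_nbhsP; exists W => // w; rewrite add0r.
exists (P `&` Q); first exact: filterI.
by move=> x y [Px _] [_ Qy]; exact: (PQ (x, y)).
Qed.

End InductiveLimitNorms.

Lemma expr2V_lt (R : realType) (e : R) : 0 < e ->
  exists s0 : nat, forall s : nat, (s0 <= s)%N -> 2%:R ^- s <= e.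
Proof.
move=> e0; exists (Num.bound e^-1) => s es.
rewrite -[e]invrK lef_pV2 ?posrE ?invr_gt0 ?exprn_gt0//.
apply: le_trans (ltW (archi_boundP _)) _; first by rewrite invr_ge0 ltW.
by rewrite -natrX ler_nat (leq_trans es)// ltnW// ltn_expl.
Qed.

(** * Completeness from condition (Q) *)

Section Completeness.
Context (R : realType) (E : lmodType R[i]) (S : lc_spectrum E) (q : norm_grid E).
Implicit Types (f g x y : E) (n m k i j l : nat) (A W O : set E) (e s t : R).

(** Enough for a metrizable step: any Cauchy sequence has a subsequence of this speed, and closed
    balls preserve the bounds in the limit. *)
Definition steps_complete := forall m (y : nat -> E),
  (forall s : nat, stepset q m (y s)) ->
  (forall s s' : nat, (s <= s')%N -> (q m s (y s - y s')%R <= (2%:R ^- s)%:E)%E) ->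
  exists x, forall s : nat, (q m s (y s - x)%R <= (2%:R ^- s)%:E)%E.

Hypothesis Sq : spectrum_norms S q.

(** Otherwise every J has a member B_J and a neighborhood O_J for which B_J - O_J misses [A J]. Sums
    of elements of [A i] that are also small for these O_J form a neighborhood, so two elements of F
    differ by such a sum. Its head stays in the chain and its tail in some O_J, a contradiction. *)
Lemma cauchy_trace (n : nat -> nat) (A : nat -> set E) (F : set_system (indlim S)) :
  retakh_chain q n A -> ProperFilter F -> cauchy F ->
  exists J, forall B O, F B -> union_nbhs q O ->
    exists b o, [/\ B b, O o & A J (b - o)].
Proof.
move=> nA FF cF; apply: contrapT => /forallNP H.
have /choice[BO BOP] J : exists BO : set E * set E,
    [/\ F BO.1, union_nbhs q BO.2 &
        forall b o, BO.1 b -> BO.2 o -> ~ A J (b - o)].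
  have /existsNP[B /existsNP[O]] := H J.
  move=> /not_implyP[FB /not_implyP[nO H1]]; exists (B, O); split=> // b o Bb Oo Ab.
  by apply: H1; exists b, o.
have /choice[h hP] W : exists O, union_nbhs q W -> union_nbhs q O /\
    forall x y, O x -> O y -> W (x + y).
  have [/union_nbhs_half[O nO OW]|] := pselect (union_nbhs q W); first by exists O.
  by exists W.
(* The sets are halved successively so that a tail starting after i stays in [U i]. The shift by two
   pays for the head: a point of [A j] plus a sum in [A j.+1] lies in [A j.+2]. *)
pose U := fix U i := if i is i'.+1 then h (U i' `&` (BO i'.+3).2) else h (BO 2%N).2.
have nU i : union_nbhs q (U i).
  elim: i => [|i IH] /=; first by have [_ /hP[]] := BOP 2%N.
  have [_ nO _] := BOP i.+3.
  by have /hP[] := union_nbhsI IH nO.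
have UU i x y : U i.+1 x -> U i.+1 y -> U i (x + y).
  have [_ nO _] := BOP i.+3; have /hP[_ UO] := union_nbhsI (nU i) nO.
  by move=> Ux Uy; have [] := UO _ _ Ux Uy.
have UO i x : U i x -> (BO i.+2).2 x.
  case: i => [|i] Ux.
    have [_ /hP[_ +] _] := BOP 2%N => /(_ x 0 Ux); rewrite addr0; apply.
    exact: union_nbhs0 (nU 0%N).
  have [_ nO _] := BOP i.+3; have /hP[_ +] := union_nbhsI (nU i) nO.
  by move=> /(_ x 0 Ux (union_nbhs0 (nU i.+1))); rewrite addr0 => -[].
pose V i := A i `&` U i.
have nV : union_nbhs q (finite_sums V).
  apply: (@finite_sums_nbhs _ _ q V n).
  - by move=> i; apply: acx_setI; [exact: (chain_acx nA)|exact: (nU i).1].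
  - by move=> i; apply: step_nbhsI; [exact: (chain_nbhs nA)|exact: (nU i).2].
  - by move=> N; exists N; exact: (chain_ge nA).
have [B FB BV] := indlim_cauchyP Sq FF cF nV.
have [a Ba] := filter_ex FB.
have [j Aa] := chain_cover nA a.
have [FBj _ Hj] := BOP j.+2.
have [a' [Ba' Bja']] := filter_ex (filterI FB FBj).
have [K [v [Vv va]]] := BV _ _ Ba' Ba.
pose w i := if (i < K)%N then v i else 0.
have Vw i : V i (w i).
  rewrite /w; case: ifP => // _; split; first exact: (chain0 nA).
  exact: union_nbhs0.
(* The zero padding guarantees at least j + 1 terms, so that the sum can be cut there even if K is
   small. *)
have {}va : a' - a = \sum_(0 <= i < K + j.+1) w i.
  rewrite va big_mkord (big_ord_widen _ _ (leq_addr j.+1 K)) big_mkcond/=.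
  by apply: eq_bigr.
have tail L i : U i (\sum_(i.+1 <= b < i.+1 + L) w b).
  elim: L i => [|L IH] i; first by rewrite addn0 big_geq//; exact: union_nbhs0.
  rewrite big_ltn ?addnS ?ltnS ?leq_addr//; apply: UU; first by case: (Vw i.+1).
  by rewrite -addSn.
apply: (Hj a' (\sum_(j.+1 <= i < j.+1 + K) w i)) => //.
  exact/UO/tail.
have -> : a' - \sum_(j.+1 <= i < j.+1 + K) w i = a + \sum_(i < j.+1) w i.
  apply/eqP; rewrite subr_eq -addrA addrC -subr_eq va; apply/eqP.
  by rewrite addnC (big_cat_nat _ (n := j.+1)) ?leq_addr//= big_mkord.
apply: (chainD nA); last by apply: (chain_sum nA) => i; case: (Vw i).
exact: (chain_mono nA) Aa.
Qed.

(** Differences of elements of [A J] lie in [A J.+1], where [chain_coincide] turns smallness in the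
    limit into smallness in the step m. The points b - o of [cauchy_trace], for finer and finer
    data, are therefore Cauchy in that step, and their limit is the limit of the filter. *)
Lemma cond_Q_complete : steps_complete -> cond_Q q -> lf_complete S.
Proof.
move=> cS /retakh_chain_exists[n [A nA]] F FF cF.
have [J HJ] := cauchy_trace nA FF cF.
pose m := n J.+2.
have /choice[O OP] (s : nat) : exists O, union_nbhs q O /\
    forall x, A J.+1 x -> O x -> (q m s x <= (2%:R ^- s.+1)%:E)%E.
  have e0 : 0 < 2%:R ^- s.+1 :> R by rewrite invr_gt0 exprn_gt0.
  by have [O] := chain_coincide nA J.+1 s e0; exists O.
have quarter W : union_nbhs q W -> exists2 O, union_nbhs q O &
    forall x y z, O x -> O y -> O z -> W (x + y + z).
  move=> /union_nbhs_half[W1 /[dup] n1 /union_nbhs_half[W2 n2 W21] W1W].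
  exists W2 => // x y z Ox Oy Oz; apply: W1W; first exact: W21.
  by rewrite -[z]addr0; apply: W21 => //; exact: union_nbhs0 n2.
have /choice[P PP] (s : nat) : exists P, union_nbhs q P /\
    forall x y z, P x -> P y -> P z -> O s (x + y + z).
  by have [/quarter[P nP H] _] := OP s; exists P.
have /choice[B BP] (s : nat) : exists B, F B /\
    forall x y, B x -> B y -> P s (x - y).
  by have [nP _] := PP s; have [B] := indlim_cauchyP Sq FF cF nP; exists B.
have /choice[y yP] (s : nat) : exists y, exists b o,
    [/\ B s b, P s o, y = b - o & A J y].
  have [nP _] := PP s; have [FB _] := BP s.
  by have [b [o [Bb Po Ab]]] := HJ _ _ FB nP; exists (b - o), b, o.
(* Any admissible b - o at level s is near [y s]. Two terms [y s] and [y s'] are later compared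
   through one b - o admissible at both levels. *)
have close (s : nat) b o : B s b -> P s o -> A J (b - o) ->
    (q m s (y s - (b - o))%R <= (2%:R ^- s.+1)%:E)%E.
  move=> Bb Po Abo; have [b' [o' [Bb' Po' yE Ay]]] := yP s.
  have [_ H] := OP s; apply: H.
    by apply: (chainD nA) => //; exact: acxN (chain_acx nA J) Abo.
  have [[cP _] HP] := PP s.
  have -> : y s - (b - o) = (b' - b) + (- o') + o.
    by rewrite yE opprB [b' - b - o']addrAC -[RHS]addrA [- b + o]addrC.
  by apply: HP => //; [have [_] := BP s; apply|exact: acxN].
have mA z : A J z -> stepset q m z.
  move=> /(chain_step nA); apply: stepset_mono; apply: (@leq_trans (n J.+1)).
    by case: (nA.1 J) => /ltnW.
  by case: (nA.1 J.+1) => /ltnW.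
have my (s : nat) : stepset q m (y s) by have [b [o [_ _ _ /mA]]] := yP s.
have [//||x xP] := cS m y.
  move=> s s' ss'.
  have [nP _] := PP s; have [nP' _] := PP s'.
  have [FB _] := BP s; have [FB' _] := BP s'.
  have [b [o [[Bb Bb'] [Po Po'] Abo]]] := HJ _ _ (filterI FB FB') (union_nbhsI nP nP').
  have h1 := close s _ _ Bb Po Abo.
  have h2 : (q m s (y s' - (b - o))%R <= (2%:R ^- s'.+1)%:E)%E.
    apply: le_trans (close s' _ _ Bb' Po' Abo).
    exact: gnorm_mono.
  have := gnormB h1 h2; rewrite [- (y s' - _)]opprB addrA subrK => /gnorm_le_trans; apply.
  apply: (@le_trans _ _ (2%:R ^- s.+1 + 2%:R ^- s.+1)).
    by rewrite lerD2l lef_pV2 ?posrE ?exprn_gt0// ler_eXn2l// ltr1n.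
  by rewrite exprSr invfM -mulrDr -[2%:R^-1]div1r -splitr mulr1.
exists x; move=> U /(indlim_nbhsP Sq)[W nW WU].
have [W2 nW2 W2W] := quarter W nW.
have [l [e e0 We]] := nW2.2 m.
have [s0 s0P] := expr2V_lt (divr_gt0 e0 (ltr0Sn R 1)).
pose s := maxn l s0.
have [B' FB' B'P] := indlim_cauchyP Sq FF cF nW2.
have [nP _] := PP s; have [FB _] := BP s.
have [b [o [[Bb Bb'] [Po Po'] Abo]]] := HJ _ _ (filterI FB' FB) (union_nbhsI nW2 nP).
have zx : W2 ((b - o) - x).
  have h : (q m s (b - o - x)%R <= e%:E)%E.
    have := gnormB (xP s) (close s _ _ Bb' Po' Abo).
    rewrite [- (y s - (b - o))]opprB addrC addrA subrK => /gnorm_le_trans; apply.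
    rewrite [leRHS]splitr lerD ?s0P ?leq_maxr// leqW// leq_maxr//.
  apply: We; last exact: le_trans (gnorm_mono q _ (leqnn m) (leq_maxl _ _)) h.
  have -> : b - o - x = (b - o - y s) + (y s - x) by rewrite addrA subrK.
  apply: stepsetD; first by apply: stepsetB => //; exact: mA.
  move=> i; have [c _ yc] := gnorm_bounded i (stepsetB (my s) (my i)).
  have := gnormD yc (xP i); rewrite addrA subrK => /le_lt_trans; apply.
  exact: ltry.
apply: filterS FB' => b' Bb2 /=.
have -> : b' = x + ((b' - b) + (b - o - x) + o).
  by rewrite -[b - o - x]addrA -opprD subrKA addrC -addrA subrK.
by apply: WU; apply: W2W => //; exact: B'P.
Qed.

End Completeness.

(** * Completeness implies regularity implies (wQ) *)

Section Regularity.
Context (R : realType) (E : lmodType R[i]) (S : lc_spectrum E) (q : norm_grid E).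
Implicit Types (f g x y : E) (n m k i j l : nat) (A W O U : set E) (e s t : R).

(** Closedness in the limit of every ball of every step; it lets the hump of the next proof stay
    outside a ball under small perturbations. *)
Definition norms_closed := forall n j e f, ~ (q n j f <= e%:E)%E ->
  exists2 O, union_nbhs q O & forall h, O h -> ~ (q n j (f + h)%R <= e%:E)%E.

Hypotheses (Sq : spectrum_norms S q) (qcl : norms_closed).

Definition norm_bounded n (B : set E) :=
  forall j, exists e, forall b, B b -> (q n j b <= e%:E)%E.

(* Gliding hump: if [B] is bounded in no step, then some series of small
   multiples of elements of [B] has a partial sum escaping, in a stable way, the
   K-th ball of the n-th step, for every pair [(n, K)]; its sum cannot exist. *)
Lemma complete_bounded : lf_complete S ->
  forall B, union_bounded q B -> exists n, norm_bounded n B.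
Proof.
move=> cS B bB; apply: contrapT => /forallNP H.
have /choice[J HJ] n : exists j, forall e, exists2 b, B b & ~ (q n j b <= e%:E)%E.
  have /existsNP[j Hj] := H n; exists j => e; apply: contrapT => Hb.
  by apply: Hj; exists e => b Bb; apply: contrapT => Hq; apply: Hb; exists b.
pose T := {z : nat * E * set E | union_nbhs q z.2}.
pose idx (z : T) := (sval z).1.1.
pose pt (z : T) := (sval z).1.2.
pose nb (z : T) := (sval z).2.
(* Enumerates the pairs (step, bound) to be escaped; integers that code no pair are sent to (0,
   0). *)
pose nK (i : nat) : nat * nat := odflt (0%N, 0%N) (unpickle i).
pose rel (z z' : T) := [/\ idx z' = (idx z).+1,
  forall h h', nb z' h -> nb z' h' ->
    ~ (q (nK (idx z)).1 (J (nK (idx z)).1) (pt z' + (h + h'))%R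
        <= (nK (idx z)).2%:R%:E)%E,
  forall u, nb z' u -> nb z (pt z' - pt z + u) &
  exists b mu, [/\ B b, 0 <= mu, mu <= 2%:R ^- idx z &
    pt z' - pt z = mu%:C%C *: b]].
have next z : {z' | rel z z'}.
  apply: cid; case: z => -[[i g] U] /= nU.
  have [U1 nU1 U1U] := union_nbhs_half nU.
  have [r r0 BU1] := bB _ nU1.
  set n := (nK i).1; set K := (nK i).2.
  pose la := Num.min r (2%:R ^- i).
  have la0 : 0 < la by rewrite lt_min r0 invr_gt0 exprn_gt0.
  have [b Bb Hb] := HJ n ((K%:R + K%:R) / la).
  (* If g is already outside the ball, nothing is added. Otherwise g + la b is outside: if both were
     inside, b would have norm at most 2K/la, against the choice of b. *)
  have [mu [mu0 mula Hmu]] : exists mu, [/\ 0 <= mu, mu <= la &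
      ~ (q n (J n) (g + mu%:C%C *: b)%R <= K%:R%:E)%E].
    have [gK|gK] := pselect (q n (J n) g <= K%:R%:E)%E; last first.
      by exists 0; split; rewrite ?(ltW la0)// scale0r addr0.
    exists la; split; rewrite ?(ltW la0)// => gbK; apply: Hb.
    apply: gnormZr_inv => //.
    by have := gnormB gbK gK; rewrite addrC addKr.
  have [O /union_nbhs_half[U2 nU2 U2O] HO] := qcl Hmu.
  have U1mu : U1 (mu%:C%C *: b).
    apply: acx_shrink (BU1 _ Bb) => //; first exact: nU1.1.
    by rewrite (le_trans mula)// ge_min lexx.
  exists (exist _ (i.+1, g + mu%:C%C *: b, U1 `&` U2) (union_nbhsI nU1 nU2)).
  rewrite /rel /idx /pt /nb /=; split=> //.
  - by move=> h h' [_ Uh] [_ Uh']; apply: HO; exact: U2O.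
  - by move=> u [U1u _]; rewrite [g + _]addrC addrK; exact: U1U.
  - exists b, mu; split=> //; last by rewrite addrC addKr.
    by rewrite (le_trans mula)// ge_min lexx orbT.
have [W0 nW0 _] : exists2 W, union_nbhs q W & True.
  by exists setT => //; split; [split => //; exact/convex_setP|exists 0%N, 1].
have [z [z0 zr]] := dependent_choice next (exist _ (0%N, 0, W0) nW0).
have zidx i : idx (z i) = i.
  by elim: i => [|i IH]; [rewrite z0|have [-> _ _ _] := zr i; rewrite IH].
pose g i := pt (z i); pose U i := nb (z i).
have nU i : union_nbhs q (U i) by exact: svalP (z i).
have step_sum i p : g (i + p.+1)%N - g i =
    (g i.+1 - g i) + (g (i.+1 + p)%N - g i.+1).
  by rewrite [RHS]addrC [RHS]addrA subrK addSnnS.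
have tail p i : U i (g (i + p)%N - g i).
  elim: p i => [|p IH] i; first by rewrite addn0 subrr; exact: union_nbhs0.
  by rewrite step_sum; have [_ _ + _] := zr i; apply; exact: IH.
(* The i-th jump is at most 2^-i times an element of [B], so r 2^i / 2 times any later difference
   lies in [W]: half of [W] takes the first jump, the other half the rest. *)
have small W : union_nbhs q W -> exists N, forall i p, (N <= i)%N ->
    W (g (i + p)%N - g i).
  move=> nW; have [r r0 Wr] := bB _ nW.
  have W2 p i : W ((r * 2%:R ^+ i / 2%:R)%:C%C *: (g (i + p)%N - g i)).
    elim: p i => [|p IH] i.
      by rewrite addn0 subrr scaler0; exact: union_nbhs0 nW.
    rewrite step_sum scalerDr; apply: absolutely_convexD; first exact: nW.1.
      have [_ _ _ [b [mu [Bb mu0 mui ->]]]] := zr i.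
      rewrite !scalerA -(rmorph_nat (real_complex R)) -!rmorphM/=.
      rewrite zidx in mui.
      apply: acx_shrink (Wr _ Bb); first exact: nW.1.
        by rewrite !mulr_ge0// ?invr_ge0// ltW ?exprn_gt0.
      rewrite [leLHS](_ : _ = r * (2%:R ^+ i * mu)); last by field.
      rewrite ler_piMr// ?(ltW r0)//.
      by rewrite mulrC -ler_pdivlMr ?exprn_gt0// div1r.
    have := IH i.+1; rewrite !scalerA -(rmorph_nat (real_complex R)) -!rmorphM/=.
    have <- // : r * 2%:R ^+ i.+1 / 2%:R = 2%:R * (r * 2%:R ^+ i / 2%:R).
    by rewrite exprS; field.
  have [s0 s0P] := expr2V_lt (divr_gt0 r0 (ltr0Sn R 1)).
  exists s0 => i p /s0P si; rewrite -[_ - _]scale1r.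
  apply: acx_shrink (W2 p i) => //; first exact: nW.1.
  have p2 : 0 < 2%:R ^+ i :> R by rewrite exprn_gt0.
  rewrite mulrAC -ler_pdivrMr// div1r; exact: si.
pose F : set_system (indlim S) := (g : nat -> indlim S) @ \oo.
have Fcauchy : cauchy F.
  move=> A /lc_entourageE[P /(indlim_nbhsP Sq)[W nW WP] PA].
  have [W' nW' W'W] := union_nbhs_half nW.
  have [N HN] := small W' nW'.
  have FN : F [set x | W' (x - g N)].
    exists N => // i /= Ni; rewrite -(subnKC Ni); exact: HN.
  exists ([set x | W' (x - g N)], [set x | W' (x - g N)]) => // -[x y] /= [Wx Wy].
  apply: PA; rewrite -[x - y]add0r; apply: WP.
  rewrite (_ : x - y = (x - g N) - (y - g N)); last first.
    by rewrite opprB addrA subrK.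
  by apply: W'W => //; exact: acxN nW'.1 Wy.
have [x Fx] := cS F _ Fcauchy.
have [N Nx] := gnorm_cover q x.
have [c c0 xc] := gnorm_bounded (J N) Nx.
(* The index i codes the pair formed by a step containing the limit x and a bound for its norm.
   Since x is the partial sum [g i.+1] plus two errors from [U i.+1], it has escaped that very
   ball. *)
pose K := Num.bound c; pose i := pickle (N, K).
have nKi : nK i = (N, K) by rewrite /nK pickleK.
have [_ + _ _] := zr i; rewrite zidx nKi /= => Hi.
have /Fx[M _ HM] : nbhs (x : indlim S) [set y | U i.+1 (x - y)].
  apply/(indlim_nbhsP Sq); exists (U i.+1) => // w Uw /=.
  by rewrite opprD addrA subrr add0r; exact: acxN (nU i.+1).1 Uw.
have := Hi _ _ (tail M i.+1) (HM _ (leq_addl i.+1 M)).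
apply; rewrite [g _ - _ + _]addrC subrKA addrC subrK.
by apply: gnorm_le_trans xc _; exact: ltW (archi_boundP (ltW c0)).
Qed.

Lemma complete_regular : lf_complete S -> lf_regular S.
Proof.
move=> cS B /(indlim_boundedP Sq)/(complete_bounded cS)[n bB].
exists n, (incl S n @^-1` B).
  apply/(step_boundedP Sq) => l; have [e Be] := bB l; exists e => b; exact: Be.
apply/seteqP; split=> [b Bb|_ [y By <-]//].
have /Sq.1[y _ yb] : stepset q n b.
  by move=> j; have [e Be] := bB j; apply: le_lt_trans (Be _ Bb) (ltry _).
by exists y => //; rewrite /preimage/= yb.
Qed.

Lemma regular_bounded : lf_regular S ->
  forall B, union_bounded q B -> exists n, norm_bounded n B.
Proof.
move=> rS B /(indlim_boundedP Sq)/rS[n [A /(step_boundedP Sq) bA ->]].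
by exists n => l; have [e Ae] := bA l; exists e => _ [a Aa <-]; exact: Ae.
Qed.

End Regularity.

(** * Conditions (Q) and (wQ), regularity and bounded retractivity *)

Section ConditionsQ.
Context (R : realType) (E : lmodType R[i]) (S : lc_spectrum E) (q : norm_grid E).
Implicit Types (f g x y : E) (n m k i j l : nat) (A W O U : set E) (e s t : R).

(** One common scale [s] is enough, as (wQ) allows a constant of any size on both norms. *)
Definition cond_wQ := forall n, exists i m, (n < m)%N /\
  forall k j, (m < k)%N -> exists l, exists2 C : R, 0 < C &
    forall f s, stepset q n f -> 0 < s ->
      (q n i f <= s%:E)%E -> (q k l f <= s%:E)%E ->
      (q m j f <= (C * s)%:E)%E.

(** For k <= m the norm of the step k dominates that of the step m. *)
Lemma cond_Q_later : (forall n, exists i m, (n < m)%N /\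
  forall k j e, (m < k)%N -> 0 < e -> exists l, exists2 C : R, 0 < C &
    forall f s t, stepset q n f -> 0 < s -> 0 < t ->
      (q n i f <= s%:E)%E -> (q k l f <= t%:E)%E ->
      (q m j f <= (e * s + C * t)%:E)%E) -> cond_Q q.
Proof.
move=> H n; have [i [m [nm Hm]]] := H n; exists i, m; split=> // k j e e0.
have [km|mk] := leqP k m; last exact: Hm.
exists j, 1 => // f s t _ s0 t0 _ ft.
apply: le_trans (gnorm_mono q f km (leqnn j)) _.
by apply: gnorm_le_trans ft _; rewrite mul1r lerDr mulr_ge0// ltW.
Qed.

Hypothesis Sq : spectrum_norms S q.

Lemma lf_wQP : lf_wQ S <-> cond_wQ.
Proof.
split=> H n.
  have [U /Sq.2[i [e e0 Ue]] [m nm Hm]] := H n; exists i, m; split=> // k j mk.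
  have [|V /Sq.2[l [v v0 Vv]] [c /gt0_complexE[C C0 ->]] VUW] :=
    Hm k mk [set x | (q m j (incl S m x) <= 1%:E)%E].
    by apply/Sq.2; exists j, 1.
  exists l, (C / Num.min e v); first by rewrite divr_gt0// lt_min e0.
  move=> f s nf s0 fi fl; pose a := Num.min e v / s.
  have ev0 : 0 < Num.min e v by rewrite lt_min e0.
  have a0 : 0 < a by rewrite divr_gt0.
  have nk : (n <= k)%N by exact: ltnW (ltn_trans nm mk).
  have /Sq.1[y _ ya] := stepsetZ a%:C%C nf.
  have /Sq.1[z _ za] := stepset_mono nk (stepsetZ a%:C%C nf).
  have as_ : a * s = Num.min e v by rewrite divfK ?gt_eqF.
  have [] := VUW (a%:C%C *: f).
    split.
      exists z => //; apply: Vv; rewrite za.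
      by apply: gnorm_le_trans (gnormZr (ltW a0) fl) _; rewrite as_ ge_min lexx orbT.
    exists y => //; apply: Ue; rewrite ya.
    by apply: gnorm_le_trans (gnormZr (ltW a0) fi) _; rewrite as_ ge_min lexx.
  move=> _ [x x1 <-]; rewrite linearZ => xf.
  have := gnormZr (ltW C0) x1; rewrite xf => /(gnormZr_inv a0).
  by move=> /gnorm_le_trans; apply; rewrite mulr1 invf_div mulrCA mulrC mulrAC.
have [i [m [nm Hm]]] := H n; exists [set x | (q n i (incl S n x) <= 1%:E)%E].
  by apply/Sq.2; exists i, 1.
exists m => // k mk W /Sq.2[j [e e0 We]]; have [l [C C0 HC]] := Hm k j mk.
exists [set x | (q k l (incl S k x) <= 1%:E)%E]; first by apply/Sq.2; exists l, 1.
have Ce : 0 < C / e by rewrite divr_gt0.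
exists (C / e)%:C%C; first by rewrite ltcR.
move=> _ [[x x1 <-] [y y1 yx]].
have nx : stepset q n (incl S n y) by exact: incl_stepset.
have {}x1 : (q k l (incl S n y) <= 1%:E)%E by rewrite yx.
have := HC _ 1 nx ltr01 y1 x1; rewrite -yx mulr1 => xC.
have /Sq.1[z _ zx] := stepset_mono (ltnW nm) nx.
rewrite -zx in xC *; exists z => //.
exists ((C / e)^-1%:C%C *: z); last first.
  by rewrite scalerA -rmorphM/= mulfV ?gt_eqF// scale1r.
apply: We; rewrite linearZ/=.
have Ci : 0 <= (C / e)^-1 by rewrite invr_ge0 ltW.
apply: gnorm_le_trans (gnormZr Ci xC) _.
by rewrite invf_div divfK// gt_eqF.
Qed.

Lemma uniform_scale (P : nat -> R -> Prop) N :
  (forall i r r', 0 < r' -> r' <= r -> P i r -> P i r') ->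
  (forall i, exists2 r : R, 0 < r & P i r) ->
  exists2 r : R, 0 < r & forall i, (i < N)%N -> P i r.
Proof.
move=> Pmono HP; elim: N => [|N [r r0 Hr]]; first by exists 1.
have [r' r'0 Pr'] := HP N; exists (Num.min r r'); first by rewrite lt_min r0.
move=> i; rewrite ltnS leq_eqVlt => /predU1P[->|iN].
  by apply: Pmono Pr'; rewrite ?lt_min ?r0// ge_min lexx orbT.
by apply: Pmono (Hr i iN); rewrite ?lt_min ?r0// ge_min lexx.
Qed.

(** Let a neighborhood contain a ball of the step n for the norm of index i0. This ball absorbs all
    [x i l] with i >= i0 at once. For each of the finitely many other i, a ball of the step [k i]
    absorbs all but finitely many l, and single points are always absorbed. *)
Lemma family_bounded n (k : nat -> nat) (c : nat -> R) (x : nat -> nat -> E) :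
  (forall i l, stepset q n (x i l)) -> (forall i, (n <= k i)%N) ->
  (forall i, 0 < c i) -> (forall i l, (q n i (x i l) <= 1%:E)%E) ->
  (forall i l, (q (k i) l (x i l) <= (c i)%:E)%E) ->
  union_bounded q [set x i l | i in setT & l in setT].
Proof.
move=> nx nk c0 x1 xc W nW; have [i0 [e0 e00 We0]] := nW.2 n.
have cW := nW.1.
have shrink f (r r' : R) : 0 < r' -> r' <= r -> W (r%:C%C *: f) -> W (r'%:C%C *: f).
  by move=> r'0; apply: acx_shrink => //; exact: ltW.
have Hi i : exists2 r : R, 0 < r & forall l, W (r%:C%C *: x i l).
  have [l0 [e1 e10 We1]] := nW.2 (k i).
  have [r r0 Hr] := uniform_scale l0 (P := fun l r => W (r%:C%C *: x i l))
    (fun l => @shrink (x i l)) (fun l => union_nbhs_absorb _ nW).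
  exists (Num.min r (e1 / c i)); first by rewrite lt_min r0 divr_gt0.
  have m0 : 0 < Num.min r (e1 / c i) by rewrite lt_min r0 divr_gt0.
  move=> l; have [ll0|l0l] := ltnP l l0.
    by apply: shrink (Hr l ll0) => //; rewrite ge_min lexx.
  apply: (shrink _ (e1 / c i)) => //; first by rewrite ge_min lexx orbT.
  apply: We1; first exact/stepsetZ/(stepset_mono (nk i)).
  have ec : 0 <= e1 / c i by rewrite ltW// divr_gt0.
  have := gnormZr ec (le_trans (gnorm_mono q _ (leqnn _) l0l) (xc i l)).
  by rewrite divfK// gt_eqF.
have [r r0 Hr] := uniform_scale i0 (P := fun i r => forall l, W (r%:C%C *: x i l))
    (fun i r r' a b H l => shrink _ _ _ a b (H l)) Hi.
have m0 : 0 < Num.min r e0 by rewrite lt_min r0.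
exists (Num.min r e0) => // _ [i _ [l _ <-]].
have [ii0|i0i] := ltnP i i0.
  by apply: shrink (Hr i ii0 l) => //; rewrite ge_min lexx.
apply: (shrink _ e0) => //; first by rewrite ge_min lexx orbT.
apply: We0; first exact: stepsetZ.
have := gnormZr (ltW e00) (le_trans (gnorm_mono q _ (leqnn _) i0i) (x1 i l)).
by rewrite mulr1.
Qed.

(** If (wQ) fails at n, then each i, with norm index i and m = n + i + 1, yields normalized
    counterexamples [x (i, l)] to the constant l + 1. They form a bounded set, but its row i = N is
    unbounded in the step [m N], hence in the step N, for every N. *)
Lemma regular_wQ : (forall B, union_bounded q B -> exists n, norm_bounded q n B) ->
  cond_wQ.
Proof.
move=> reg; apply: contrapT => /existsNP[n /forallNP Hn].
pose m i := (n + i).+1.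
have nm i : (n < m i)%N by rewrite ltnS leq_addr.
have /choice[kj kjP] i : exists kj : nat * nat, (m i < kj.1)%N /\
    forall l C, 0 < C -> exists f s, [/\ stepset q n f, 0 < s,
      (q n i f <= s%:E)%E, (q kj.1 l f <= s%:E)%E &
      ~ (q (m i) kj.2 f <= (C * s)%:E)%E].
  have /forallNP/(_ (m i))/not_andP[//|] := Hn i.
  move=> /existsNP[k /existsNP[j /not_implyP[mk /forallNP H]]].
  exists (k, j); split=> // l C C0; apply: contrapT => H1; apply: (H l).
  exists C => // f s nf s0 fi fl; apply: contrapT => fC; apply: H1.
  by exists f, s.
have /choice[x xP] (il : nat * nat) : exists x, [/\ stepset q n x,
    (q n il.1 x <= 1%:E)%E, (q (kj il.1).1 il.2 x <= 1%:E)%E &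
    ~ (q (m il.1) (kj il.1).2 x <= (il.2.+1%:R)%:E)%E].
  have [_ /(_ il.2 il.2.+1%:R (ltr0Sn R _))[f [s [nf s0 fi fl fC]]]] := kjP il.1.
  have si : 0 <= s^-1 by rewrite invr_ge0 ltW.
  exists (s^-1%:C%C *: f); split; first exact: stepsetZ.
  - by have := gnormZr si fi; rewrite mulVf// gt_eqF.
  - by have := gnormZr si fl; rewrite mulVf// gt_eqF.
  - by move=> /gnormZr_inv; rewrite invr_gt0 invrK => /(_ s0).
have bX : union_bounded q [set x (i, l) | i in setT & l in setT].
  apply: (@family_bounded n (fun i => (kj i).1) (fun=> 1) (fun i l => x (i, l))).
  - by move=> i l; have [] := xP (i, l).
  - by move=> i; have [/ltnW mk _] := kjP i; apply: leq_trans mk; rewrite ltnW.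
  - by [].
  - by move=> i l; have [] := xP (i, l).
  - by move=> i l; have [] := xP (i, l).
have [N HN] := reg _ bX.
have [e He] := HN (kj N).2; pose l := Num.bound `|e|.
have [_ _ _] := xP (N, l); apply => /=.
have mN : (N <= m N)%N by rewrite leqW// leq_addl.
apply: le_trans (gnorm_mono q _ mN (leqnn _)) _.
apply: gnorm_le_trans (He _ _) _; first by exists N => //; exists l.
apply: le_trans (ler_norm _) _; apply: le_trans (ltW (archi_boundP _)) _ => //.
by rewrite ler_nat.
Qed.

(** Failure of (Q) gives a bounded double sequence whose row i tends to 0 in the step [k i] but
    stays away from 0 in the step [m i]. If the limit and the step N had the same topology on it,
    the row i = N would tend to 0 in the step N and hence in the step [m N]. *)
Lemma boundedly_retractive_Q : boundedly_retractive S -> cond_Q q.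
Proof.
move=> br; apply: contrapT => /existsNP[n /forallNP Hn].
pose m i := (n + i).+1.
have nm i : (n < m i)%N by rewrite ltnS leq_addr.
have /choice[kje kjeP] i : exists kje : nat * nat * R, [/\ (m i < kje.1.1)%N,
    0 < kje.2 & forall l C, 0 < C -> exists f s t,
      [/\ stepset q n f, 0 < s & 0 < t] /\
      [/\ (q n i f <= s%:E)%E, (q kje.1.1 l f <= t%:E)%E &
      ~ (q (m i) kje.1.2 f <= (kje.2 * s + C * t)%:E)%E]].
  have /forallNP/(_ (m i))/not_andP[//|] := Hn i.
  move=> /existsNP[k /existsNP[j /existsNP[e /not_implyP[e0 /forallNP H]]]].
  have {}H l C : 0 < C -> exists f s t,
      [/\ stepset q n f, 0 < s & 0 < t] /\ [/\ (q n i f <= s%:E)%E,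
      (q k l f <= t%:E)%E & ~ (q (m i) j f <= (e * s + C * t)%:E)%E].
    move=> C0; apply: contrapT => H1; apply: (H l).
    exists C => // f s t nf s0 t0 fi fl; apply: contrapT => fC; apply: H1.
    by exists f, s, t.
  exists (k, j, e); split=> //=; rewrite ltnNge; apply/negP => km.
  have [f [s [t [[_ s0 t0] [_ ft]]]]] := H j 1 ltr01; apply.
  apply: le_trans (gnorm_mono q f km (leqnn j)) _.
  by apply: gnorm_le_trans ft _; rewrite mul1r lerDr mulr_ge0// ltW.
pose k i := (kje i).1.1; pose j i := (kje i).1.2; pose e i := (kje i).2.
have e0 i : 0 < e i by case: (kjeP i).
have /choice[x xP] (il : nat * nat) : exists x, [/\ stepset q n x,
    (q n il.1 x <= 1%:E)%E,
    (q (k il.1) il.2 x <= (e il.1 / il.2.+1%:R)%:E)%E &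
    ~ (q (m il.1) (j il.1) x <= (e il.1)%:E)%E].
  case: il => i l /=; have [_ _ /(_ l l.+1%:R (ltr0Sn R _))] := kjeP i.
  set L := l.+1%:R; move=> [f [s [t [[nf s0 t0] [fi fl fC]]]]].
  have L0 : 0 < L by rewrite ltr0Sn.
  (* Dividing by a makes the first norm at most 1 and the second at most e/L, while e a = e s + L t
     is exactly the bound that f violates. *)
  pose a := s + L * t / e i.
  have a0 : 0 < a by rewrite addr_gt0// divr_gt0// mulr_gt0.
  have ai : 0 <= a^-1 by rewrite invr_ge0 ltW.
  exists (a^-1%:C%C *: f); split; first exact: stepsetZ.
  - apply: gnorm_le_trans (gnormZr ai fi) _.
    by rewrite mulrC ler_pdivrMr// mul1r /a lerDl ltW// divr_gt0 ?mulr_gt0.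
  - apply: gnorm_le_trans (gnormZr ai fl) _.
    rewrite mulrC ler_pdivrMr// mulrC /a mulrDl.
    have -> : L * t / e i * (e i / L) = t.
      by rewrite mulrA divfK ?gt_eqF// mulrAC mulfV ?gt_eqF// mul1r.
    by rewrite lerDr ltW// mulr_gt0 ?divr_gt0.
  - move=> /gnormZr_inv; rewrite invr_gt0 invrK => /(_ a0).
    rewrite /a mulrDr mulrCA mulfV ?gt_eqF// mulr1; exact: fC.
(* The point 0 is added so that neighborhoods of 0 within the set can be compared. *)
pose B : set (indlim S) :=
  [set x (i, l) | i in setT & l in setT] `|` [set 0].
have kn i : (n <= k i)%N.
  by have [/ltnW mk _ _] := kjeP i; apply: leq_trans mk; rewrite ltnW.
have bX : union_bounded q [set x (i, l) | i in setT & l in setT].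
  apply: (@family_bounded n k e (fun i l => x (i, l))) => //.
  - by move=> i l; have [] := xP (i, l).
  - by move=> i l; have [] := xP (i, l).
  - move=> i l; have [_ _ H _] := xP (i, l); apply: gnorm_le_trans H _ => /=.
    by rewrite ler_pdivrMr// ler_peMr// ?ler1n// ltW.
have bB : union_bounded q B.
  move=> W nW; have [r r0 Hr] := bX W nW; exists r => // b [/Hr//|->].
  by rewrite scaler0; exact: union_nbhs0 nW.
have [N [BN topN]] := br _ ((indlim_boundedP Sq _).2 bB).
pose G : set (step S N) := [set y | (q (m N) (j N) (incl S N y) <= (e N)%:E)%E].
have nG : nbhs (0 : step S N) G.
  apply/Sq.2; exists (j N), (e N) => // y.
  by apply: le_trans; apply: gnorm_mono => //; rewrite leqW// leq_addl.
have [_ [|O' oO' GO']] := topN (incl S N @` G° `&` B).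
  by exists G° => //; exact: open_interior.
have : O' 0.
  have : (O' `&` B) 0.
    rewrite -GO'; split; last by right.
    by exists 0; [exact: nG|rewrite linear0].
  by case.
move=> O'0; have /(indlim_nbhsP Sq)[W nW WO'] : nbhs (0 : indlim S) O'.
  exact: open_nbhs_nbhs.
have [l0 [e1 e10 We1]] := nW.2 (k N).
pose l := maxn l0 (Num.bound (e N / e1)).
have [nx _ xl xN] := xP (N, l); apply: xN.
have Bx : B (x (N, l)) by left; exists N => //; exists l.
have : (O' `&` B) (x (N, l)).
  split=> //; rewrite -[x _]add0r; apply: WO'; apply: We1.
    exact: stepset_mono (kn N) _ nx.
  apply: le_trans (gnorm_mono q _ (leqnn _) (leq_maxl l0 (Num.bound (e N / e1)))) _.
  apply: gnorm_le_trans xl _ => /=; rewrite ler_pdivrMr// mulrC -ler_pdivrMr//.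
  apply: le_trans (ltW (archi_boundP _)) _; first by rewrite divr_ge0// ltW.
  by rewrite ler_nat leqW// leq_maxr.
by rewrite -GO' => -[[y /interior_subset Gy <-] _].
Qed.

(** Completeness puts a bounded set into some step as a bounded set, hence into some [A j]. Its
    differences lie in [A j.+1], where the limit and the step [n j.+2] induce the same topology. *)
Lemma Q_boundedly_retractive : steps_complete q -> norms_closed q -> cond_Q q ->
  boundedly_retractive S.
Proof.
move=> cS qcl Q B /(indlim_boundedP Sq) bB.
have [n0 Bn0] := complete_bounded Sq qcl (cond_Q_complete Sq cS Q) bB.
have [n [A nA]] := retakh_chain_exists Q.
have [|j BA] := chain_absorb nA _ Bn0.
  by move=> b Bb l; have [e He] := Bn0 l; apply: le_lt_trans (He _ Bb) (ltry _).
pose m := n j.+2; exists m.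
have mA w : A j.+1 w -> stepset q m w.
  move=> /(chain_step nA); apply: stepset_mono.
  by case: (nA.1 j.+1) => /ltnW.
have Bm : B `<=` range (incl S m).
  by move=> b Bb; apply/Sq.1/mA/(chain_mono nA (leqnSn j))/BA.
split=> // T; split=> -[O oO ->].
  exists (incl S m @^-1` O).
    by move/continuousP: (@incl_continuous _ _ S m); apply.
  apply/seteqP; split=> b [].
    by move=> Ob Bb; split=> //; have [y _ yb] := Bm b Bb; exists y; rewrite // /preimage/= yb.
  by move=> [y Oy <-].
(* An open set of the step need not be open in the limit; the implication imposes nothing outside
   [B], so the points of [O] in [B] are interior to [G]. *)
pose G : set (indlim S) := [set x | B x -> ((incl S m @` O) `&` B) x].
exists (interior G); first exact: open_interior.
apply/seteqP; split=> a; last by move=> [/interior_subset Ga Ba]; exact: Ga.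
move=> [[y Oy ya] Ba]; split=> //; apply/(indlim_nbhsP Sq).
have : nbhs (0 : step S m) [set z | O (y + z)].
  have := nbhsB (- y) (open_nbhs_nbhs (conj oO Oy)); rewrite addNr.
  by apply: filterS => _ [z Oz <-] /=; rewrite addrA subrr add0r.
move=> /Sq.2[l [e e0 Oe]]; have [W nW HW] := chain_coincide nA j.+1 l e0.
exists W => // w Ww Baw; split=> //.
have Aw : A j.+1 w.
  have -> : w = (a + w) - a by rewrite addrC addKr.
  by apply: (chainD nA); [exact: BA|apply: (acxN (chain_acx nA j)); exact: BA].
have /Sq.1[z _ zw] := mA _ Aw.
exists (y + z); last by rewrite linearD ya zw.
by apply: Oe; rewrite zw; exact: HW.
Qed.

End ConditionsQ.

(** * The weighted spaces of ultradifferentiable functions *)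

Section ConcreteNorms.
Context (R : realType) (d : nat) (M : weight_sequence R) (V : weight_system R d).
Local Notation C := R[i].
Local Notation X := (union_vect M V).
Implicit Types (f g : X) (n m j : nat) (e : R) (alpha : {ffun 'I_d -> nat}).

(** The values h = j + 1 are cofinal among all h > 0 and remain positive at j = 0. *)
Definition unorm n j (f : X) : \bar R := bnorm M (V n) j.+1%:R (f : 'rV[R]_d -> C).

Lemma union_vect_smooth f : csmooth f.
Proof. by have /asboolP[n _ /(_ 1 ltr01)[]] := union_funP f. Qed.

Lemma wsys_mono n m x : (n <= m)%N -> V m x <= V n x.
Proof.
elim: m => [|m IH]; first by rewrite leqn0 => /eqP ->.
rewrite leq_eqVlt => /predU1P[->//|/IH]; apply: le_trans; exact: wsys_decr.
Qed.

Lemma union_vect_linE (a : C) f g :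
  (a *: f + g : X) = (a *: (f : 'rV[R]_d -> C) + g) :> ('rV[R]_d -> C).
Proof. by []. Qed.

Lemma unorm_lin n j (a : C) f g (e1 e2 : R) : (unorm n j f <= e1%:E)%E ->
  (unorm n j g <= e2%:E)%E -> (unorm n j (a *: f + g)%R <= (cabs a * e1 + e2)%:E)%E.
Proof.
move=> fe ge; rewrite /unorm union_vect_linE.
by apply: bnorm_lin => //; exact: union_vect_smooth.
Qed.

Lemma unorm_ge0 n j f : (0 <= unorm n j f)%E.
Proof.
apply: le_trans (ereal_sup_ubound _); last by exists ([ffun=> 0%N], 0).
rewrite lee_fin; apply: divr_ge0; last exact/ltW/wseq_gt0.
by rewrite mulr_ge0 ?mulr_ge0 ?exprn_ge0 ?cabs_ge0// ltW// weight_gt0.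
Qed.

Lemma unorm0 n j : unorm n j 0 = 0%E.
Proof. by apply/eqP; rewrite eq_le unorm_ge0 andbT; exact: bnorm0. Qed.

Lemma unormD n j f g (a b : R) : (unorm n j f <= a%:E)%E ->
  (unorm n j g <= b%:E)%E -> (unorm n j (f + g)%R <= (a + b)%:E)%E.
Proof.
move=> fa gb; have := unorm_lin 1 fa gb; rewrite scale1r.
by have -> : cabs (1 : C) = 1; [rewrite /cabs normr1|rewrite mul1r].
Qed.

Lemma unormZ n j (c : C) f (a : R) : (unorm n j f <= a%:E)%E ->
  (unorm n j (c *: f)%R <= (cabs c * a)%:E)%E.
Proof.
move=> fa; rewrite -[c *: f]addr0 -[cabs c * a]addr0.
by apply: unorm_lin => //; rewrite unorm0.
Qed.

Lemma unorm_incr n j f : (unorm n j f <= unorm n j.+1 f)%E.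
Proof. by apply: bnorm_mono => //; rewrite ler_nat. Qed.

Lemma unorm_decr n j f : (unorm n.+1 j f <= unorm n j f)%E.
Proof. by apply: bnorm_mono => //; exact: wsys_decr. Qed.

Lemma unorm_cover f : exists n, forall j, (unorm n j f < +oo)%E.
Proof.
by have /asboolP[n _ Bf] := union_funP f; exists n => j; have [] := Bf j.+1%:R (ltr0Sn R j).
Qed.

Definition union_grid : norm_grid X := NormGrid unorm0 unorm_ge0 unormD unormZ
  unorm_incr unorm_decr unorm_cover.

Lemma stepsetP n f : stepset union_grid n f <-> frechet_B M (V n) f.
Proof.
split=> [nf h h0|Bf j]; last by have [] := Bf j.+1%:R (ltr0Sn R j).
split; first exact: union_vect_smooth.
have hb := archi_boundP (ltW h0).
apply: le_lt_trans (nf (Num.bound h)); apply: bnorm_mono => //.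
by apply: le_trans (ltW hb) _; rewrite ler_nat.
Qed.

Lemma union_spectrum_norms : spectrum_norms (B_spectrum M V) union_grid.
Proof.
split=> n => [f|W].
  split=> [[y _ <-]|/stepsetP Bf].
    by apply/stepsetP; exact/asboolP/frechet_funP.
  have fB : (f : 'rV[R]_d -> C) \in frechet_pred M (V n) by exact/asboolP.
  by exists (FrechetVect fB) => //; exact: val_inj.
split=> [/lc_nbhs0E[_ [h h0 [e e0 ->]] WW]|[l [e e0 We]]].
  exists (Num.bound h), e => // x xe; apply: WW.
  apply: le_trans xe; apply: bnorm_mono => //.
  by apply: le_trans (ltW (archi_boundP (ltW h0))) _; rewrite ler_nat.
apply/lc_nbhs0E; exists (frechet_ball (M:=M) (w:=V n) l.+1%:R e).
  by exists l.+1%:R => //; exists e.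
by move=> x xe; exact: We.
Qed.

Definition evalnorm n j alpha x f : R :=
  j.+1%:R ^+ morder alpha * cabs (cderiv alpha f x) * V n x / M (morder alpha).

Lemma unorm_leP n j f e : (unorm n j f <= e%:E)%E <->
  forall alpha x, evalnorm n j alpha x f <= e.
Proof. exact: bnorm_leP. Qed.

Lemma evalnorm_factor n j alpha x f : evalnorm n j alpha x f =
  (j.+1%:R ^+ morder alpha * V n x / M (morder alpha)) * cabs (cderiv alpha f x).
Proof. by rewrite /evalnorm; ring. Qed.

Lemma evalcoef_gt0 n j alpha x :
  0 < j.+1%:R ^+ morder alpha * V n x / M (morder alpha).
Proof. by rewrite divr_gt0 ?wseq_gt0// mulr_gt0 ?exprn_gt0 ?weight_gt0. Qed.

Lemma cderiv_unionZ alpha (a : C) f x :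
  cderiv alpha (a *: f : X) x = a * cderiv alpha f x.
Proof.
have -> : (a *: f : X) = (a *: (f : 'rV[R]_d -> C) + 0) :> ('rV[R]_d -> C).
  by rewrite addr0.
by rewrite cderiv_lin ?cderiv0 ?addr0; [|exact: union_vect_smooth|exact: csmooth0].
Qed.

Lemma cderiv_unionD alpha f g x :
  cderiv alpha (f + g : X) x = cderiv alpha f x + cderiv alpha g x.
Proof.
have -> : (f + g : X) = (1 *: (f : 'rV[R]_d -> C) + g) :> ('rV[R]_d -> C).
  by rewrite scale1r.
by rewrite cderiv_lin ?mul1r//; exact: union_vect_smooth.
Qed.

Lemma cderiv_nbhs alpha x e : 0 < e ->
  union_nbhs union_grid [set f | cabs (cderiv alpha f x) <= e].
Proof.
move=> e0; split.
  split=> [|a f a1 /= fe]; last first.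
    rewrite cderiv_unionZ cabsM; apply: le_trans fe.
    by rewrite ler_piMl ?cabs_ge0// -lecR -cabsE.
  apply/convex_setP => f g l l0 l1 /= fe ge.
  suff : cabs (cderiv alpha (l *: f + (1 - l) *: g : X) x) <= e by [].
  rewrite cderiv_unionD !cderiv_unionZ; apply: le_trans (cabsD _ _) _.
  rewrite !cabsM; have -> : e = cabs l * e + cabs (1 - l) * e.
    rewrite -mulrDl; have -> : cabs l + cabs (1 - l) = 1; last by rewrite mul1r.
    apply: complexI; rewrite rmorphD/= -!cabsE !ger0_norm ?subr_ge0//.
    by rewrite addrC subrK.
  by rewrite lerD// ler_wpM2l// cabs_ge0.
move=> n; exists 0%N.
exists (e * (1%:R ^+ morder alpha * V n x / M (morder alpha))).
  by rewrite mulr_gt0// (evalcoef_gt0 n 0%N).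
move=> f _ /unorm_leP/(_ alpha x); rewrite evalnorm_factor mulrC ler_pM2r//.
exact: (evalcoef_gt0 n 0%N).
Qed.

(** The norm is a supremum of weighted point evaluations of derivatives, each continuous on the
    whole limit by [cderiv_nbhs]. If one evaluation exceeds e, perturbations eating up at most half
    of the excess keep it above e. *)
Lemma union_norms_closed : norms_closed union_grid.
Proof.
move=> n j e f fe.
have [alpha [x fx]] : exists alpha x, e < evalnorm n j alpha x f.
  apply: contrapT => H; apply: fe; apply/unorm_leP => alpha x.
  by rewrite leNgt; apply/negP => ?; apply: H; exists alpha, x.
set c := j.+1%:R ^+ morder alpha * V n x / M (morder alpha).
have c0 : 0 < c by exact: evalcoef_gt0.
rewrite evalnorm_factor -/c in fx.
pose del := (c * cabs (cderiv alpha f x) - e) / (2%:R * c).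
have del0 : 0 < del.
  by rewrite /del divr_gt0 ?subr_gt0//; exact: (mulr_gt0 (ltr0Sn R 1) c0).
exists [set h : X | cabs (cderiv alpha h x) <= del]; first exact: cderiv_nbhs.
move=> h /= hd /unorm_leP/(_ alpha x); rewrite evalnorm_factor -/c; apply/negP.
rewrite -ltNge.
rewrite cderiv_unionD.
have : cabs (cderiv alpha f x) <=
    cabs (cderiv alpha f x + cderiv alpha h x) + cabs (cderiv alpha h x).
  have -> : cabs (cderiv alpha h x) = cabs (- cderiv alpha h x).
    by rewrite /cabs normrN.
  by apply: le_trans (cabsD _ _); rewrite addrK.
move=> /(ler_wpM2l (ltW c0)); rewrite mulrDr.
have : c * cabs (cderiv alpha h x) <= c * del by rewrite ler_wpM2l// ltW.
have -> : c * del = (c * cabs (cderiv alpha f x) - e) / 2%:R.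
  by rewrite /del; field; rewrite gt_eqF.
lra.
Qed.

End ConcreteNorms.

(** * Derivatives along lines, equality of mixed derivatives, limits of smooth functions *)

Section DirectionalDerivatives.
Context (R : realType) (W : normedModType R).
Implicit Types (f : W -> R) (x v : W) (l e t h : R).

(** This quotient-free form admits h = 0 and passes to pointwise limits of functions. *)
Lemma is_deriveP f x v l : is_derive x v f l <->
  forall e, 0 < e -> exists2 r : R, 0 < r & forall h, `|h| < r ->
    `|f (x + h *: v) - f x - h * l| <= e * `|h|.
Proof.
split=> [[df dfl] e e0|H].
  have : h^-1 *: (f (h *: v + x) - f x) @[h --> 0^'] --> l.
    by rewrite -dfl; exact: df.
  move=> /cvgrPdist_le/(_ e e0)[r /= r0 Hr]; exists r => // h hr.
  have [->|h0] := eqVneq h 0; first by rewrite scale0r addr0 subrr !mul0r subrr normr0 mulr0.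
  have := Hr h; rewrite /ball_/= sub0r normrN => /(_ hr h0).
  rewrite -(ler_pM2r (_ : 0 < `|h|)) ?normr_gt0// -normrM mulrBl.
  by rewrite /GRing.scale/= mulrAC mulVf// mul1r distrC [h *: v + x]addrC [l * h]mulrC.
have : h^-1 *: (f (h *: v + x) - f x) @[h --> 0^'] --> l.
  apply/cvgrPdist_le => e e0; have [r r0 Hr] := H e e0.
  exists r => //= h; rewrite /ball_/= sub0r normrN => hr h0.
  rewrite -(ler_pM2r (_ : 0 < `|h|)) ?normr_gt0// -normrM mulrBl.
  rewrite /GRing.scale/= mulrAC mulVf// mul1r distrC [h *: v + x]addrC [l * h]mulrC.
  exact: Hr.
move=> cl; split; first by apply/cvg_ex; exists l.
exact: cvg_lim cl.
Qed.

End DirectionalDerivatives.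

Section OneVariable.
Context (R : realType).
Implicit Types (g dg : R -> R) (x l e t h a b : R).

Lemma is_derive1P g x l : is_derive x 1 g l <->
  forall e, 0 < e -> exists2 r : R, 0 < r & forall h, `|h| < r ->
    `|g (x + h) - g x - h * l| <= e * `|h|.
Proof.
split=> [/is_deriveP H e /H[r r0 Hr]|H].
  by exists r => // h /Hr; rewrite /GRing.scale/= mulr1.
apply/is_deriveP => e /H[r r0 Hr].
by exists r => // h /Hr; rewrite /GRing.scale/= mulr1.
Qed.

(** The intermediate point is recorded as a fraction c of h, which covers both signs of h; a
    negative h is treated from the other endpoint, with 1 - c. *)
Lemma mean_value g dg : (forall t, is_derive t 1 g (dg t)) ->
  forall t h, exists2 c, 0 <= c <= 1 & g (t + h) - g t = dg (t + c * h) * h.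
Proof.
move=> Hg; have cg : continuous g.
  by move=> t; apply/differentiable_continuous/derivable1_diffP; case: (Hg t).
have pos t h : 0 <= h -> exists2 c, 0 <= c <= 1 & g (t + h) - g t = dg (t + c * h) * h.
  move=> h0; have tth : t <= t + h by rewrite lerDl.
  have [c] := MVT_segment tth (fun s _ => Hg s) (continuous_subspaceT cg).
  rewrite in_itv/= => /andP[tc ch] ->.
  have [->|hn] := eqVneq h 0.
    by exists 0; rewrite ?lexx ?ler01// addr0 subrr !mulr0.
  have hp : 0 < h by rewrite lt_def hn.
  exists ((c - t) / h); last by rewrite divfK// [t + (c - t)]addrC subrK [t + h]addrC addrK.
  by rewrite divr_ge0 ?subr_ge0//= ler_pdivrMr// mul1r lerBlDl.
move=> t h; have [h0|h0] := leP 0 h; first exact: pos.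
have [|c /andP[c0 c1] gc] := pos (t + h) (- h).
  by rewrite oppr_ge0 ltW.
exists (1 - c); first by rewrite subr_ge0 c1 gerBl c0.
move: gc; rewrite addrK mulrN mulrN => /eqP.
rewrite -eqr_oppLR opprB => /eqP ->.
by rewrite -addrA mulrBl mul1r.
Qed.

End OneVariable.

Lemma is_derive_line (R : realType) (W : normedModType R) (f : W -> R)
    (x v : W) (l t : R) : is_derive (x + t *: v) v f l ->
  is_derive t 1 (fun s : R => f (x + s *: v)) l.
Proof.
move=> /is_deriveP H; apply/is_derive1P => e /H[r r0 Hr].
by exists r => // h /Hr; rewrite scalerDl addrA.
Qed.
Lemma continuousP_eps (R : realType) (W : normedModType R) (f : W -> R) (x : W) (e : R) :
  {for x, continuous f} -> 0 < e ->
  exists2 r : R, 0 < r & forall y, `|y| < r -> `|f (x + y) - f x| <= e.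
Proof.
move=> /cvgrPdist_le/(_ e) H e0; have /nbhs_ballP[r r0 Hr] := H e0.
exists r => // y yr; rewrite distrC; apply: Hr.
by rewrite -ball_normE/= opprD addrA subrr add0r normrN.
Qed.

Lemma dist_third (R : realFieldType) (p u v : R) :
  `|p - u| <= `|u - v| / 3%:R -> `|p - v| <= `|u - v| / 3%:R ->
  0 < `|u - v| / 3%:R -> False.
Proof.
move=> pu pv; have := ler_normD (u - p) (p - v).
rewrite addrA subrK [`|u - p|]distrC; lra.
Qed.

Section Schwarz.
Context (R : realType) (d : nat).
Implicit Types (f : 'rV[R]_d -> R) (i j : 'I_d) (s : seq 'I_d) (x y : 'rV[R]_d).
Local Notation e_ i := (delta_mx (0 : 'I_1) i : 'rV[R]_d).

Lemma partials_is_derive f s i x : smooth f ->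
  is_derive x (e_ i) (partials s f) (partials (i :: s) f x).
Proof. by move=> sf; have [_ df] := sf s; split. Qed.

Lemma partials_cat f s s' : partials s (partials s' f) = partials (s ++ s') f.
Proof. by rewrite /partials foldr_cat. Qed.

Lemma smooth_partials f s : smooth f -> smooth (partials s f).
Proof. by move=> sf s'; rewrite partials_cat; exact: sf. Qed.

Lemma second_difference f i j x (h : R) : smooth f ->
  exists c c' : R, [/\ 0 <= c <= 1, 0 <= c' <= 1 &
    f (x + h *: e_ j + h *: e_ i) - f (x + h *: e_ i) - (f (x + h *: e_ j) - f x) =
    partials [:: j; i] f (x + ((c * h) *: e_ i + (c' * h) *: e_ j)) * h * h].
Proof.
move=> sf.
have Hphi (t : R) : is_derive t 1
    (fun s : R => f (x + h *: e_ j + s *: e_ i) - f (x + s *: e_ i))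
    (partials [:: i] f (x + h *: e_ j + t *: e_ i) - partials [:: i] f (x + t *: e_ i)).
  by apply: is_deriveB; apply: is_derive_line; exact: (partials_is_derive [::]).
have [c c01 Hc] := mean_value Hphi 0 h.
have Hpsi (t : R) : is_derive t 1
    (fun s : R => partials [:: i] f (x + (c * h) *: e_ i + s *: e_ j))
    (partials [:: j; i] f (x + (c * h) *: e_ i + t *: e_ j)).
  by apply: is_derive_line; exact: (partials_is_derive [:: i]).
have [c' c'01 Hc'] := mean_value Hpsi 0 h.
exists c, c'; split=> //.
move: Hc Hc'; rewrite !add0r !scale0r !addr0 => -> Hc'.
by rewrite addrAC Hc' addrA.
Qed.

(** The second difference of f is symmetric in i and j. By [second_difference] it equals h^2 times
    either mixed derivative at some point near x, so the continuous mixed derivatives agree at x. *)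
Lemma partialC f i j : smooth f -> partials [:: i; j] f = partials [:: j; i] f.
Proof.
move=> sf; apply/funext => x; apply: contrapT => /eqP ab.
set a := partials _ f x in ab *; set b := partials _ f x in ab *.
pose del := `|a - b| / 3%:R.
have del0 : 0 < del by rewrite divr_gt0// normr_gt0 subr_eq0.
have [r1 r10 H1] := continuousP_eps ((sf [:: i; j]).1 x) del0.
have [r2 r20 H2] := continuousP_eps ((sf [:: j; i]).1 x) del0.
pose K := `|e_ i| + `|e_ j| + 1; have K0 : 0 < K by rewrite ltr_wpDl ?addr_ge0.
pose h := Num.min r1 r2 / K.
have m0 : 0 < Num.min r1 r2 by rewrite lt_min r10.
have h0 : 0 < h by rewrite divr_gt0.
have hK : h * K = Num.min r1 r2 by rewrite divfK ?gt_eqF.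
clearbody h.
have small (c c' : R) (u v : 'I_d) : 0 <= c <= 1 -> 0 <= c' <= 1 ->
    `|e_ u| + `|e_ v| < K ->
    `|(c * h) *: e_ u + (c' * h) *: e_ v| < Num.min r1 r2.
  move=> /andP[c0 c1] /andP[c'0 c'1] uv; apply: le_lt_trans (ler_normD _ _) _.
  rewrite !normrZ (ger0_norm c0) (ger0_norm c'0) (gtr0_norm h0).
  apply: (@le_lt_trans _ _ (h * (`|e_ u| + `|e_ v|))).
    by rewrite mulrDr lerD// -!mulrA ler_piMl// mulr_ge0// ltW.
  by rewrite -hK ltr_pM2l.
have [c1 [c2 [c10 c20 E1]]] := second_difference i j x h sf.
have [c3 [c4 [c30 c40 E2]]] := second_difference j i x h sf.
have E : partials [:: j; i] f (x + ((c1 * h) *: e_ i + (c2 * h) *: e_ j)) =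
         partials [:: i; j] f (x + ((c3 * h) *: e_ j + (c4 * h) *: e_ i)).
  apply: (mulIf (lt0r_neq0 h0)); apply: (mulIf (lt0r_neq0 h0)).
  apply: etrans (esym E1) _; apply: etrans E2.
  rewrite [x + h *: e_ i + h *: e_ j]addrAC.
  by rewrite !opprB; ring.
have s1 := small c1 c2 i j c10 c20 _; have s2 := small c3 c4 j i c30 c40 _.
have := H2 _ (lt_le_trans (s1 _) _); rewrite E => /(_ _ _) B2.
have := H1 _ (lt_le_trans (s2 _) _) => B1.
have ij : `|e_ i| + `|e_ j| < K by rewrite /K ltrDl.
have ji : `|e_ j| + `|e_ i| < K by rewrite addrC.
have {}B1 := B1 ji; have {}B2 := B2 ij.
move: B1 B2; rewrite ge_min lexx /= ge_min lexx orbT => /(_ isT) B1 /(_ isT) B2.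
exact: dist_third B1 B2 del0.
Qed.

Lemma partials_swap f i s : smooth f -> partials (i :: s) f = partials (rcons s i) f.
Proof.
move=> sf; elim: s => //= j s IH; rewrite -[RHS]/(partial j (partials (rcons s i) f)).
rewrite -IH; exact: partialC (smooth_partials s sf).
Qed.

Lemma partials_perm f s s' : smooth f -> perm_eq s s' -> partials s f = partials s' f.
Proof.
move=> sf; elim: s s' => [|i s IH] s' ss'.
  by move: ss'; rewrite perm_sym => /perm_nilP ->.
have is' : i \in s' by rewrite -(perm_mem ss') mem_head.
case/splitPr: is' ss' => p1 p2; rewrite perm_sym perm_catC/= perm_cons perm_catC perm_sym.
move=> /IH ps; rewrite -cat_rcons -partials_cat -partials_swap; last exact: smooth_partials.
by rewrite /= partials_cat ps.
Qed.

Lemma count_directions (alpha : {ffun 'I_d -> nat}) i :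
  count_mem i (directions alpha) = alpha i.
Proof.
rewrite /directions count_flatten -map_comp sumnE big_map big_enum/=.
rewrite (bigD1 i)//= count_nseq/= eqxx mul1n big1 ?addn0// => j ji.
by rewrite count_nseq/= (negbTE ji) mul0n.
Qed.

(** The norms control derivatives only in the order fixed by [directions], whereas [smooth] asks for
    all orders; this bridges the two. *)
Lemma partials_directions f s : smooth f ->
  partials s f = partials (directions [ffun i => count_mem i s]) f.
Proof.
move=> sf; apply: partials_perm => //; apply/allP => i _.
by rewrite /= count_directions ffunE.
Qed.

End Schwarz.

Lemma continuous_distP (R : realType) (W : normedModType R) (f : W -> R) (x : W) :
  {for x, continuous f} <->
  forall e, 0 < e -> nbhs x [set z | `|f x - f z| <= e].
Proof. by split=> [/cvgrPdist_le|H]; last exact/cvgrPdist_le. Qed.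

Lemma nbhs_translate (R : realType) (W : normedModType R) (U : set W) (x : W) :
  nbhs x U -> exists2 r : R, 0 < r & forall y, `|y| < r -> U (x + y).
Proof.
move=> /nbhs_ballP[r r0 Hr]; exists r => // y yr; apply: Hr.
by rewrite -ball_normE/= opprD addrA subrr add0r normrN.
Qed.

Section SmoothLimit.
Context (R : realType) (d : nat).
Implicit Types (f : 'rV[R]_d -> R) (i : 'I_d) (s : seq 'I_d) (x : 'rV[R]_d).
Local Notation e_ i := (delta_mx (0 : 'I_1) i : 'rV[R]_d).

Lemma geometric_limit (u : nat -> R) (K : R) (s0 : nat) :
  (forall p q : nat, (s0 <= p)%N -> (p <= q)%N -> `|u p - u q| <= K * 2%:R ^- p) ->
  cvgn u.
Proof.
move=> uK; have K0 : 0 <= K.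
  have := uK s0 s0 (leqnn _) (leqnn _); rewrite subrr normr0.
  by rewrite pmulr_lge0// invr_gt0 exprn_gt0.
apply/cauchy_cvgP/cauchy_exP => e /= e0.
have [n0 Hn0] := expr2V_lt (divr_gt0 e0 (ltr_wpDl K0 (ltr0Sn R 1))).
pose n := maxn s0 n0; exists (u n), n => // m /= nm.
rewrite /ball/=; apply: le_lt_trans (uK n m (leq_maxl _ _) nm) _.
have := Hn0 n (leq_maxr _ _); rewrite ler_pdivlMr ?ltr_wpDl//.
have : 0 < 2%:R ^- n :> R by rewrite invr_gt0 exprn_gt0.
move: (2%:R ^- n) => w w0; nra.
Qed.

Lemma cvg_dist_le (u : nat -> R) (a K : R) (n : nat) :
  cvgn u -> (forall m, (n <= m)%N -> `|a - u m| <= K) -> `|a - limn u| <= K.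
Proof.
move=> cu H; have ca : (fun m => `|a - u m|) @ \oo --> `|a - limn u|.
  by apply: cvg_norm; apply: cvgB => //; exact: cvg_cst.
apply: (cvgr_to_le ca); exists n => //.
Qed.

Context (y : nat -> 'rV[R]_d -> R).
Hypothesis sy : forall p, smooth (y p).
Hypothesis yC : forall s x, exists K (p0 : nat), exists2 U, nbhs x U &
  forall (p q : nat) z, (p0 <= p)%N -> (p <= q)%N -> U z ->
    `|partials s (y p) z - partials s (y q) z| <= K * 2%:R ^- p.

Let G s x := limn (fun p => partials s (y p) x).

Let cG s x : cvgn (fun p => partials s (y p) x).
Proof.
have [K [p0 [U Ux H]]] := yC s x; apply: (@geometric_limit _ K p0) => p q p0p pq.
by apply: H => //; exact: nbhs_singleton.
Qed.

Let Gunif s x e : 0 < e -> exists (p0 : nat), exists2 U, nbhs x U &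
  forall (p : nat) z, (p0 <= p)%N -> U z -> `|partials s (y p) z - G s z| <= e.
Proof.
move=> e0; have [K [p0 [U Ux H]]] := yC s x.
have K1 : 0 < `|K| + 1 by rewrite ltr_wpDl.
have [n0 Hn0] := expr2V_lt (divr_gt0 e0 K1).
exists (maxn p0 n0), U => // p z; rewrite geq_max => /andP[p0p n0p] Uz.
apply: (@cvg_dist_le (fun p => partials s (y p) z) _ _ p (@cG s z)) => q pq.
apply: le_trans (H p q z p0p pq Uz) _.
have := Hn0 p n0p; rewrite ler_pdivlMr//; apply: le_trans.
rewrite mulrC ler_wpM2l ?invr_ge0 ?exprn_ge0//.
by apply: le_trans (ler_norm K) _; rewrite lerDl.
Qed.

Let Gcont s : continuous (G s).
Proof.
move=> x; apply/continuous_distP => e e0.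
have e3 : 0 < e / 3%:R by rewrite divr_gt0.
have [p0 [U Ux H]] := Gunif s x e3.
have /continuous_distP/(_ _ e3) cy := (sy p0 s).1 x.
apply: (filterS _ (filterI cy Ux)) => z [/= yz Uz].
have Hx := H p0 x (leqnn _) (nbhs_singleton Ux); have Hz := H p0 z (leqnn _) Uz.
have third (a b c w : R) : `|a - b| <= e / 3%:R -> `|c - w| <= e / 3%:R ->
    `|a - c| <= e / 3%:R -> `|b - w| <= e.
  rewrite !ler_norml => /andP[? ?] /andP[? ?] /andP[? ?]; apply/andP; split; lra.
exact: third Hx Hz yz.
Qed.

(** The mean value theorem and the locally uniform convergence of the next derivative give the
    difference estimate for all late approximants with the same radius; it then passes to the
    limit. *)
Let Gderive s i x : is_derive x (e_ i) (G s) (G (i :: s) x).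
Proof.
apply/is_deriveP => e e0.
have e4 : 0 < e / 2%:R by rewrite divr_gt0.
have [p0 [U Ux H]] := Gunif (i :: s) x e4.
have /continuous_distP/(_ _ e4) cG1 := @Gcont (i :: s) x.
have [r r0 Hr] := nbhs_translate (filterI Ux cG1).
pose K := `|e_ i| + 1; have K0 : 0 < K by rewrite ltr_wpDl.
exists (r / K); first by rewrite divr_gt0.
move=> h hr.
have bound p : (p0 <= p)%N ->
    `|partials s (y p) (x + h *: e_ i) - partials s (y p) x - h * G (i :: s) x|
      <= e * `|h|.
  move=> p0p.
  have Hd (t : R) : is_derive t 1 (fun u : R => partials s (y p) (x + u *: e_ i))
      (partials (i :: s) (y p) (x + t *: e_ i)).
    by apply: is_derive_line; exact: partials_is_derive.
  have [c /andP[c0 c1]] := mean_value Hd 0 h; rewrite !add0r scale0r addr0 => ->.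
  rewrite [_ * h]mulrC -mulrBr normrM mulrC ler_wpM2r//.
  have [Uz Gz] : (U `&` (fun t => `|G (i :: s) x - G (i :: s) t| <= e / 2%:R))
      (x + (c * h) *: e_ i).
    apply: Hr; rewrite normrZ.
    rewrite normrM (ger0_norm c0); apply: (@le_lt_trans _ _ (`|h| * `|e_ i|)).
      by rewrite ler_wpM2r// ler_piMl.
    apply: (@le_lt_trans _ _ (`|h| * K)); first by rewrite ler_wpM2l// lerDl.
    by rewrite -ltr_pdivlMr.
  have two (a b w : R) : `|a - b| <= e / 2%:R -> `|w - b| <= e / 2%:R -> `|a - w| <= e.
    rewrite !ler_norml => /andP[? ?] /andP[? ?]; apply/andP; split; lra.
  by apply: two (H p _ p0p Uz) Gz.
have c1 := @cG s (x + h *: e_ i); have c2 := @cG s x.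
have cv : (fun p => `|partials s (y p) (x + h *: e_ i) - partials s (y p) x
    - h * G (i :: s) x|) @ \oo --> `|G s (x + h *: e_ i) - G s x - h * G (i :: s) x|.
  by apply: cvg_norm; apply: cvgB; [exact: cvgB|exact: cvg_cst].
by apply: (cvgr_to_le cv); exists p0.
Qed.

Lemma smooth_limit : exists g, smooth g /\ forall s x,
  (fun p => partials s (y p) x) @ \oo --> partials s g x.
Proof.
exists (G [::]).
have GE s : partials s (G [::]) = G s.
  elim: s => //= i s ->; apply/funext => x.
  by case: (Gderive s i x).
split=> [s|s x]; last by rewrite GE; exact: cG.
rewrite GE; split; first exact: Gcont.
by move=> i x; case: (Gderive s i x).
Qed.

End SmoothLimit.

(** * From conditions on the weights to condition (Q) *)

Section WeightConditions.
Context (R : realType) (d : nat) (M : weight_sequence R) (V : weight_system R d).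
Local Notation X := (union_vect M V).
Implicit Types (f g : X) (n m j : nat) (e s t : R).

(** Regular decrease is applied to the set where e V_n <= V_m. There V_k / V_n is bounded below, so
    V_m <= V_n <= D V_k; elsewhere V_m < e V_n. *)
Lemma regularly_decreasing_split : regularly_decreasing V ->
  forall n, exists2 m, (n <= m)%N & forall k e, (m < k)%N -> 0 < e ->
    exists2 D : R, 0 < D & forall x, V m x <= e * V n x \/ V m x <= D * V k x.
Proof.
move=> rV n; have [m nm Hm] := rV n; exists m => // k e mk e0.
have := Hm k mk [set x | e * V n x <= V m x].
set I := ereal_inf [set _ | _ in _]; set J := ereal_inf [set _ | _ in _].
have eI : (e%:E <= I)%E.
  apply: le_ereal_inf_tmp => _ [x xY <-].
  by rewrite lee_fin ler_pdivlMr ?weight_gt0.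
move=> /(_ (lt_le_trans _ eI)); rewrite lte_fin => /(_ e0) J0.
(* The infimum is infinite when the set is empty; then 1 serves as a lower bound. *)
have [D D0 DJ] : exists2 D : R, 0 < D & (D%:E <= J)%E.
  by case: J J0 => [r| |] // r0; [exists r|exists 1; rewrite ?leey].
exists D^-1; first by rewrite invr_gt0.
move=> x; have [xY|xY] := leP (e * V n x) (V m x); last by left; exact: ltW.
right; have : (D%:E <= (V k x / V n x)%:E)%E.
  by apply: le_trans DJ _; apply: ereal_inf_lbound; exists x.
rewrite lee_fin ler_pdivlMr ?weight_gt0// -ler_pdivlMl// mulrC.
by apply: le_trans; apply: wsys_mono.
Qed.

(** (wQ) bounds the norm of a step m1 by C (s + t). At points where V_m <= (e/C) V_m1 this becomes e
    (s + t); at the others V_m <= D V_k gives D t directly. *)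
Lemma regularly_decreasing_Q : regularly_decreasing V ->
  cond_wQ (union_grid M V) -> cond_Q (union_grid M V).
Proof.
move=> /regularly_decreasing_split rV wQ; apply: cond_Q_later => n.
have [i [m1 [nm1 H1]]] := wQ n; have [m m1m Hm] := rV m1.
exists i, m; split=> [|k j e mk e0]; first exact: leq_trans m1m.
have [l [C C0 HC]] := H1 k j (leq_ltn_trans m1m mk).
have [D D0 HD] := Hm k _ mk (divr_gt0 e0 C0).
exists (maxn l j), (e + D); first by rewrite addr_gt0.
move=> f s t nf s0 t0 fs ft.
have f1 : (union_grid M V m1 j f <= (C * (s + t))%:E)%E.
  apply: HC => //; first by rewrite addr_gt0.
    by apply: gnorm_le_trans fs _; rewrite lerDl ltW.
  apply: le_trans (gnorm_mono _ f (leqnn k) (leq_maxl l j)) _.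
  by apply: gnorm_le_trans ft _; rewrite lerDr ltW.
have f2 : (union_grid M V k j f <= t%:E)%E.
  exact: le_trans (gnorm_mono _ f (leqnn k) (leq_maxr l j)) ft.
apply/unorm_leP => alpha x.
have {f1} := (unorm_leP _ _ _ _).1 f1 alpha x.
have {f2} := (unorm_leP _ _ _ _).1 f2 alpha x.
rewrite /evalnorm -!(mulrA _ (V _ x)) ![V _ x / _]mulrC.
rewrite !(mulrA _ (M (morder alpha))^-1).
set c := _ * (M (morder alpha))^-1 => f2 f1.
have c0 : 0 <= c.
  by rewrite /c mulr_ge0 ?invr_ge0 ?(ltW (wseq_gt0 _ _))// mulr_ge0 ?cabs_ge0 ?exprn_ge0.
have [/(ler_wpM2l c0)|/(ler_wpM2l c0)] := HD x.
  move=> /le_trans; apply; rewrite mulrCA.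
  apply: (@le_trans _ _ (e / C * (C * (s + t)))).
    by rewrite ler_wpM2l// ltW// divr_gt0.
  rewrite mulrA divfK ?gt_eqF// mulrDr mulrDl addrA lerDl.
  by rewrite mulr_ge0 ?ltW.
move=> /le_trans; apply; rewrite mulrCA.
apply: (@le_trans _ _ (D * t)); first by rewrite ler_wpM2l// ltW.
by rewrite mulrDl addrA lerDr addr_ge0// mulr_ge0 ?ltW.
Qed.

Lemma le_powR (r x y : R) : 0 <= r -> 0 <= x -> x <= y -> x `^ r <= y `^ r.
Proof.
move=> r0 x0 xy; apply: (ge0_ler_powR r0 _ _ xy); rewrite nnegrE//.
exact: le_trans xy.
Qed.

(** Either c t^th <= e s^th and the first term suffices, or s <= (c/e)^(1/th) t and the second one
    does. *)
Lemma young_powR (th c e : R) : 0 < th < 1 -> 0 < c -> 0 < e ->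
  exists2 C : R, 0 < C & forall s t, 0 < s -> 0 < t ->
    c * (s `^ (1 - th) * t `^ th) <= e * s + C * t.
Proof.
move=> /andP[th0 th1] c0 e0; pose B := (c / e) `^ th^-1.
have B0 : 0 < B by apply: powR_gt0; exact: divr_gt0.
have t1 : 0 <= 1 - th by rewrite subr_ge0 ltW.
exists (c * B `^ (1 - th)); first by rewrite mulr_gt0// powR_gt0.
move=> s t s0 t0.
have split_pow u : 0 < u -> u `^ (1 - th) * u `^ th = u.
  by move=> u0; rewrite -powRD ?subrK ?powRr1 ?ltW// gt_eqF// implybT.
have [cs|cs] := leP (c * t `^ th) (e * s `^ th).
  apply: (@le_trans _ _ (e * s)); last by rewrite lerDl !mulr_ge0 ?powR_ge0 ?ltW.
  rewrite mulrCA -[X in _ <= e * X](split_pow s s0) [leRHS]mulrCA.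
  by rewrite ler_wpM2l// powR_ge0.
have sB : s <= B * t.
  have thK u : 0 < u -> (u `^ th) `^ th^-1 = u.
    by move=> u0; rewrite -powRrM mulfV ?gt_eqF// powRr1// ltW.
  rewrite -(thK s s0) -[X in _ * X](thK t t0) -powRM ?powR_ge0 ?divr_ge0 ?(ltW c0) ?(ltW e0)//.
  apply: le_powR; rewrite ?invr_ge0 ?powR_ge0 ?(ltW th0)//.
  by rewrite mulrAC ler_pdivlMr// mulrC ltW.
apply: (@le_trans _ _ (c * B `^ (1 - th) * t)); last first.
  by rewrite lerDr mulr_ge0 ?ltW.
rewrite -mulrA ler_wpM2l ?(ltW c0)//.
apply: (@le_trans _ _ ((B * t) `^ (1 - th) * t `^ th)).
  rewrite ler_wpM2r ?powR_ge0//.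
  by apply: le_powR => //; exact: ltW.
by rewrite powRM ?(ltW B0) ?(ltW t0)// -mulrA split_pow.
Qed.

(** The interpolation is done at each point and derivative. The factor (j + 1)^p is charged entirely
    to V_k: a power r with r th >= 1 makes ((j + 1)^(r p))^th large enough, so the norm of index 0
    suffices for V_n. *)
Lemma Omega_Q : Omega V -> cond_Q (union_grid M V).
Proof.
move=> OV; apply: cond_Q_later => n; have [m nm Hm] := OV n.
exists 0%N, m; split=> // k j e mk e0.
have [th th01 [c c0 Hc]] := Hm k mk; have /andP[th0 th1] := th01.
have t1 : 0 <= 1 - th by rewrite subr_ge0 ltW.
have [C C0 HC] := young_powR th01 c0 e0.
pose r := Num.bound th^-1.
have rth : 1 <= r%:R * th.
  rewrite -ler_pdivrMr// div1r.
  by apply: ltW (archi_boundP _); rewrite invr_ge0 ltW.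
(* The predecessor compensates the shift h = l + 1 in [unorm]. *)
exists (j.+1 ^ r).-1, C => // f s t _ s0 t0.
have lE : (j.+1 ^ r).-1.+1 = (j.+1 ^ r)%N by rewrite prednK// expn_gt0.
move=> /unorm_leP fs /unorm_leP ft; apply/unorm_leP => alpha x.
apply: le_trans (HC s t s0 t0).
have {fs} := fs alpha x; have {ft} := ft alpha x.
rewrite /evalnorm lE natrX expr1n mul1r.
set p := morder alpha; set N := j.+1%:R; set D := cabs _.
have D0 : 0 <= D by exact: cabs_ge0.
have M0 := wseq_gt0 M p.
pose a := D / M p; have a0 : 0 <= a by rewrite divr_ge0// ltW.
have v0 i : 0 <= V i x by rewrite ltW// weight_gt0.
have -> : (N ^+ r) ^+ p * D * V k x / M p = (N ^+ r) ^+ p * a * V k x.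
  by rewrite /a; ring.
have -> : D * V n x / M p = a * V n x by rewrite /a; ring.
have -> : N ^+ p * D * V m x / M p = N ^+ p * (a * V m x) by rewrite /a; ring.
move=> ft fs; clearbody a.
have N0 : 0 <= (N ^+ r) ^+ p by rewrite !exprn_ge0.
have Np : N ^+ p <= ((N ^+ r) ^+ p) `^ th.
  rewrite -exprM -!powR_mulrn// -powRrM; apply: ler_powR; first by rewrite ler1n.
  by rewrite natrM mulrAC ler_peMl.
have [a00|an0] := eqVneq a 0.
  by rewrite a00 mul0r mulr0 mulr_ge0 ?mulr_ge0 ?powR_ge0 ?ltW.
have aS : a = a `^ (1 - th) * a `^ th.
  by rewrite -powRD ?subrK ?powRr1// an0 implybT.
apply: (@le_trans _ _ (((N ^+ r) ^+ p) `^ th *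
    (a * (c * (V n x `^ (1 - th) * V k x `^ th))))).
  apply: ler_pM => //; [by rewrite exprn_ge0|exact: mulr_ge0|].
  exact: ler_wpM2l.
rewrite {1}aS.
have -> : ((N ^+ r) ^+ p) `^ th * (a `^ (1 - th) * a `^ th *
    (c * (V n x `^ (1 - th) * V k x `^ th))) =
    c * ((a * V n x) `^ (1 - th) * ((N ^+ r) ^+ p * a * V k x) `^ th).
  by rewrite !powRM ?mulr_ge0//; ring.
rewrite ler_wpM2l ?(ltW c0)// ler_pM ?powR_ge0//;
  by apply: le_powR; rewrite ?mulr_ge0 ?(ltW th0).
Qed.

End WeightConditions.

Section ComplexModulus.
Context (R : realType).
Implicit Types (z w : R[i]).

Lemma ge_cabs_Re z : `|complex.Re z| <= cabs z.
Proof. by rewrite -lecR -cabsE; exact: normc_ge_Re. Qed.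

Lemma ge_cabs_Im z : `|complex.Im z| <= cabs z.
Proof.
case: z => a b; rewrite /cabs normc_def /= -sqrtr_sqr.
by rewrite ler_wsqrtr// lerDr sqr_ge0.
Qed.

Lemma le_cabs z : cabs z <= `|complex.Re z| + `|complex.Im z|.
Proof.
case: z => a b; rewrite /cabs normc_def /=.
rewrite -[leRHS]ger0_norm ?addr_ge0// -sqrtr_sqr ler_wsqrtr//.
rewrite sqrrD !real_normK ?num_real// [leRHS]addrAC lerDl.
by rewrite mulrn_wge0// mulr_ge0.
Qed.

Lemma cabs_limit_le (z : R[i]) (w : nat -> R[i]) (l : R[i]) (b : R) (n : nat) :
  (forall m, (n <= m)%N -> cabs (z - w m) <= b) ->
  (fun m => complex.Re (w m)) @ \oo --> complex.Re l ->
  (fun m => complex.Im (w m)) @ \oo --> complex.Im l ->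
  cabs (z - l) <= b.
Proof.
move=> zb cr ci; apply/ler_addgt0Pr => e e0.
have e2 : 0 < e / 2%:R by rewrite divr_gt0.
move/cvgrPdist_le : cr => /(_ _ e2)[N1 _ H1].
move/cvgrPdist_le : ci => /(_ _ e2)[N2 _ H2].
pose m := maxn n (maxn N1 N2).
have nm : (n <= m)%N by rewrite leq_maxl.
have h1 := H1 m; rewrite /= !leq_max leqnn !orbT in h1.
have h2 := H2 m; rewrite /= !leq_max leqnn !orbT in h2.
have := cabsD (z - w m) (w m - l); rewrite addrA subrK => /le_trans; apply.
apply: lerD; first exact: zb.
apply: le_trans (le_cabs _) _; rewrite [leRHS]splitr lerD//.
  by rewrite raddfB/= distrC; exact: h1.
by rewrite raddfB/= distrC; exact: h2.
Qed.

End ComplexModulus.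

(** * Completeness of the weighted Frechet spaces *)

Section StepsComplete.
Context (R : realType) (d : nat) (M : weight_sequence R) (V : weight_system R d).
Local Notation C := R[i].
Local Notation X := (union_vect M V).

Lemma cderiv_unionB alpha (f g : X) x :
  cderiv alpha (f - g : X) x = cderiv alpha f x - cderiv alpha g x.
Proof. by rewrite -scaleN1r cderiv_unionD cderiv_unionZ mulN1r. Qed.

Lemma partials_unionB (f g : X) (s : seq 'I_d) x :
  let D := cderiv [ffun i => count_mem i s] (f - g : X) x in
  partials s (re f) x - partials s (re g) x = complex.Re D /\
  partials s (im f) x - partials s (im g) x = complex.Im D.
Proof.
move=> D; rewrite /D cderiv_unionB !raddfB/=.
have [rf jf] := union_vect_smooth f; have [rg jg] := union_vect_smooth g.
by rewrite !(partials_directions s).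
Qed.

(** Near each point V_m is bounded below, so all derivatives converge locally uniformly and the
    limit is smooth. The weighted bounds pass to the limit pointwise. That the limit lies in the
    step follows by comparison, for each h, with a term [y p] such that h <= p + 1. *)
Lemma union_steps_complete : steps_complete (union_grid M V).
Proof.
move=> m y my yC.
have yb (p q : nat) alpha x : (p <= q)%N ->
    cabs (cderiv alpha (y p) x - cderiv alpha (y q) x) <=
    2%:R ^- p / (p.+1%:R ^+ morder alpha * V m x / M (morder alpha)).
  move=> pq; have /unorm_leP/(_ alpha x) := yC p q pq.
  rewrite evalnorm_factor mulrC -ler_pdivlMr; last exact: evalcoef_gt0.
  by rewrite cderiv_unionB.
have unif (s : seq 'I_d) (x : 'rV[R]_d) : exists K (p0 : nat), exists2 U, nbhs x U &
    forall (p q : nat) z, (p0 <= p)%N -> (p <= q)%N -> U z ->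
      cabs (cderiv [ffun i => count_mem i s] (y p - y q : X) z) <= K * 2%:R ^- p.
  set alpha := [ffun _ => _]; have Vx := weight_gt0 (V m) x.
  exists (M (morder alpha) / (V m x / 2%:R)), 0%N.
  exists [set z | V m x / 2%:R <= V m z].
    have V2 : 0 < V m x / 2%:R by rewrite divr_gt0.
    have /continuous_distP/(_ _ V2) := @weight_continuous _ _ (V m) x.
    apply: filterS => z /=; rewrite ler_norml => /andP[_].
    by rewrite lerBlDr -lerBlDl {1}[V m x]splitr addrK.
  move=> p q z _ pq /= Vz; rewrite cderiv_unionB; apply: le_trans (yb p q alpha z pq) _.
  rewrite mulrC ler_wpM2r ?invr_ge0 ?exprn_ge0// invf_div.
  rewrite ler_wpM2l ?(ltW (wseq_gt0 M _))// lef_pV2 ?posrE ?divr_gt0//; last first.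
    by rewrite mulr_gt0 ?exprn_gt0 ?weight_gt0.
  apply: le_trans Vz _; rewrite ler_peMl ?(ltW (weight_gt0 _ _))//.
  by rewrite exprn_ege1// ler1n.
have [g1 [sg1 Hg1]] : exists g, smooth g /\ forall s x,
    (fun p => partials s (re (y p)) x) @ \oo --> partials s g x.
  apply: (@smooth_limit _ _ (fun p => re (y p))) => [p|s x].
    by have [] := union_vect_smooth (y p).
  have [K [p0 [U Ux H]]] := unif s x; exists K, p0, U => // p q z p0p pq Uz.
  have [-> _] := partials_unionB (y p) (y q) s z.
  exact: le_trans (ge_cabs_Re _) (H p q z p0p pq Uz).
have [g2 [sg2 Hg2]] : exists g, smooth g /\ forall s x,
    (fun p => partials s (im (y p)) x) @ \oo --> partials s g x.
  apply: (@smooth_limit _ _ (fun p => im (y p))) => [p|s x].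
    by have [] := union_vect_smooth (y p).
  have [K [p0 [U Ux H]]] := unif s x; exists K, p0, U => // p q z p0p pq Uz.
  have [_ ->] := partials_unionB (y p) (y q) s z.
  exact: le_trans (ge_cabs_Im _) (H p q z p0p pq Uz).
have [g [g1E g2E]] : exists g : 'rV[R]_d -> C, re g = g1 /\ im g = g2.
  by exists (fun x => Complex (g1 x) (g2 x)).
have sg : csmooth g by split; rewrite ?g1E ?g2E.
have yg p alpha x : cabs (cderiv alpha (y p) x - cderiv alpha g x) <=
    2%:R ^- p / (p.+1%:R ^+ morder alpha * V m x / M (morder alpha)).
  apply: (@cabs_limit_le _ _ (fun q => cderiv alpha (y q) x) _ _ p).
  - by move=> q; exact: yb.
  - by rewrite /= g1E; exact: Hg1.
  - by rewrite /= g2E; exact: Hg2.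
have bg p : (bnorm M (V m) p.+1%:R ((-1 : C) *: g + (y p : 'rV[R]_d -> C))%R
    <= (2%:R ^- p)%:E)%E.
  apply/bnorm_leP => alpha x; rewrite (cderiv_lin _ _ _ sg (union_vect_smooth (y p))).
  rewrite mulN1r [- _ + _]addrC; move: (yg p alpha x).
  move: (cabs _) => c; rewrite ler_pdivlMr; last first.
    exact: (evalcoef_gt0 M V m p alpha x).
  rewrite (_ : c * _ = p.+1%:R ^+ morder alpha * c * V m x / M (morder alpha)) //.
  by rewrite !mulrA [c * _]mulrC.
have Bg : frechet_B M (V m) g.
  move=> h h0; split=> //; pose p := Num.bound h.
  have hp : h <= p.+1%:R.
    by apply: le_trans (ltW (archi_boundP (ltW h0))) _; rewrite ler_nat.
  apply: le_lt_trans (@bnorm_mono _ _ M (V m) (V m) _ _ g h0 hp (fun x => lexx _)) _.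
  have -> : g = (-1 : C) *: ((-1 : C) *: g + (y p : 'rV[R]_d -> C)) + (y p : 'rV[R]_d -> C).
    by rewrite scalerDr scalerA mulrNN mulr1 scale1r scaleN1r -addrA addNr addr0.
  have [e _ ye] := gnorm_bounded p (my p).
  have sy := union_vect_smooth (y p).
  apply: le_lt_trans (bnorm_lin (-1) (ltr0Sn R p) _ sy (bg p) ye) (ltry _).
  exact: csmooth_lin.
have gU : g \in union_pred M V by apply/asboolP; exists m.
exists (UnionVect gU) => p; apply: le_trans (bg p).
rewrite le_eqVlt; apply/orP; left; apply/eqP; congr (bnorm _ _ _ _).
by rewrite scaleN1r addrC.
Qed.

End StepsComplete.

(** * The associated function of a weight sequence *)

Section AssociatedFunction.
Context (R : realType) (M : weight_sequence R).
Implicit Types (p q k : nat) (t a b c : R).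

Lemma eventually_decreasing_bounded (c : nat -> R) (N : nat) :
  (forall p, 0 <= c p) -> (forall p, (N <= p)%N -> c p.+1 <= c p) ->
  exists2 K : R, 0 < K & forall p, c p <= K.
Proof.
move=> c0 cN; exists (\sum_(i < N.+1) c i + 1).
  by rewrite ltr_wpDl// sumr_ge0.
move=> p; apply: (@le_trans _ _ (\sum_(i < N.+1) c i)); last by rewrite lerDl.
have small q : (q <= N)%N -> c q <= \sum_(i < N.+1) c i.
  move=> qN; rewrite (bigD1 (Ordinal (qN : (q < N.+1)%N)))//= lerDl.
  by rewrite sumr_ge0.
have [/small//|/ltnW Np] := leqP p N.
rewrite -(subnKC Np); elim: (p - N)%N => [|q IH]; first by rewrite addn0 small.
by rewrite addnS; apply: le_trans IH; apply: cN; exact: leq_addr.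
Qed.

Lemma ratio_gt0 p : 0 < ratio M p.
Proof. by rewrite divr_gt0 ?wseq_gt0. Qed.

Lemma wseqS p : M p.+1 = ratio M p.+1 * M p.
Proof. by rewrite /ratio/= divfK// gt_eqF// wseq_gt0. Qed.

Lemma ratio_large c : exists N, forall p, (N <= p)%N -> c <= ratio M p.
Proof.
have /cvgryPge/(_ c)[N _ H] := wseq_ratio M; exists N => p Np; exact: H.
Qed.

Lemma powers_bounded t : 0 <= t -> exists2 K : R, 0 < K &
  forall p, t ^+ p / M p <= K.
Proof.
move=> t0; have [N HN] := ratio_large t.
apply: (@eventually_decreasing_bounded _ N) => p.
  by rewrite divr_ge0 ?exprn_ge0// ltW// wseq_gt0.
move=> Np; rewrite wseqS exprS invfM mulrACA ler_piMl//.
  by rewrite divr_ge0 ?exprn_ge0// ltW// wseq_gt0.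
by rewrite ler_pdivrMr ?ratio_gt0// mul1r HN// leqW.
Qed.

(** The exponential of the associated function of the sequence, without the usual factor M_0. *)
Definition assoc t : R := sup (range (fun p => t ^+ p / M p)).

Lemma assoc_ge t p : 0 <= t -> t ^+ p / M p <= assoc t.
Proof.
move=> t0; apply: ub_le_sup; last by exists p.
by have [K _ HK] := powers_bounded t0; exists K => _ [q _ <-].
Qed.

Lemma assoc_le t c : (forall p, t ^+ p / M p <= c) -> assoc t <= c.
Proof.
by move=> H; apply: ge_sup; [exists (t ^+ 0 / M 0%N); exists 0%N|move=> _ [p _ <-]].
Qed.

Lemma assoc_ge0 t : 0 <= t -> (M 0%N)^-1 <= assoc t.
Proof. by move=> t0; have := assoc_ge 0 t0; rewrite expr0 div1r. Qed.

Lemma assoc_gt0 t : 0 <= t -> 0 < assoc t.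
Proof. by move=> /assoc_ge0; apply: lt_le_trans; rewrite invr_gt0 wseq_gt0. Qed.

Lemma assoc_mulr_le t c K : 0 <= c -> (forall p, t ^+ p / M p * c <= K) ->
  assoc t * c <= K.
Proof.
rewrite le_eqVlt => /predU1P[<- H|c0 H].
  by have := H 0%N; rewrite !mulr0.
by rewrite -ler_pdivlMr//; apply: assoc_le => p; rewrite ler_pdivlMr.
Qed.

Lemma assoc_mono a b : 0 <= a -> a <= b -> assoc a <= assoc b.
Proof.
move=> a0 ab; apply: assoc_le => p; apply: le_trans (assoc_ge p (le_trans a0 ab)).
by rewrite ler_wpM2r ?invr_ge0 ?(ltW (wseq_gt0 _ _))// lerXn2r// nnegrE// (le_trans a0).
Qed.

(** Termwise, a^p b^q / (M_p M_q) <= b^(p+q) / (M_p M_q), which (M.2) bounds by C (H b)^(p+q) /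
    M_(p+q). *)
Lemma M2_assoc : M2 M -> exists C H : R, [/\ 0 < C, 1 <= H &
  forall a b, 0 <= a -> a <= b -> assoc a * assoc b <= C * assoc (H * b)].
Proof.
move=> [C [H [C1 H1 HC]]]; exists C, H; have C0 := lt_le_trans ltr01 C1.
split=> // a b a0 ab; have b0 := le_trans a0 ab.
have Hb : 0 <= H * b by rewrite mulr_ge0// (le_trans ler01).
apply: assoc_mulr_le => [|p]; first exact/ltW/assoc_gt0.
rewrite mulrC; apply: assoc_mulr_le => [|q].
  by rewrite divr_ge0 ?exprn_ge0// ltW// wseq_gt0.
apply: le_trans (ler_wpM2l (ltW C0) (assoc_ge (q + p) Hb)).
rewrite [leRHS]mulrA ler_pdivlMr ?wseq_gt0// mulrACA -invfM.
rewrite [leLHS]mulrAC ler_pdivrMr ?mulr_gt0 ?wseq_gt0//.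
apply: (@le_trans _ _ (b ^+ q * b ^+ p * M (q + p)%N)).
  rewrite ler_wpM2r ?(ltW (wseq_gt0 _ _))// ler_wpM2l ?exprn_ge0//.
  by rewrite lerXn2r.
apply: le_trans (ler_wpM2l _ (HC q p)) _; first by rewrite mulr_ge0 ?exprn_ge0.
by rewrite -exprD exprMn le_eqVlt; apply/orP; left; apply/eqP; ring.
Qed.

Hypothesis m1 : M1 M.

Lemma ratio_mono p q : (0 < p)%N -> (p <= q)%N -> ratio M p <= ratio M q.
Proof.
move=> p0; elim: q => [|q IH]; first by rewrite leqn0 => /eqP ->.
rewrite leq_eqVlt => /predU1P[->//|pq]; apply: le_trans (IH pq) _.
have q0 : (0 < q)%N := leq_trans p0 pq.
rewrite /ratio/= ler_pdivrMr ?wseq_gt0// [leRHS]mulrAC ler_pdivlMr ?wseq_gt0//.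
by rewrite -expr2 mulrC; exact: m1.
Qed.

Lemma wseq_mul p q : M p * M q <= M 0%N * M (p + q)%N.
Proof.
elim: p => [|p IH]; first by rewrite add0n.
rewrite addSn !wseqS -mulrA [leRHS]mulrCA.
have r : ratio M p.+1 <= ratio M (p + q).+1 by apply: ratio_mono; rewrite ?ltnS ?leq_addr.
apply: (@le_trans _ _ (ratio M p.+1 * (M 0%N * M (p + q)%N))).
  by rewrite ler_wpM2l// ltW// ratio_gt0.
by rewrite ler_wpM2r// mulr_ge0 ?(ltW (wseq_gt0 _ _)).
Qed.

Lemma wseq_prod (I : Type) (s : seq I) (alpha : I -> nat) :
  \prod_(i <- s) (M (alpha i) / M 0%N) <= M (\sum_(i <- s) alpha i)%N / M 0%N.
Proof.
have M0 := wseq_gt0 M 0%N.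
elim: s => [|i s IH]; first by rewrite !big_nil divff// gt_eqF.
rewrite !big_cons; apply: le_trans (ler_wpM2l _ IH) _.
  by rewrite divr_ge0 ?(ltW (wseq_gt0 _ _)).
rewrite mulrACA [leRHS](_ : _ = M 0%N * M (alpha i + \sum_(j <- s) alpha j)%N
    * ((M 0%N)^-1 * (M 0%N)^-1)); last by field; rewrite gt_eqF.
by rewrite ler_wpM2r ?wseq_mul// mulr_ge0 ?invr_ge0 ?ltW.
Qed.

Lemma wseq_geometric p q : M p * ratio M 1 ^+ q <= M (p + q)%N.
Proof.
elim: q => [|q IH]; first by rewrite addn0 expr0 mulr1.
rewrite addnS wseqS exprS mulrCA ler_pM//; last exact: ratio_mono.
  exact/ltW/ratio_gt0.
by rewrite mulr_ge0 ?exprn_ge0// ltW ?wseq_gt0 ?ratio_gt0.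
Qed.

Lemma M3_partial : M3 M -> exists2 C : R, 1 <= C & forall q N : nat, (0 < q)%N ->
  \sum_(q <= p < N) (ratio M p)^-1 <= C * q%:R / ratio M q.
Proof.
move=> [C C1 H]; exists C => // q N q0; rewrite -lee_fin.
apply: le_trans (ltW (H q q0)); rewrite -sumEFin.
apply: nneseries_lim_ge => p _ _; rewrite lee_fin invr_ge0; exact/ltW/ratio_gt0.
Qed.

(** The (k - 1) q terms of the sum of 1/m_p over q <= p < k q are at least 1/m_(kq), while (M.3)
    bounds the sum by C q / m_q. Hence m_(kq) >= ((k - 1)/C) m_q. *)
Lemma M3_dilation : M3 M -> forall a, exists2 k, (0 < k)%N &
  forall q, (0 < q)%N -> a * ratio M q <= ratio M (k * q).
Proof.
move=> /M3_partial[C C1 HC] a; have C0 := lt_le_trans ltr01 C1.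
pose k := (Num.bound (`|a| * C)).+1.
have ka : a * C <= k.-1%:R.
  apply: le_trans (ler_norm _) _; rewrite normrM (gtr0_norm C0).
  by apply: ltW (archi_boundP _); rewrite mulr_ge0// ltW.
exists k => // q q0; have q0R : 0 < q%:R :> R by rewrite ltr0n.
have kq : (q <= k * q)%N by rewrite leq_pmull.
have := HC q (k * q)%N q0.
have : k.-1%:R * q%:R / ratio M (k * q) <= \sum_(q <= p < k * q) (ratio M p)^-1.
  rewrite -natrM; have -> : (k.-1 * q = k * q - q)%N by rewrite mulSn addKn.
  rewrite mulr_natl -sumr_const_nat; apply: ler_sum_nat => p /andP[qp pk].
  rewrite lef_pV2 ?posrE ?ratio_gt0//; apply: ratio_mono; last exact: ltnW.
  exact: leq_trans qp.
move=> /le_trans H {}/H; rewrite mulrAC [leRHS]mulrAC ler_pM2r//.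
rewrite ler_pdivrMr ?ratio_gt0// mulrAC ler_pdivlMr ?ratio_gt0// => H.
rewrite -(ler_pM2l C0); apply: le_trans H; rewrite mulrA ler_wpM2r//.
  exact/ltW/ratio_gt0.
by rewrite mulrC.
Qed.

(** By [block], (a t)^p / M_p is essentially the k-th power of t^q / M_q with q close to p/k. The
    leftover factors are at most k copies of a t and at most k of a t / m_1; three groups of at most
    k factors give L = 3k. *)
Lemma M3_assoc a : M3 M -> 1 <= a -> exists C (L : nat),
  0 < C /\ forall t, 0 <= t -> assoc (a * t) <= C * assoc t ^+ L.
Proof.
move=> m3 a1; have a0 := lt_le_trans ltr01 a1.
have [k k0 Hk] := M3_dilation m3 a.
have M00 := wseq_gt0 M 0%N.
(* [M_(k q)] dominates [a^(k q) M_q^k] up to factors polynomial in [a], since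
   [m_(k q + r) >= a m_q]. *)
have block q : a ^+ (k * q) * (M q / M 0%N) ^+ k * M k <= M (k * q.+1)%N.
  elim: q => [|q IH].
    by rewrite muln0 expr0 mul1r divff ?gt_eqF// expr1n mul1r muln1.
  have Hr r : (r <= k)%N -> (a * ratio M q.+1) ^+ r * M (k * q.+1)%N <= M (k * q.+1 + r)%N.
    elim: r => [|r IHr] rk; first by rewrite addn0 expr0 mul1r.
    rewrite addnS wseqS exprS -mulrA ler_pM//.
    - by rewrite mulr_ge0 ?(ltW a0) ?(ltW (ratio_gt0 _)).
    - rewrite mulr_ge0 ?(ltW (wseq_gt0 _ _))// exprn_ge0// mulr_ge0//; first exact: ltW.
      exact: ltW (ratio_gt0 _).
    - apply: le_trans (Hk q.+1 isT) _; apply: ratio_mono; first by rewrite muln_gt0 k0.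
      by rewrite -addnS leq_addr.
    - exact: IHr (ltnW rk).
  have := Hr k (leqnn k); rewrite -mulnSr; apply: le_trans.
  apply: le_trans (ler_wpM2l _ IH); last first.
    by rewrite exprn_ge0// mulr_ge0 ?(ltW a0) ?(ltW (ratio_gt0 _)).
  rewrite mulnS exprD wseqS -mulrA !exprMn.
  by rewrite le_eqVlt; apply/orP; left; apply/eqP; ring.
set t1 := ratio M 1; have t10 : 0 < t1 := ratio_gt0 1.
(* Chosen so that u = B [assoc t] dominates 1, a t, a t / t1 and all M_0 t^q / M_q at once. *)
pose B := M 0%N + a * M 1%N + a * M 1%N / t1.
have M10 := wseq_gt0 M 1%N.
have aM : 0 < a * M 1%N by rewrite mulr_gt0.
have B0 : 0 < B by rewrite !addr_gt0// divr_gt0.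
pose D := \sum_(i < k.+1) (M i)^-1.
have DM i : (i <= k)%N -> (M i)^-1 <= D.
  move=> ik; rewrite /D (bigD1 (Ordinal (ik : (i < k.+1)%N)))//= lerDl.
  by rewrite sumr_ge0// => j _; rewrite invr_ge0 ltW// wseq_gt0.
have D0 : 0 < D by apply: lt_le_trans (DM 0%N isT); rewrite invr_gt0.
exists (D * B ^+ (k + k + k)), (k + k + k)%N.
split=> [|t t0]; first by rewrite mulr_gt0// exprn_gt0.
have A0 := assoc_gt0 t0; set A := assoc t in A0 *.
apply: assoc_le => p; rewrite -mulrA -exprMn; set u := B * A.
have At1 : t <= M 1%N * A by rewrite mulrC -ler_pdivrMr//; have := assoc_ge 1 t0.
have u1 : 1 <= u.
  apply: (@le_trans _ _ (M 0%N * A)).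
    by rewrite mulrC -ler_pdivrMr// div1r; exact: assoc_ge0.
  by rewrite ler_pM2r// /B -addrA lerDl addr_ge0// ltW// divr_gt0.
have atu : a * t <= u.
  apply: (@le_trans _ _ (a * M 1%N * A)); first by rewrite -mulrA ler_pM2l.
  by rewrite ler_pM2r// /B addrAC lerDr addr_ge0// ltW// divr_gt0.
have att : a * t / t1 <= u.
  apply: (@le_trans _ _ (a * M 1%N / t1 * A)).
    by rewrite [leRHS]mulrAC ler_pM2r ?invr_gt0// -mulrA ler_pM2l.
  by rewrite ler_pM2r// /B lerDr addr_ge0// ltW.
have MqA q : t ^+ q / (M q / M 0%N) <= u.
  rewrite invf_div mulrA ler_pdivrMr ?wseq_gt0//.
  rewrite [leLHS](_ : _ = M 0%N * (t ^+ q / M q) * M q); last first.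
    by field; rewrite gt_eqF// wseq_gt0.
  rewrite ler_pM2r ?wseq_gt0//; apply: (@le_trans _ _ (M 0%N * A)).
    by rewrite ler_pM2l//; exact: assoc_ge.
  by rewrite ler_pM2r// /B -addrA lerDl addr_ge0// ltW// divr_gt0.
have at0 : 0 <= a * t by rewrite mulr_ge0// ltW.
have u0 : 0 <= u := le_trans ler01 u1.
clearbody u.
have upow i j : (i <= j)%N -> u ^+ i <= u ^+ j by move=> ij; rewrite ler_weXn2l.
have [pk|kp] := ltnP p k.
  rewrite mulrC ler_pM ?exprn_ge0 ?invr_ge0 ?(ltW (wseq_gt0 _ _))//.
    by apply: DM; exact: ltnW.
  have h : (a * t) ^+ p <= u ^+ p by rewrite lerXn2r ?nnegrE.
  by apply: (le_trans h); apply: upow; rewrite -addnA (leq_trans (ltnW pk))// leq_addr.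
(* The quotient is lowered by one because [block] bounds M at k (q + 1) through M_q. *)
pose q := (p %/ k).-1; pose r := (p %% k)%N.
have qE : q.+1 = (p %/ k)%N by rewrite prednK// divn_gt0.
have pE : p = (k * q.+1 + r)%N by rewrite qE mulnC; exact: divn_eq.
have rk : (r <= k)%N by rewrite ltnW// ltn_pmod.
have Mp : a ^+ (k * q) * (M q / M 0%N) ^+ k * M k * t1 ^+ r <= M p.
  rewrite pE; apply: le_trans (wseq_geometric _ _).
  by rewrite ler_pM2r ?exprn_gt0.
have Mq0 : 0 < M q / M 0%N by rewrite divr_gt0// wseq_gt0.
have den0 : 0 < a ^+ (k * q) * (M q / M 0%N) ^+ k * M k * t1 ^+ r.
  by rewrite !mulr_gt0 ?exprn_gt0// wseq_gt0.
apply: (@le_trans _ _ ((a * t) ^+ p / (a ^+ (k * q) * (M q / M 0%N) ^+ k * M k * t1 ^+ r))).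
  by rewrite ler_wpM2l ?exprn_ge0// lef_pV2 ?posrE ?wseq_gt0.
have -> : (a * t) ^+ p / (a ^+ (k * q) * (M q / M 0%N) ^+ k * M k * t1 ^+ r) =
    (M k)^-1 * ((t ^+ q / (M q / M 0%N)) ^+ k * (a * t) ^+ k * (a * t / t1) ^+ r).
  move: (M q / M 0%N) Mq0 (wseq_gt0 M k) => y y0.
  move: (M k) (t1) t10 => z y1 y10 z0.
  rewrite pE mulnS !exprD !exprMn -[t ^+ q ^+ k]exprM [(q * k)%N]mulnC !exprVn.
  by field; rewrite !expf_neq0 ?gt_eqF.
have tri (x y z : R) : 0 <= x -> x <= u -> 0 <= y -> y <= u -> 0 <= z -> z <= u ->
    x ^+ k * y ^+ k * z ^+ r <= u ^+ (k + k + k).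
  move=> x0 xu y0 yu z0 zu; rewrite !exprD.
  apply: ler_pM; [by rewrite mulr_ge0 ?exprn_ge0|by rewrite exprn_ge0| |].
    by apply: ler_pM; rewrite ?exprn_ge0 ?lerXn2r ?nnegrE.
  by apply: le_trans (upow r k rk); rewrite lerXn2r ?nnegrE.
have X0 : 0 <= t ^+ q / (M q / M 0%N) by rewrite divr_ge0 ?exprn_ge0// ltW.
have Z0 : 0 <= a * t / t1 by rewrite divr_ge0// ltW.
apply: ler_pM; last exact: tri.
- by rewrite invr_ge0 ltW// wseq_gt0.
- by rewrite !mulr_ge0 ?exprn_ge0.
- exact: DM.
Qed.

End AssociatedFunction.

(** * Compactly supported functions *)

(* If [sum 1 / m_i] converges with tails [T_i], then [a_i], proportional to
   [sqrt T_i - sqrt T_(i+1)], is summable and [a_i m_i] tends to infinity. *)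
Lemma summable_faster (R : realType) (m : nat -> R) (B : R) :
  (forall i, 0 < m i) -> (forall n, \sum_(i < n) (m i)^-1 <= B) ->
  exists a : nat -> R, [/\ forall i, 0 < a i,
    forall n, \sum_(i < n) a i <= 4%:R^-1 &
    forall K, exists N, forall i, (N <= i)%N -> K <= a i * m i].
Proof.
move=> m0 mB; pose S n := \sum_(i < n) (m i)^-1.
have SS n : S n.+1 = S n + (m n)^-1 by rewrite /S big_ord_recr.
have Smono p q : (p <= q)%N -> S p <= S q.
  elim: q => [|q IH]; first by rewrite leqn0 => /eqP ->.
  rewrite leq_eqVlt => /predU1P[->//|/IH] /le_trans; apply.
  by rewrite SS lerDl invr_ge0 ltW.
pose Sup := sup (range S).
have supS : has_sup (range S).
  by split; [exists (S 0%N), 0%N|exists B => _ [n _ <-]; exact: mB].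
have Sle n : S n <= Sup by apply: ub_le_sup; [exact: supS.2|exists n].
pose T n := Sup - S n.
have TS n : T n - T n.+1 = (m n)^-1 by rewrite /T SS; ring.
have T0 n : 0 < T n.
  by rewrite subr_gt0; apply: lt_le_trans (Sle n.+1); rewrite SS ltrDl invr_gt0.
have Tsmall e : 0 < e -> exists N, forall n, (N <= n)%N -> T n < e.
  move=> e0; have [_ [N _ <-] HN] := sup_adherent e0 supS.
  exists N => n Nn; rewrite /T ltrBlDr -ltrBlDl.
  exact: lt_le_trans HN (Smono _ _ Nn).
pose s n := Num.sqrt (T n); have s0 n : 0 < s n by rewrite sqrtr_gt0.
have s2 n : s n ^+ 2 = T n by rewrite sqr_sqrtr// ltW.
have sS n : (s n - s n.+1) * (s n + s n.+1) = (m n)^-1.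
  by rewrite -TS -!s2; ring.
have sdiff n : 0 < s n - s n.+1.
  by rewrite -(pmulr_lgt0 _ (addr_gt0 (s0 n) (s0 n.+1))) sS invr_gt0.
(* The differences of s telescope to at most s 0, so this divisor makes the total at most 1/4, the
   margin available on either side of the slopes of the trapezoid. *)
have c0 : 0 < 4%:R * s 0%N by rewrite mulr_gt0.
exists (fun i => (s i - s i.+1) / (4%:R * s 0%N)); split=> [i|n|K].
- by rewrite divr_gt0.
- rewrite -mulr_suml ler_pdivrMr// mulrA mulVf ?pnatr_eq0// mul1r.
  have -> : \sum_(i < n) (s i - s i.+1) = s 0%N - s n.
    by elim: n => [|n IH]; rewrite ?big_ord0 ?subrr// big_ord_recr/= IH; ring.
  by rewrite gerBl ltW.
have K0 : 0 < `|K| + 1 by rewrite ltr_wpDl.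
(* The product a_i m_i equals 1 / (4 s_0 (s_i + s_(i+1))), and s_i <= e makes it at least [|K|] +
   1. *)
pose e := (8%:R * (`|K| + 1) * s 0%N)^-1.
have e0 : 0 < e by rewrite invr_gt0 !mulr_gt0.
have [N HN] := Tsmall (e ^+ 2) (exprn_gt0 2 e0); exists N => i /HN Ti.
have si : s i <= e by rewrite -(gtr0_norm e0) -sqrtr_sqr ler_wsqrtr// ltW.
have sii : s i + s i.+1 <= 2%:R * e by have := sdiff i; lra.
have -> : (s i - s i.+1) / (4%:R * s 0%N) * m i =
    (4%:R * s 0%N * (s i + s i.+1))^-1.
  have mE : m i = ((s i - s i.+1) * (s i + s i.+1))^-1 by rewrite sS invrK.
  have d0 := sdiff i; have p0 := addr_gt0 (s0 i) (s0 i.+1).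
  by rewrite mE; field; rewrite !gt_eqF.
apply: (@le_trans _ _ (4%:R * s 0%N * (2%:R * e))^-1).
  have -> : (4%:R * s 0%N * (2%:R * e))^-1 = `|K| + 1.
    by rewrite /e; field; rewrite !gt_eqF.
  by apply: le_trans (ler_norm K) _; rewrite lerDl.
rewrite lef_pV2 ?posrE ?mulr_gt0 ?addr_gt0//.
by rewrite ler_pM2l.
Qed.

Section TruncatedPowers.
Context (R : realType).
Implicit Types (x b : R) (n : nat).

Definition pos x := Num.max x 0.

(** The induction starts at the square, since [pos] itself has a corner; each further power is the
    previous one times y. *)
Lemma pos_is_derive n x :
  is_derive x 1 (fun y => pos y ^+ n.+2) (n.+2%:R * pos x ^+ n.+1).
Proof.
elim: n => [|n IH].
  apply/is_derive1P => e e0; exists e => // h he.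
  have h2 : `|h| ^+ 2 <= e * `|h| by rewrite expr2 ler_wpM2r// ltW.
  apply: le_trans h2; rewrite real_normK ?num_real//.
  rewrite expr1 /pos !maxEle ler_norml; do 2 case: ifP => ?; apply/andP; split; nra.
have -> : (fun y => pos y ^+ n.+3) = (fun y => y * pos y ^+ n.+2).
  apply/funext => y; rewrite [LHS]exprS /pos maxEle; case: ifP => // _.
  by rewrite !expr0n/= !mulr0.
apply: is_derive_eq.
rewrite /GRing.scale/= mulr1 addrC.
have -> : x * (n.+2%:R * pos x ^+ n.+1) = n.+2%:R * pos x ^+ n.+2.
  rewrite mulrCA; congr (_ * _); rewrite [RHS]exprS /pos maxEle; case: ifP => // _.
  by rewrite !expr0n/= !mulr0.
by rewrite -[n.+3]addn1 natrD; ring.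
Qed.

(** The n-fold primitive of [pos]. With explicit primitives, averaging over an interval is a
    difference quotient and no integral is involved. *)
Definition trunc_power n x := pos x ^+ n.+1 / (n.+1)`!%:R.

Lemma trunc_power_is_derive n b x :
  is_derive x 1 (fun y => trunc_power n.+1 (y + b)) (trunc_power n (x + b)).
Proof.
apply/is_derive1P => e e0; have f0 : 0 < (n.+2)`!%:R :> R by rewrite ltr0n fact_gt0.
have [r r0 Hr] := (is_derive1P _ _ _).1 (pos_is_derive n (x + b)) _ (mulr_gt0 e0 f0).
have hb h : x + b + h = x + h + b by rewrite addrAC.
exists r => // h /Hr; rewrite hb => H.
rewrite -(ler_pM2r f0) mulrAC; apply: le_trans H.
rewrite -{1}(gtr0_norm f0) -normrM le_eqVlt; apply/orP; left; apply/eqP.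
congr (`|_|); rewrite /trunc_power [(n.+2)`!]factS natrM.
have n0 : (n.+1)`!%:R != 0 :> R by rewrite pnatr_eq0 -lt0n fact_gt0.
have n2 : n.+2%:R != 0 :> R by rewrite pnatr_eq0.
move: n0 n2; move: (n.+2%:R : R) ((n.+1)`!%:R : R) => u v v0 u0.
by field; rewrite v0 u0.
Qed.

(* [trapezoid 0] is 1 on [-1/2, 1/2] and 0 outside [-3/4, 3/4]. *)
Definition trapezoid n x : R :=
  4%:R * (trunc_power n (x + 3%:R / 4%:R) - trunc_power n (x + 1 / 2%:R)
          - trunc_power n (x - 1 / 2%:R) + trunc_power n (x - 3%:R / 4%:R)).

Lemma trapezoid_is_derive n x :
  is_derive x 1 (trapezoid n.+1) (trapezoid n x).
Proof.
have H b := trunc_power_is_derive n b x.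
have H1 := is_deriveB (H (3%:R / 4%:R)) (H (1 / 2%:R)).
have H2 := is_deriveD (is_deriveB H1 (H (- (1 / 2%:R)))) (H (- (3%:R / 4%:R))).
exact: (is_deriveZ 4%:R H2).
Qed.

Lemma trapezoid0E x : trapezoid 0 x = 4%:R * (pos (x + 3%:R / 4%:R)
  - pos (x + 1 / 2%:R) - pos (x - 1 / 2%:R) + pos (x - 3%:R / 4%:R)).
Proof. by rewrite /trapezoid /trunc_power !expr1 !divr1. Qed.

Lemma trapezoid_norm x : `|trapezoid 0 x| <= 1.
Proof.
rewrite trapezoid0E ler_norml /pos !maxEle.
by do 4 case: ifP => ?; apply/andP; split; lra.
Qed.

Lemma trapezoid_lipschitz x y : `|trapezoid 0 x - trapezoid 0 y| <= 16%:R * `|x - y|.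
Proof.
have pl u v : `|pos u - pos v| <= `|u - v|.
  rewrite /pos !maxEle; have [uv|uv] := leP 0 (u - v);
  [rewrite (ger0_norm uv)|rewrite (ltr0_norm uv)];
  rewrite ler_norml; do 2 case: ifP => ?; apply/andP; split; lra.
have sh b : `|pos (x + b) - pos (y + b)| <= `|x - y|.
  by apply: le_trans (pl _ _) _; rewrite opprD addrACA subrr addr0.
have := sh (3%:R / 4%:R); have := sh (1 / 2%:R).
have := sh (- (1 / 2%:R)); have := sh (- (3%:R / 4%:R)).
rewrite !trapezoid0E !ler_norml; lra.
Qed.

Lemma trapezoid1 x : `|x| <= 1 / 2%:R -> trapezoid 0 x = 1.
Proof.
rewrite trapezoid0E ler_norml /pos !maxEle => /andP[? ?].
by do 4 case: ifP => ?; lra.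
Qed.

Lemma trapezoid_eq0 x : 3%:R / 4%:R <= `|x| -> trapezoid 0 x = 0.
Proof.
rewrite trapezoid0E ler_normr /pos !maxEle => /orP[?|?].
all: by do 4 case: ifP => ?; lra.
Qed.

End TruncatedPowers.

Section DifferenceQuotients.
Context (R : realType).
Implicit Types (f g F : R -> R) (l : seq R) (x y s c : R).

Definition diffq s f x := (f x - f (x - s)) / s.

Definition diffqs l f := foldr diffq f l.

Lemma is_derive_translate f f' b : (forall x, is_derive x 1 f (f' x)) ->
  forall x, is_derive x 1 (fun y => f (y + b)) (f' (x + b)).
Proof.
move=> df x; apply/is_derive1P => e e0.
have [r r0 Hr] := (is_derive1P _ _ _).1 (df (x + b)) e e0.
exists r => // h /Hr; have -> : x + b + h = x + h + b by rewrite addrAC.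
by [].
Qed.

Lemma diffq_is_derive s f f' : (forall x, is_derive x 1 f (f' x)) ->
  forall x, is_derive x 1 (diffq s f) (diffq s f' x).
Proof.
move=> df x; have H := is_deriveB (df x) (is_derive_translate (- s) df x).
have := is_deriveZ s^-1 H; rewrite /GRing.scale/= mulrC => H1.
have -> : diffq s f = s^-1 *: (f - (fun y => f (y - s))).
  by apply/funext => y; rewrite /diffq mulrC.
exact: H1.
Qed.

Lemma diffqs_is_derive l f f' : (forall x, is_derive x 1 f (f' x)) ->
  forall x, is_derive x 1 (diffqs l f) (diffqs l f' x).
Proof. by move=> df; elim: l => //= s l IH x; exact: diffq_is_derive. Qed.

Lemma diffq_average s f F : s != 0 -> (forall x, is_derive x 1 F (f x)) ->
  forall x, exists2 c, 0 <= c <= 1 & diffq s F x = f (x - c * s).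
Proof.
move=> s0 dF x; have [c c01 H] := mean_value dF x (- s); exists c => //.
by rewrite /diffq -opprB H mulrN opprK mulfK// mulrN.
Qed.

Lemma diffq_norm s f B x : 0 < s -> (forall x, `|f x| <= B) ->
  `|diffq s f x| <= 2%:R / s * B.
Proof.
move=> s0 fB; rewrite /diffq normrM normfV (gtr0_norm s0) mulrAC ler_pM2r ?invr_gt0//.
apply: le_trans (ler_normB _ _) _; apply: le_trans (lerD (fB _) (fB _)) _.
by rewrite mulr_natl mulr2n.
Qed.

Lemma derive_locally_constant f x c r (d : R) : 0 < r -> is_derive x 1 f d ->
  (forall y, `|y - x| < r -> f y = c) -> d = 0.
Proof.
move=> r0 /is_derive1P df fc; apply/eqP; rewrite -normr_le0.
apply/ler_addgt0Pl => e e0; rewrite addr0; have [r' r'0 H] := df e e0.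
pose h := Num.min r r' / 2%:R.
have m0 : 0 < Num.min r r' by rewrite lt_min r0.
have h0 : 0 < h by rewrite divr_gt0.
have hm : h < Num.min r r' by rewrite /h; lra.
have hr : h < r by apply: lt_le_trans hm _; rewrite ge_min lexx.
have hr' : h < r' by apply: lt_le_trans hm _; rewrite ge_min lexx orbT.
have := H h; rewrite gtr0_norm// => /(_ hr').
rewrite !fc ?subrr ?normr0//; last by rewrite addrC addKr gtr0_norm.
by rewrite sub0r normrN normrM gtr0_norm// mulrC ler_pM2r.
Qed.

End DifferenceQuotients.

Section Bump.
Context (R : realType) (a : nat -> R).
Hypothesis a0 : forall i, 0 < a i.
Hypothesis aS : forall n, \sum_(i < n) a i <= 4%:R^-1.
Implicit Types (x y : R) (j n p : nat).

(* The average of the trapezoid successively over intervals of length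
   [a (j + n - 1)], ..., [a j]. *)
Definition averaged j n := diffqs [seq a i | i <- iota j n] (trapezoid n).

Lemma averaged_primitive j n x :
  is_derive x 1 (diffqs [seq a i | i <- iota j n] (trapezoid n.+1)) (averaged j n x).
Proof. by apply: diffqs_is_derive => y; exact: trapezoid_is_derive. Qed.

(** The outermost average is a value of the averaged function at a point shifted by at most a_j. The
    bounds, the support and the plateau all follow from this by induction. *)
Lemma averagedS j n x : exists2 c, 0 <= c <= 1 &
  averaged j n.+1 x = averaged j.+1 n (x - c * a j).
Proof.
apply: diffq_average; first by rewrite gt_eqF.
by move=> y; exact: averaged_primitive.
Qed.

Lemma averaged_norm j n x : `|averaged j n x| <= 1.
Proof.
elim: n j x => [|n IH] j x; first exact: trapezoid_norm.
by have [c _ ->] := averagedS j n x.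
Qed.

(** The mean value theorem is applied to the difference of the two translates, so that the same c
    serves x and y. *)
Lemma averaged_diff j n x y : exists2 c, 0 <= c <= 1 &
  averaged j n.+1 x - averaged j n.+1 y =
  averaged j.+1 n (x - c * a j) - averaged j.+1 n (y - c * a j).
Proof.
set F := diffqs [seq a i | i <- iota j.+1 n] (trapezoid n.+1).
have dF (t : R) : is_derive t 1 (fun s => F (s + x) - F (s + y))
    (averaged j.+1 n (t + x) - averaged j.+1 n (t + y)).
  by apply: is_deriveB; apply: is_derive_translate => s; exact: averaged_primitive.
have aj : a j != 0 by rewrite gt_eqF.
have [c c01 H] := diffq_average aj dF 0; exists c => //.
move: H; rewrite /diffq !sub0r !add0r ![- _ + _]addrC => <-.
by rewrite /averaged/= /diffq -/F; ring.
Qed.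

Lemma averaged_lipschitz j n x y :
  `|averaged j n x - averaged j n y| <= 16%:R * `|x - y|.
Proof.
elim: n j x y => [|n IH] j x y; first exact: trapezoid_lipschitz.
have [c _ ->] := averaged_diff j n x y; apply: le_trans (IH _ _ _) _.
by rewrite opprB addrA subrK.
Qed.

(** The additional average is the innermost one, so the outer ones act on a difference and preserve
    its bound. Alone, it shifts the trapezoid, which is 16-Lipschitz, by at most its length. *)
Lemma averaged_step j n x :
  `|averaged j n.+1 x - averaged j n x| <= 16%:R * a (j + n)%N.
Proof.
elim: n j x => [|n IH] j x.
  have [c /andP[c0 c1] ->] := averagedS j 0 x; rewrite addn0.
  apply: le_trans (averaged_lipschitz _ 0 _ _) _.
  rewrite addrC addKr normrN normrM (ger0_norm c0) (gtr0_norm (a0 j)).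
  by rewrite ler_wpM2l// ler_piMl// ltW.
set F := diffqs [seq a i | i <- iota j.+1 n] (trapezoid n.+1).
set G := diffqs [seq a i | i <- iota j.+1 n.+1] (trapezoid n.+2).
have dFG (t : R) : is_derive t 1 (fun s => G s - F s)
    (averaged j.+1 n.+1 t - averaged j.+1 n t).
  by apply: is_deriveB; exact: averaged_primitive.
have aj : a j != 0 by rewrite gt_eqF.
have [c c01 H] := diffq_average aj dFG x.
have -> : averaged j n.+2 x - averaged j n.+1 x = diffq (a j) (fun s => G s - F s) x.
  rewrite -[averaged j n.+2 x]/(diffq (a j) G x) -[averaged j n.+1 x]/(diffq (a j) F x).
  by rewrite /diffq; ring.
by rewrite H addnS -addSn; exact: IH.
Qed.

Definition width j n := \sum_(j <= i < j + n) a i.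

Lemma widthS j n : width j n.+1 = a j + width j.+1 n.
Proof. by rewrite /width big_ltn ?addnS ?ltnS ?leq_addr// addSn. Qed.

Lemma averaged1 j n x : `|x| <= 1 / 2%:R - width j n -> averaged j n x = 1.
Proof.
elim: n j x => [|n IH] j x.
  by rewrite /width addn0 big_geq// subr0; exact: trapezoid1.
have [c /andP[c0 c1] ->] := averagedS j n x; rewrite widthS => H; apply: IH.
apply: le_trans (ler_normB _ _) _; rewrite normrM (ger0_norm c0) (gtr0_norm (a0 j)).
have : c * a j <= a j by rewrite ler_piMl// ltW.
move: H; lra.
Qed.

Lemma averaged_eq0 j n x : 3%:R / 4%:R + width j n <= `|x| -> averaged j n x = 0.
Proof.
elim: n j x => [|n IH] j x.
  by rewrite /width addn0 big_geq// addr0; exact: trapezoid_eq0.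
have [c /andP[c0 c1] ->] := averagedS j n x; rewrite widthS => H; apply: IH.
apply: le_trans (lerB_dist _ _); rewrite normrM (ger0_norm c0) (gtr0_norm (a0 j)).
have : c * a j <= a j by rewrite ler_piMl// ltW.
move: H; lra.
Qed.

Lemma averaged_is_derive j n x :
  is_derive x 1 (averaged j n.+1) (diffq (a j) (averaged j.+1 n) x).
Proof. by apply: diffq_is_derive => y; exact: averaged_primitive. Qed.

Definition averaged_lim j x := limn (fun n => averaged j n x).

Lemma averaged_cvg j x : cvgn (fun n => averaged j n x).
Proof.
(* Adding 16 times these partial sums makes the sequence nondecreasing and bounded. *)
pose S n := \sum_(i < n) a (j + i)%N.
have Sb n : S n <= 4%:R^-1.
  apply: le_trans (aS (j + n)); rewrite big_split_ord/= lerDr sumr_ge0// => i _.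
  exact: ltW.
have cS : cvgn S.
  apply: nondecreasing_is_cvgn.
    apply/nondecreasing_seqP => n; rewrite /S big_ord_recr/= lerDl; exact: ltW.
  by exists 4%:R^-1 => _ [n _ <-].
have cu : cvgn (fun n => averaged j n x + 16%:R * S n).
  apply: nondecreasing_is_cvgn.
    apply/nondecreasing_seqP => n; rewrite /S big_ord_recr/= mulrDr.
    have := averaged_step j n x; rewrite ler_norml => /andP[+ _]; lra.
  exists (1 + 16%:R * 4%:R^-1) => _ [n _ <-]; apply: lerD.
    exact: le_trans (ler_norm _) (averaged_norm j n x).
  by rewrite ler_wpM2l.
have -> : (fun n => averaged j n x) =
    (fun n => averaged j n x + 16%:R * S n - 16%:R * S n).
  by apply/funext => n; rewrite addrK.
apply: is_cvgB => //; apply: is_cvgMr => //.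
Qed.

Lemma averaged_lim_le j x (b : R) :
  (forall n, `|averaged j n x| <= b) -> `|averaged_lim j x| <= b.
Proof.
move=> H; have c : (fun n => `|averaged j n x|) @ \oo --> `|averaged_lim j x|.
  by apply: cvg_norm; exact: averaged_cvg.
by apply: (cvgr_to_le c); exists 0%N.
Qed.

Lemma averaged_lim_is_derive j x :
  is_derive x 1 (averaged_lim j) (diffq (a j) (averaged_lim j.+1) x).
Proof.
apply/is_derive1P => e e0; have aj := a0 j.
(* The difference quotient varies by at most 2 * 16 [|h|] / a_j, by the Lipschitz bound at its two
   points, uniformly in n. *)
exists (e * a j / 32%:R); first by rewrite divr_gt0// mulr_gt0.
move=> h hr.
have Hn n : `|averaged j n.+1 (x + h) - averaged j n.+1 x
    - h * diffq (a j) (averaged j.+1 n) x| <= e * `|h|.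
  have [c /andP[c0 c1] ->] := mean_value (averaged_is_derive j n) x h.
  rewrite mulrC -mulrBr normrM mulrC ler_wpM2r//.
  rewrite /diffq -mulrBl normrM normfV (gtr0_norm aj) ler_pdivrMr//.
  have l1 := averaged_lipschitz j.+1 n (x + c * h) x.
  have l2 := averaged_lipschitz j.+1 n (x + c * h - a j) (x - a j).
  rewrite [x + _]addrC addrK in l1.
  rewrite opprB addrA subrK [x + _]addrC addrK in l2.
  have ch : `|c * h| <= `|h| by rewrite normrM (ger0_norm c0) ler_piMl.
  have hb : 32%:R * `|h| <= e * a j by rewrite mulrC -ler_pdivlMr// ltW.
  move: l1 l2 ch hb; rewrite [c * h + x]addrC.
  move: (averaged _ _ _) (averaged _ _ _) (averaged _ _ _) (averaged _ _ _) => u v w z.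
  move: `|h| `|c * h| => H CH; rewrite !ler_norml.
  move=> /andP[? ?] /andP[? ?] ? ?; apply/andP; split; lra.
have cA k y : (fun n => averaged k n y) @ \oo --> averaged_lim k y.
  exact: averaged_cvg.
have cS k y : (fun n => averaged k n.+1 y) @ \oo --> averaged_lim k y.
  by rewrite (cvg_shiftS (fun n => averaged k n y)); exact: cA.
have c : (fun n => `|averaged j n.+1 (x + h) - averaged j n.+1 x
    - h * diffq (a j) (averaged j.+1 n) x|) @ \oo -->
    `|averaged_lim j (x + h) - averaged_lim j x
      - h * diffq (a j) (averaged_lim j.+1) x|.
  apply: cvg_norm; apply: cvgB; first by apply: cvgB; exact: cS.
  apply: cvgMr; apply: cvgMl; apply: cvgB; exact: cA.
by apply: (cvgr_to_le c); exists 0%N.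
Qed.

(** The p-th derivative of the infinite average: differentiating turns the first p averages into
    difference quotients. *)
Definition bumpf p := diffqs [seq a i | i <- iota 0 p] (averaged_lim p).

Lemma bump_is_derive p x : is_derive x 1 (bumpf p) (bumpf p.+1 x).
Proof.
have E : iota 0 p.+1 = iota 0 p ++ [:: p] by rewrite -addn1 iotaD.
rewrite /bumpf E map_cat /diffqs foldr_cat/=.
by apply: diffqs_is_derive => y; exact: averaged_lim_is_derive.
Qed.

Lemma width0 n : width 0 n <= 4%:R^-1.
Proof. by rewrite /width big_mkord. Qed.

Lemma bump_at0 x : `|x| <= 4%:R^-1 -> bumpf 0 x = 1.
Proof.
move=> x4; rewrite /bumpf/= /averaged_lim.
have -> : (fun n => averaged 0 n x) = (fun=> 1); last exact: lim_cst.
by apply/funext => n; apply: averaged1; have := width0 n; lra.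
Qed.

Lemma bump_deriv_at0 p : bumpf p.+1 0 = 0.
Proof.
suff H x : `|x| < 4%:R^-1 -> bumpf p.+1 x = 0 by apply: H; rewrite normr0.
elim: p x => [|p IH] x x4.
  apply: (@derive_locally_constant _ (bumpf 0) x 1 (4%:R^-1 - `|x|)).
  - by rewrite subr_gt0.
  - exact: bump_is_derive.
  - move=> y yx; apply: bump_at0; have := ler_normD x (y - x).
    by rewrite addrC subrK; move: yx; lra.
apply: (@derive_locally_constant _ (bumpf p.+1) x 0 (4%:R^-1 - `|x|)).
- by rewrite subr_gt0.
- exact: bump_is_derive.
- move=> y yx; apply: IH; have := ler_normD x (y - x).
  by rewrite addrC subrK; move: yx; lra.
Qed.

Lemma bump_support p x : 1 < `|x| -> bumpf p x = 0.
Proof.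
elim: p x => [|p IH] x x1.
  rewrite /bumpf/= /averaged_lim.
  have -> : (fun n => averaged 0 n x) = (fun=> 0); last exact: lim_cst.
  by apply/funext => n; apply: averaged_eq0; have := width0 n; lra.
apply: (@derive_locally_constant _ (bumpf p) x 0 (`|x| - 1)).
- by rewrite subr_gt0.
- exact: bump_is_derive.
- move=> y yx; apply: IH; have := ler_normD y (x - y).
  by rewrite addrC subrK distrC; move: yx; lra.
Qed.

(** Each difference quotient of step a_i costs a factor 2/a_i, and the averages are bounded by 1. *)
Lemma bump_norm p x : `|bumpf p x| <= \prod_(i < p) (2%:R / a i).
Proof.
have H l f : all (fun s => 0 < s) l -> (forall y, `|f y| <= 1) ->
    forall y, `|diffqs l f y| <= \prod_(s <- l) (2%:R / s).
  move=> + f1; elim: l => [_|s l IH /= /andP[s0 l0]] y; first by rewrite big_nil.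
  by rewrite big_cons; apply: diffq_norm => //; exact: IH.
apply: le_trans (H _ _ _ _ x) _.
- by apply/allP => _ /mapP[i _ ->].
- by move=> y; apply: averaged_lim_le => n; exact: averaged_norm.
- by rewrite big_map -[p in iota _ p]subn0 big_mkord.
Qed.

End Bump.

(** * Oscillating test functions and the necessity of Omega *)

Section Towers.
Context (R : realType).
Implicit Types (u v : nat -> R -> R) (p : nat) (x h xi : R).

(** A function is given with explicit formulas for all its derivatives, so that estimates apply to
    them directly. *)
Definition tower u := forall p x, is_derive x 1 (u p) (u p.+1 x).

Lemma tower_shift u : tower u -> tower (fun p => u p.+1).
Proof. by move=> tu p x; exact: tu. Qed.

(* Leibniz' rule for the [p]-th derivative, without binomial coefficients. *)
Fixpoint tower_mul p u v : R -> R :=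
  if p is p'.+1 then
    tower_mul p' (fun i => u i.+1) v + tower_mul p' u (fun i => v i.+1)
  else fun x => u 0%N x * v 0%N x.

Lemma tower_mulP u v : tower u -> tower v -> tower (fun p => tower_mul p u v).
Proof.
move=> tu tv p; elim: p u v tu tv => [|p IH] u v tu tv x.
  rewrite /= [X in is_derive _ _ _ X](_ : _ = u 0%N x * v 1%N x + v 0%N x * u 1%N x).
    exact: is_deriveM (tu 0%N x) (tv 0%N x).
  by rewrite addrC; congr (_ + _); rewrite mulrC.
apply: is_deriveD.
  exact: IH (tower_shift tu) tv x.
exact: IH tu (tower_shift tv) x.
Qed.

Lemma tower_mul_le p u v x (B : R) :
  (forall i j, (i + j)%N = p -> `|u i x| * `|v j x| <= B) ->
  `|tower_mul p u v x| <= 2%:R ^+ p * B.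
Proof.
elim: p u v => [|p IH] u v H; first by rewrite expr0 mul1r /= normrM H.
rewrite exprS -mulrA mulr_natl mulr2n; apply: le_trans (ler_normD _ _) _.
by apply: lerD; apply: IH => i j ij; apply: H; rewrite ?addnS ?addSn ij.
Qed.

Lemma tower_mul_eq0 p u v x : (forall j, v j x = 0) -> tower_mul p u v x = 0.
Proof.
elim: p u v => [|p IH] u v v0; first by rewrite /= v0 mulr0.
by rewrite /= [LHS]/GRing.add/= !IH ?addr0 // => j; exact: v0.
Qed.

Lemma tower_mul_flat p u v x : v 0%N x = 1 -> (forall j, v j.+1 x = 0) ->
  tower_mul p u v x = u p x.
Proof.
move=> v0 vS; elim: p u => [|p IH] u; first by rewrite /= v0 mulr1.
by rewrite /= [LHS]/GRing.add/= IH tower_mul_eq0 ?addr0.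
Qed.

(* The derivatives of [cos + sin] are [c cos + s sin] with [c, s] signs. *)
Fixpoint wave_coef p : R * R :=
  if p is p'.+1 then ((wave_coef p').2, - (wave_coef p').1) else (1, 1).

(** The p-th derivative of cos(xi x) + sin(xi x). Cosine or sine alone would have vanishing
    derivatives of every other order at 0; for the sum they all have absolute value xi^p there. *)
Definition wave xi p x :=
  xi ^+ p * ((wave_coef p).1 * cos (xi * x) + (wave_coef p).2 * sin (xi * x)).

Lemma wave_coef_norm p : `|(wave_coef p).1| = 1 /\ `|(wave_coef p).2| = 1.
Proof. by elim: p => [|p [IH1 IH2]] /=; rewrite ?normr1 ?normrN. Qed.

Lemma wave_tower xi : tower (wave xi).
Proof.
move=> p x; set c := wave_coef p.
have dm (f g : R -> R) : (forall y : R, is_derive y 1 f (g y)) ->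
    is_derive x 1 (fun y => f (xi * y)) (xi * g (xi * x)).
  move=> df; apply/is_derive1P => e e0.
  have xi1 : 0 < `|xi| + 1 by rewrite ltr_wpDl.
  have [r r0 H] := (is_derive1P _ _ _).1 (df (xi * x)) _ (divr_gt0 e0 xi1).
  exists (r / (`|xi| + 1)); first by rewrite divr_gt0.
  move=> k; rewrite ltr_pdivlMr// => kr; rewrite mulrDr mulrA [k * xi]mulrC.
  apply: le_trans (H _ _) _.
    rewrite normrM mulrC; apply: le_lt_trans kr.
    by rewrite ler_wpM2l// lerDl.
  rewrite normrM mulrA ler_wpM2r// mulrAC ler_pdivrMr// ler_wpM2l ?(ltW e0)//.
  by rewrite lerDl.
have H := is_deriveZ (xi ^+ p) (is_deriveD
  (is_deriveZ c.1 (dm _ _ (@is_derive_cos R)))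
  (is_deriveZ c.2 (dm _ _ (@is_derive_sin R)))).
apply: (is_derive_eq H); rewrite /GRing.scale/= /wave/= -/c exprS; ring.
Qed.

Lemma wave_norm xi p x : 0 <= xi -> `|wave xi p x| <= 2%:R * xi ^+ p.
Proof.
move=> xi0; have [c1 s1] := wave_coef_norm p.
rewrite /wave normrM ger0_norm ?exprn_ge0// mulrC ler_wpM2r ?exprn_ge0//.
apply: le_trans (ler_normD _ _) _; rewrite !normrM c1 s1 !mul1r.
by rewrite [2%:R]mulr2n lerD// ?cos_max ?sin_max.
Qed.

Lemma wave_at0 xi p : 0 <= xi -> `|wave xi p 0| = xi ^+ p.
Proof.
move=> xi0; rewrite /wave mulr0 cos0 sin0 mulr1 mulr0 addr0 normrM.
by rewrite (wave_coef_norm p).1 mulr1 ger0_norm// exprn_ge0.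
Qed.

End Towers.

Section TestTowers.
Context (R : realType) (M : weight_sequence R).
Hypotheses (m1 : M1 M) (m3 : M3 M).

(** (M.3) makes 1/m_p summable, so widths a_i with a_i m_(i+1) tending to infinity are available.
    Multiplied by h^p / M_p, the bound of [bump_norm] then has consecutive ratios 2h / (a_p
    m_(p+1)), eventually at most 1 for every h. *)
Lemma flat_bump : exists u : nat -> R -> R, [/\ tower u,
  u 0%N 0 = 1 /\ (forall p, u p.+1 0 = 0),
  forall p x, 1 < `|x| -> u p x = 0 &
  forall h, 0 < h -> exists2 K : R, 0 < K &
    forall p x, `|u p x| <= K * (M p / h ^+ p)].
Proof.
have [C C1 HC] := M3_partial m3.
have [a [a0 aS aM]] : exists a : nat -> R, [/\ forall i, 0 < a i,
    forall n, \sum_(i < n) a i <= 4%:R^-1 &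
    forall K, exists N, forall i, (N <= i)%N -> K <= a i * ratio M i.+1].
  apply: (summable_faster (B := C * 1%:R / ratio M 1)) => [i|n]; first exact: ratio_gt0.
  apply: le_trans (HC 1%N n.+1 isT).
  by rewrite big_add1/= big_mkord.
exists (bumpf a); split.
- exact: bump_is_derive.
- split; last exact: bump_deriv_at0.
  by apply: bump_at0; rewrite // normr0.
- exact: bump_support.
move=> h h0; pose c p := \prod_(i < p) (2%:R / a i) * h ^+ p / M p.
have c0 p : 0 <= c p.
  rewrite divr_ge0 ?(ltW (wseq_gt0 _ _))// mulr_ge0 ?exprn_ge0 ?(ltW h0)//.
  by rewrite prodr_ge0// => i _; rewrite divr_ge0// ltW.
have [N HN] := aM (2%:R * h).
have [K K0 HK] : exists2 K : R, 0 < K & forall p, c p <= K.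
  apply: (@eventually_decreasing_bounded _ c N) => // p Np.
  have r0 := ratio_gt0 M p.+1.
  have -> : c p.+1 = c p * (2%:R * h / (a p * ratio M p.+1)).
    rewrite /c big_ord_recr/= exprS wseqS; have := wseq_gt0 M p; have := a0 p.
    move: (\prod_(i < p) _) (M p) (ratio M p.+1) (a p) r0 => P m r b r0 b0 Mp0.
    by field; rewrite !gt_eqF.
  by apply: ler_piMr => //; rewrite ler_pdivrMr ?mul1r ?HN// mulr_gt0.
exists K => // p x; apply: le_trans (bump_norm a0 aS p x) _.
have := HK p; rewrite /c ler_pdivrMr ?wseq_gt0// -ler_pdivlMr ?exprn_gt0//.
by rewrite mulrA.
Qed.

(** The tower [g xi] is the wave times the bump. Using the bump bound at 2h pays for the 2^p terms
    of the product rule, and xi^i is bounded by [assoc] at 2 h xi times M_i / (2h)^i; the product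
    M_i M_j is then merged into M_0 M_p. *)
Lemma test_towers : exists (psi : nat -> R -> R) (g : R -> nat -> R -> R),
  [/\ tower psi /\ forall xi, tower (g xi),
      psi 0%N 0 = 1 /\ (forall xi p, 0 <= xi -> `|g xi p 0| = xi ^+ p),
      (forall p x, 1 < `|x| -> psi p x = 0) /\
      (forall xi p x, 1 < `|x| -> g xi p x = 0) &
      forall h, 0 < h -> exists2 K : R, 0 < K & forall p x,
        `|psi p x| <= K * (M p / h ^+ p) /\
        forall xi, 0 <= xi ->
          `|g xi p x| <= K * assoc M (2%:R * h * xi) * (M p / h ^+ p)].
Proof.
have [psi [tpsi [psi0 psiS] spsi bpsi]] := flat_bump.
exists psi, (fun xi p => tower_mul p (wave xi) psi); split.
- by split=> // xi; exact: tower_mulP (@wave_tower R xi) tpsi.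
- by split=> // xi p xi0; rewrite tower_mul_flat// wave_at0.
- by split=> // xi p x x1; apply: tower_mul_eq0 => j; exact: spsi.
move=> h h0; have [K1 K10 H1] := bpsi h h0.
have h20 : 0 < 2%:R * h by rewrite mulr_gt0.
have [K2 K20 H2] := bpsi _ h20.
have M00 := wseq_gt0 M 0%N.
exists (K1 + 2%:R * K2 * M 0%N); first by rewrite addr_gt0// !mulr_gt0.
move=> p x; have Mh : 0 <= M p / h ^+ p.
  by rewrite divr_ge0 ?exprn_ge0 ?ltW ?wseq_gt0.
split=> [|xi xi0].
  by apply: le_trans (H1 p x) _; rewrite ler_wpM2r// lerDl !mulr_ge0 ?ltW.
have t0 : 0 <= 2%:R * h * xi by rewrite mulr_ge0// ltW.
have A0 := assoc_gt0 M t0; set A := assoc M _ in A0 *.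
apply: (@le_trans _ _ (2%:R ^+ p * (2%:R * K2 * M 0%N * A * (M p / (2%:R * h) ^+ p)))).
  apply: tower_mul_le => i j ij; have := wave_norm i x xi0.
  move=> /ler_pM/(_ (H2 j x)); rewrite !normr_ge0 => /(_ isT isT)/le_trans; apply.
  have /(ler_wpM2r _) := assoc_ge M i t0.
  move=> /(_ (M i * M j / (2%:R * h) ^+ p)).
  have z0 : 0 <= M i * M j / (2%:R * h) ^+ p.
    by rewrite divr_ge0 ?mulr_ge0 ?exprn_ge0 ?ltW ?wseq_gt0.
  move=> /(_ z0) Hi.
  have -> : 2%:R * xi ^+ i * (K2 * (M j / (2%:R * h) ^+ j)) =
      2%:R * K2 * ((2%:R * h * xi) ^+ i / M i * (M i * M j / (2%:R * h) ^+ p)).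
    rewrite -ij exprD [(2%:R * h * xi) ^+ i]exprMn.
    have := wseq_gt0 M i; move: (M i) (2%:R * h) h20 => m y y0 mi0.
    by field; rewrite !expf_neq0 ?gt_eqF.
  have -> : 2%:R * K2 * M 0%N * A * (M p / (2%:R * h) ^+ p) =
      2%:R * K2 * (A * (M 0%N * M p / (2%:R * h) ^+ p)) by ring.
  rewrite ler_wpM2l ?mulr_ge0 ?(ltW K20)//; apply: (le_trans Hi).
  rewrite ler_wpM2l ?(ltW A0)// ler_wpM2r ?invr_ge0 ?exprn_ge0 ?(ltW h20)//.
  by rewrite -ij; exact: wseq_mul.
have -> : 2%:R ^+ p * (2%:R * K2 * M 0%N * A * (M p / (2%:R * h) ^+ p)) =
    2%:R * K2 * M 0%N * A * (M p / h ^+ p).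
  by rewrite exprMn; field; rewrite !expf_neq0 ?gt_eqF.
rewrite ler_wpM2r// ler_wpM2r ?(ltW A0)// lerDr; exact: ltW.
Qed.

End TestTowers.

(** * Test functions of several variables *)

Section TensorProducts.
Context (R : realType) (d : nat) (W : 'I_d -> nat -> R -> R) (x0 : 'rV[R]_d).
Hypothesis tW : forall i, tower (W i).
Implicit Types (x : 'rV[R]_d) (i j : 'I_d) (k : 'I_d -> nat) (alpha : {ffun 'I_d -> nat}).
Local Notation C := R[i].

Definition tensor k x : R := \prod_i W i (k i) (x 0 i - x0 0 i).

Lemma tensor_continuous k : continuous (tensor k).
Proof.
rewrite /tensor; elim: (index_enum _) => [|i s IH] x.
  have -> : (fun y : 'rV[R]_d => \prod_(i <- [::]) W i (k i) (y 0 i - x0 0 i)) = (fun=> 1).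
    by apply/funext => y; rewrite big_nil.
  exact: (@cst_continuous _ _ (1 : R)).
have -> : (fun y : 'rV[R]_d => \prod_(j <- i :: s) W j (k j) (y 0 j - x0 0 j)) =
  (fun y => W i (k i) (y 0 i - x0 0 i) * \prod_(j <- s) W j (k j) (y 0 j - x0 0 j)).
  by apply/funext => y; rewrite big_cons.
have cW : continuous (fun t : R => W i (k i) (t - x0 0 i)).
  move=> t; apply/differentiable_continuous/derivable1_diffP.
  by case: (is_derive_translate (- x0 0 i) (tW i (k i)) t).
exact: (continuousM (continuous_comp (@coord_continuous R 1 d 0 i x) (cW _)) (IH x)).
Qed.

Lemma tensor_is_derive k i x :
  is_derive x (delta_mx 0 i) (tensor k) (tensor (fun j => ((i == j) + k j)%N) x).
Proof.
set c := \prod_(j | j != i) W j (k j) (x 0 j - x0 0 j).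
apply/is_deriveP => e e0; have c1 : 0 < `|c| + 1 by rewrite ltr_wpDl.
have [r r0 H] := (is_derive1P _ _ _).1 (tW i (k i) (x 0 i - x0 0 i)) _ (divr_gt0 e0 c1).
exists r => // h /H {}H.
have -> : tensor k (x + h *: delta_mx 0 i) = W i (k i) (x 0 i - x0 0 i + h) * c.
  rewrite /tensor (bigD1 i)//= !mxE !eqxx/= mulr1 addrAC; congr (_ * _).
  apply: eq_bigr => j ji; rewrite !mxE (negbTE ji) andbF mulr0 addr0.
  by [].
have -> : tensor k x = W i (k i) (x 0 i - x0 0 i) * c by rewrite /tensor (bigD1 i).
have -> : tensor (fun j => ((i == j) + k j)%N) x = W i (k i).+1 (x 0 i - x0 0 i) * c.
  rewrite /tensor (bigD1 i)//= eqxx add1n; congr (_ * _).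
  by apply: eq_bigr => j ji; rewrite eq_sym (negbTE ji).
rewrite mulrA -!mulrBl normrM; apply: le_trans (ler_wpM2r _ H) _ => //.
rewrite mulrAC ler_wpM2r// mulrAC ler_pdivrMr// ler_wpM2l ?(ltW e0)//.
by rewrite lerDl.
Qed.

Lemma partials_tensor s : partials s (tensor (fun=> 0%N)) = tensor (fun i => count_mem i s).
Proof.
elim: s => //= i s ->; apply/funext => x.
by case: (tensor_is_derive (fun j => count_mem j s) i x).
Qed.

Lemma tensor_smooth : smooth (tensor (fun=> 0%N)).
Proof.
move=> s; rewrite partials_tensor; split; first exact: tensor_continuous.
by move=> i x; case: (tensor_is_derive (fun j => count_mem j s) i x).
Qed.

Definition ctensor x : C := (tensor (fun=> 0%N) x)%:C%C.

Lemma ctensor_smooth : csmooth ctensor.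
Proof. by split; [exact: tensor_smooth|exact: smooth0]. Qed.

Lemma cderiv_ctensor alpha x : cderiv alpha ctensor x = (tensor alpha x)%:C%C.
Proof.
have re_ : re ctensor = tensor (fun=> 0%N) by [].
have im_ : im ctensor = 0 by [].
rewrite /cderiv re_ im_ partials0 partials_tensor.
congr (Complex _ _); congr tensor; apply/funext => i; exact: count_directions.
Qed.

Lemma tensor_le (M : weight_sequence R) (B : 'I_d -> R) (h : R) alpha x :
  M1 M -> 0 < h ->
  (forall i p y, `|W i p y| <= B i * (M p / h ^+ p)) ->
  h ^+ morder alpha * `|tensor alpha x| / M (morder alpha) <=
    \prod_i (B i * M 0%N) / M 0%N.
Proof.
move=> m1 h0 HB; have M0 := wseq_gt0 M 0%N.
have B0 i : 0 <= B i.
  have := le_trans (normr_ge0 _) (HB i 0%N 0); rewrite pmulr_lge0//.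
  by rewrite divr_gt0 ?exprn_gt0.
rewrite ler_pdivrMr ?wseq_gt0//.
apply: (@le_trans _ _ (h ^+ morder alpha *
    \prod_i (B i * M 0%N * (M (alpha i) / M 0%N) / h ^+ alpha i))).
  rewrite ler_wpM2l ?exprn_ge0 ?(ltW h0)// /tensor normr_prod.
  apply: ler_prod => i _; rewrite normr_ge0/=; apply: le_trans (HB _ _ _) _.
  rewrite le_eqVlt; apply/orP; left; apply/eqP.
  by field; rewrite !gt_eqF// exprn_gt0.
rewrite big_split/= prodfV prodrXr -/(morder alpha) mulrC divfK; last first.
  by rewrite gt_eqF// exprn_gt0.
rewrite big_split/= -[leRHS]mulrA [_^-1 * _]mulrC; apply: ler_wpM2l.
  by apply: prodr_ge0 => i _; rewrite mulr_ge0// ltW.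
exact: wseq_prod.
Qed.

End TensorProducts.

Section OmegaNecessary.
Context (R : realType) (d : nat) (M : weight_sequence R).
Local Notation C := R[i].
Implicit Types (x : 'rV[R]_d) (xi h : R).

(** The oscillating tower is placed in one coordinate and the flat bump in the others. Derivatives
    along that coordinate see the exact size xi^p at the center, and the support in a unit box
    reduces the weight to its bound there. *)
Lemma test_functions : (0 < d)%N -> M1 M -> M3 M ->
  exists (F : 'rV[R]_d -> R -> 'rV[R]_d -> C) (K : R -> R) (alpha : nat -> {ffun 'I_d -> nat}),
  [/\ forall x0 xi, csmooth (F x0 xi),
      forall p, morder (alpha p) = p,
      forall x0 xi p, 0 <= xi -> cabs (cderiv (alpha p) (F x0 xi) x0) = xi ^+ p,
      forall h, 0 < h -> 0 < K h &
      forall h b x0 xi (w : weight R d), 0 < h -> 0 <= xi ->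
        (forall x, (forall i, `|x 0 i - x0 0 i| <= 1) -> w x <= b) ->
        (bnorm M w h (F x0 xi) <= (K h * assoc M (2%:R * h * xi) * b)%:E)%E].
Proof.
move=> d0 m1 m3; have M0 := wseq_gt0 M 0%N.
have [psi [g [[tpsi tg] [psi0 g0] [spsi sg] Hb]]] := test_towers m1 m3.
pose i0 : 'I_d := Ordinal d0.
pose W xi (i : 'I_d) := if i == i0 then g xi else psi.
have tW xi i : tower (W xi i) by rewrite /W; case: ifP.
pose alpha p := [ffun i : 'I_d => if i == i0 then p else 0%N].
have /choice[K KP] h : exists K : R, 0 < h -> 0 < K /\ forall p (t : R),
        `|psi p t| <= K * (M p / h ^+ p) /\
        forall xi, 0 <= xi ->
          `|g xi p t| <= K * assoc M (2%:R * h * xi) * (M p / h ^+ p).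
  have [h0|_] := boolP (0 < h); last by exists 0.
  by have [K K0 HK] := Hb h h0; exists K.
exists (fun x0 xi => ctensor (W xi) x0), (fun h => (K h * M 0%N) ^+ d / M 0%N), alpha.
split.
- by move=> x0 xi; exact: ctensor_smooth.
- move=> p; rewrite /morder (bigD1 i0)//= ffunE eqxx big1 ?addn0// => i ii0.
  by rewrite ffunE (negbTE ii0).
- move=> x0 xi p xi0; rewrite cderiv_ctensor// cabs_real /tensor (bigD1 i0)//=.
  rewrite big1 ?mulr1; first by rewrite /W eqxx ffunE eqxx subrr g0.
  by move=> i ii0; rewrite /W (negbTE ii0) ffunE (negbTE ii0) subrr.
- move=> h /KP[K0 _]; rewrite divr_gt0// exprn_gt0// mulr_gt0//.
move=> h b x0 xi w h0 xi0 wb; have [K0 HK] := KP h h0.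
have t0 : 0 <= 2%:R * h * xi by rewrite !mulr_ge0// ltW.
have A0 := assoc_gt0 M t0; set A := assoc M _ in A0 *.
have b0 : 0 <= b.
  apply: le_trans (ltW (weight_gt0 w x0)) (wb x0 _) => i.
  by rewrite subrr normr0.
apply/bnorm_leP => al x; rewrite cderiv_ctensor// cabs_real.
have [box|out] := pselect (forall i, `|x 0 i - x0 0 i| <= 1); last first.
  have [i xi1] : exists i, 1 < `|x 0 i - x0 0 i|.
    apply: contrapT => H; apply: out => i; rewrite leNgt; apply/negP => ?.
    by apply: H; exists i.
  have -> : tensor (W xi) x0 al x = 0.
    rewrite /tensor (bigD1 i)//=.
    by rewrite /W; case: ifP => _; rewrite ?sg ?spsi ?mul0r.
  rewrite normr0 mulr0 !mul0r mulr_ge0// mulr_ge0 ?(ltW A0)//.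
  by rewrite divr_ge0 ?(ltW M0)// exprn_ge0// ltW// mulr_gt0.
have HB i p y : `|W xi i p y| <= (if i == i0 then K h * A else K h) * (M p / h ^+ p).
  have [H1 H2] := HK p y.
  by rewrite /W; case: ifP => _; [exact: H2|exact: H1].
have := tensor_le x0 al x m1 h0 HB.
have -> : \prod_(i < d) ((if i == i0 then K h * A else K h) * M 0%N) =
    (K h * M 0%N) ^+ d * A.
  have -> : (K h * M 0%N) ^+ d = \prod_(i < d) (K h * M 0%N).
    by rewrite prodr_const card_ord.
  rewrite (bigD1 i0)//= [in RHS](bigD1 i0)//= ?eqxx.
  have -> : \prod_(i < d | i != i0) ((if i == i0 then K h * A else K h) * M 0%N) =
            \prod_(i < d | i != i0) (K h * M 0%N).
    by apply: eq_bigr => i /negbTE ->.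
  by rewrite [K h * A * _]mulrAC [LHS]mulrAC.
move=> T; rewrite mulrAC; apply: ler_pM => //.
- by rewrite mulr_ge0 ?invr_ge0 ?(ltW (wseq_gt0 _ _))// mulr_ge0 ?exprn_ge0 ?(ltW h0).
- exact/ltW/weight_gt0.
- by apply: le_trans T _; rewrite mulrAC.
- exact: wb.
Qed.

(** This r solves v / r = r^L w. *)
Lemma powR_balance (v w : R) (L : nat) : 0 < w -> 0 < v ->
  let th := (L.+1%:R)^-1 in let r := (v / w) `^ th in
  v / r = v `^ (1 - th) * w `^ th /\ r ^+ L * w = v `^ (1 - th) * w `^ th.
Proof.
move=> w0 v0 th r; have vw : 0 < v / w by rewrite divr_gt0.
have r0 : 0 < r by exact: powR_gt0.
have L0 : L.+1%:R != 0 :> R by rewrite pnatr_eq0.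
have splitp u : 0 < u -> u `^ (1 - th) * u `^ th = u.
  by move=> u0; rewrite -powRD ?subrK ?powRr1 ?ltW// gt_eqF// implybT.
have thL : th * L%:R = 1 - th.
  have -> : L%:R = L.+1%:R - 1 :> R by rewrite [L.+1%:R]mulrSr addrK.
  by rewrite mulrBr mulVf// mulr1.
split.
  apply: (canLR (mulfK (lt0r_neq0 r0))).
  rewrite -mulrA -powRM ?(ltW w0) ?(ltW vw)// [w * _]mulrC divfK ?gt_eqF//.
  by rewrite splitp.
rewrite /r -powR_mulrn ?powR_ge0// -powRrM thL.
rewrite -[X in _ * X = _](splitp w w0) mulrA.
by rewrite -powRM ?(ltW vw) ?(ltW w0)// divfK ?gt_eqF.
Qed.

(* Optimizing over [r] turns the family of linear bounds into the
   multiplicative bound of [Omega]. *)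
Lemma geometric_interpolation (v w u D : R) (L : nat) :
  0 < w -> w <= v -> (forall r, 1 <= r -> u <= D * (v / r + r ^+ L.+1 * w)) ->
  u <= (D + D) * (v `^ (1 - (L.+2%:R)^-1) * w `^ (L.+2%:R)^-1).
Proof.
move=> w0 wv H; have v0 := lt_le_trans w0 wv.
have [e1 e2] := powR_balance L.+1 w0 v0.
have r1 : 1 <= (v / w) `^ (L.+2%:R)^-1.
  have vw : 1 <= v / w by rewrite ler_pdivlMr// mul1r.
  have i0 : 0 <= (L.+2%:R)^-1 :> R by rewrite invr_ge0.
  by have := le_powR i0 ler01 vw; rewrite powR1.
by have := H _ r1; rewrite e1 e2 mulrDr mulrDl.
Qed.

(** The frequency is doubled, starting at 1, as long as [assoc] does not exceed r; this stops
    because [assoc] at t is at least t / M_1. *)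
Lemma assoc_bracket (h r : R) : 0 < h -> assoc M h <= r ->
  exists2 xi, 0 <= xi & assoc M (h * xi) <= r <= assoc M (h * (2%:R * xi)).
Proof.
move=> h0 hr.
have ex : exists i : nat, r < assoc M (h * 2%:R ^+ i).
  have r1 : 0 < h / (M 1%N * (`|r| + 1)).
    by rewrite divr_gt0// mulr_gt0 ?wseq_gt0// ltr_wpDl.
  have [i Hi] := expr2V_lt r1; exists i.
  have t0 : 0 <= h * 2%:R ^+ i by rewrite mulr_ge0 ?exprn_ge0// ltW.
  apply: lt_le_trans (assoc_ge M 1 t0); rewrite expr1.
  apply: (@lt_le_trans _ _ (`|r| + 1)); first by rewrite ltr_pwDr// ler_norm.
  rewrite ler_pdivlMr ?wseq_gt0//.
  have p0 : 0 < M 1%N * (`|r| + 1) by rewrite mulr_gt0 ?wseq_gt0 ?ltr_wpDl.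
  have {}Hi := Hi i (leqnn _); rewrite ler_pdivlMr// mulrC in Hi.
  by rewrite ler_pdivrMr ?exprn_gt0// in Hi; rewrite mulrC.
case: (ex_minnP ex) => -[|i]; first by rewrite expr0 mulr1 ltNge hr.
move=> Hi Hmin; exists (2%:R ^+ i); first by rewrite exprn_ge0.
rewrite -exprS (ltW Hi) andbT leNgt; apply/negP => /Hmin.
by rewrite ltnn.
Qed.

Lemma box_bound (V : weight_system R d) (n m : nat) (c : R) x0 :
  (ereal_sup [set (V m (x0 + y)%R)%:E | y in
     [set y : 'rV[R]_d | forall i, (-1 <= y 0 i <= 1)%R]] <= (c * V n x0)%:E)%E ->
  forall x, (forall i, `|x 0 i - x0 0 i| <= 1) -> V m x <= c * V n x0.
Proof.
move=> H x box; rewrite -lee_fin; apply: le_trans H.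
apply: ereal_sup_ubound; exists (x - x0); last by rewrite addrC subrK.
by move=> i /=; rewrite !mxE -ler_norml.
Qed.

(** The supremum over p of the derivatives at x0 bounds the norm of the step m below by [assoc] at
    (j + 1) xi times V_m. (M.2) splits this into two factors, and [assoc_bracket] makes one at most
    r and the other at least r. *)
Lemma wQ_Omega (V : weight_system R d) : (0 < d)%N -> M1 M -> M2 M -> M3 M ->
  translation_controlled V -> cond_wQ (union_grid M V) -> Omega V.
Proof.
move=> d0 m1 m2 m3 tV wQ n.
have [F [K [alpha [sF oalpha dF K0 nF]]]] := test_functions d0 m1 m3.
have [n1 nn1 [c1 c10 T1]] := tV n.
have [i [m [n1m Hm]]] := wQ n1; exists m; first exact: leq_ltn_trans n1m.
move=> k mk; have [k1 kk1 [c2 c20 T2]] := tV k.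
have [C0 [H [C00 H1 HM2]]] := M2_assoc m2.
(* [test_functions] bounds the norm with h = i + 1 by [assoc] at 2 h xi = h1 xi. *)
pose h1 : R := 2%:R * i.+1%:R; have h10 : 0 < h1 by rewrite mulr_gt0.
have H0 := lt_le_trans ltr01 H1.
(* Large enough for (M.2) to recover the factors at h1 xi and 2 h1 xi from the one at (j + 1) xi. *)
pose j := Num.bound (H * (2%:R * h1)).
have Hj : H * (2%:R * h1) <= j.+1%:R.
  apply: le_trans (ltW (archi_boundP _)) _; last by rewrite ler_nat.
  by rewrite !mulr_ge0 ?(ltW H0) ?(ltW h10).
have [l [C1 C10 HC]] := Hm k1 j (leq_trans mk kk1).
(* The dilation leading from h1 to 2 (l + 1), the factor attached to the norm of the step k1. *)
pose la := Num.max 1 (2%:R * l.+1%:R / h1).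
have la1 : 1 <= la by rewrite le_max lexx.
have [C3 [L [C30 HL]]] := M3_assoc m1 m3 la1.
have hl : 2%:R * l.+1%:R <= la * h1.
  by rewrite -ler_pdivrMr// le_max lexx orbT.
have Ki := K0 _ (ltr0Sn R i); have Kl := K0 _ (ltr0Sn R l).
pose P := C0 * C1 * (K i.+1%:R * c1).
pose Q := C0 * C1 * (K l.+1%:R * C3 * c2).
have P0 : 0 < P by rewrite !mulr_gt0.
have Q0 : 0 < Q by rewrite !mulr_gt0.
have main x0 xi : 0 <= xi ->
    assoc M (h1 * xi) * assoc M (h1 * (2%:R * xi)) * V m x0 <=
    P * (assoc M (h1 * xi) * V n x0) + Q * (assoc M (h1 * xi) ^+ L * V k x0).
  move=> xi0; have t0 : 0 <= h1 * xi by rewrite mulr_ge0 ?(ltW h10).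
  have A0 := assoc_gt0 M t0.
  have Vn := box_bound (T1 x0); have Vk := box_bound (T2 x0).
  have BF : frechet_B M (V n1) (F x0 xi).
    move=> h h0; split; first exact: sF.
    exact: le_lt_trans (nF h _ x0 xi (V n1) h0 xi0 Vn) (ltry _).
  have FU : F x0 xi \in union_pred M V by apply/asboolP; exists n1.
  pose f : union_vect M V := UnionVect FU.
  have nf : stepset (union_grid M V) n1 f by apply/stepsetP.
  have b1 : (union_grid M V n1 i f <= _)%E :=
    nF _ _ x0 xi (V n1) (ltr0Sn R i) xi0 Vn.
  have b2 : (union_grid M V k1 l f <= _)%E :=
    nF _ _ x0 xi (V k1) (ltr0Sn R l) xi0 Vk.
  have tl : 0 <= 2%:R * l.+1%:R * xi by rewrite !mulr_ge0.
  have Al : assoc M (2%:R * l.+1%:R * xi) <= C3 * assoc M (h1 * xi) ^+ L.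
    apply: le_trans (HL _ t0); apply: assoc_mono => //.
    by rewrite mulrA ler_wpM2r.
  have Vn0 := weight_gt0 (V n) x0; have Vk0 := weight_gt0 (V k) x0.
  pose s1 := K i.+1%:R * assoc M (h1 * xi) * (c1 * V n x0).
  pose s2 := K l.+1%:R * (C3 * assoc M (h1 * xi) ^+ L) * (c2 * V k x0).
  have s10 : 0 < s1 by rewrite !mulr_gt0.
  have s20 : 0 < s2 by rewrite !mulr_gt0// exprn_gt0.
  have fs : (union_grid M V m j f <= (C1 * (s1 + s2))%:E)%E.
    apply: HC => //; first by rewrite addr_gt0.
      by apply: gnorm_le_trans b1 _; rewrite lerDl ltW.
    apply: gnorm_le_trans b2 _; apply: (@le_trans _ _ s2); last by rewrite lerDr ltW.
    by rewrite ler_wpM2r ?mulr_ge0 ?(ltW c20) ?(ltW Vk0)// ler_wpM2l// ltW.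
  have low : assoc M (j.+1%:R * xi) * V m x0 <= C1 * (s1 + s2).
    apply: assoc_mulr_le => [|p]; first exact/ltW/weight_gt0.
    have := (unorm_leP _ _ _ _).1 fs (alpha p) x0.
    by rewrite /evalnorm oalpha dF// -exprMn mulrAC.
  have A2 : assoc M (h1 * xi) * assoc M (h1 * (2%:R * xi)) <= C0 * assoc M (j.+1%:R * xi).
    have t1 : h1 * xi <= h1 * (2%:R * xi) by rewrite ler_pM2l// ler_peMl// ler1n.
    apply: le_trans (HM2 _ _ t0 t1) _; rewrite ler_pM2l//; apply: assoc_mono.
      by rewrite mulr_ge0 ?(ltW H0)// (le_trans t0).
    by rewrite [h1 * _]mulrA [h1 * _]mulrC mulrA ler_wpM2r.
  apply: le_trans (ler_wpM2r (ltW (weight_gt0 _ x0)) A2) _.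
  rewrite -mulrA; apply: le_trans (ler_wpM2l (ltW C00) low) _.
  by rewrite le_eqVlt; apply/orP; left; apply/eqP; rewrite /s1 /s2 /P /Q; ring.
have M0 := wseq_gt0 M 0%N.
have Ah := assoc_gt0 M (ltW h10).
(* The last summand covers r below [assoc M h1], where V_m <= V_n already suffices. *)
pose D := P + Q * M 0%N + assoc M h1.
have D0 : 0 < D by rewrite !addr_gt0// mulr_gt0.
have bound r x0 : 1 <= r -> V m x0 <= D * (V n x0 / r + r ^+ L.+1 * V k x0).
  move=> r1; have r0 := lt_le_trans ltr01 r1.
  have Vn0 := weight_gt0 (V n) x0; have Vk0 := weight_gt0 (V k) x0.
  have Vnr : 0 < V n x0 / r by rewrite divr_gt0.
  have rV : 0 < r ^+ L.+1 * V k x0 by rewrite mulr_gt0// exprn_gt0.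
  have nm : V m x0 <= V n x0.
    by apply: wsys_mono; apply: leq_trans nn1 (ltnW n1m).
  have [hr|rh] := leP (assoc M h1) r; last first.
    apply: (le_trans nm); apply: (@le_trans _ _ (assoc M h1 * (V n x0 / r))).
      by rewrite mulrA ler_pdivlMr// mulrC ler_pM2r// ltW.
    have PQ : assoc M h1 <= D.
      by rewrite /D lerDr; apply: ltW; apply: addr_gt0 => //; exact: mulr_gt0.
    by apply: (ler_pM (ltW Ah) (ltW Vnr) PQ); rewrite lerDl ltW.
  have [xi xi0 /andP[a1r ra2]] := assoc_bracket h10 hr.
  have := main x0 xi xi0.
  have A1 : 0 < assoc M (h1 * xi) by apply: assoc_gt0; rewrite mulr_ge0// ltW.
  have A1M : 1 <= M 0%N * assoc M (h1 * xi).
    rewrite mulrC -ler_pdivrMr// div1r; apply: assoc_ge0.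
    by rewrite mulr_ge0// ltW.
  move: a1r ra2 A1 A1M; move: (assoc M (h1 * xi)) (assoc M (h1 * (2%:R * xi))) => a b.
  move=> ar rb a0 aM H1'.
  have step : a * r * V m x0 <= P * (a * V n x0) + Q * (a ^+ L * V k x0).
    apply: le_trans H1'; rewrite ler_wpM2r ?(ltW (weight_gt0 _ _))//.
    by rewrite ler_pM2l.
  have ar0 : 0 < a * r by rewrite mulr_gt0.
  rewrite -(ler_pM2l ar0); apply: (le_trans step).
  (* The V_k term needs a^L <= M_0 a r r^(L+1), which follows from a <= r, 1 <= M_0 a and 1 <= r. *)
  apply: (@le_trans _ _ (a * r * (P * (V n x0 / r) + Q * M 0%N * (r ^+ L.+1 * V k x0)))).
    rewrite mulrDr; apply: lerD.
      by rewrite le_eqVlt; apply/orP; left; apply/eqP; field; rewrite gt_eqF.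
    have -> : a * r * (Q * M 0%N * (r ^+ L.+1 * V k x0)) =
        Q * ((M 0%N * a) * (r * r ^+ L.+1) * V k x0) by ring.
    rewrite ler_pM2l// ler_pM2r//; apply: (@le_trans _ _ (r ^+ L)).
      by rewrite lerXn2r// nnegrE ltW.
    have rr : 1 <= r * r by rewrite -[leLHS]mulr1 ler_pM.
    have -> : M 0%N * a * (r * r ^+ L.+1) = (M 0%N * a * (r * r)) * r ^+ L.
      by rewrite exprS; ring.
    rewrite ler_peMl ?exprn_ge0 ?(ltW r0)//.
    by rewrite -[leLHS]mulr1; apply: ler_pM.
  rewrite ler_pM2l// mulrDr; apply: lerD.
    by rewrite ler_pM2r// /D -addrA lerDl addr_ge0 ?(ltW Ah)// mulr_ge0 ?(ltW Q0) ?(ltW M0).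
  by rewrite ler_pM2r// /D addrAC lerDr addr_ge0// ltW.
have th01 : 0 < (L.+2%:R : R)^-1 < 1.
  by rewrite invr_gt0 ltr0n invf_lt1 ?ltr0n// ltr1n.
exists (L.+2%:R)^-1 => //; exists (D + D); first by rewrite addr_gt0.
move=> x; apply: geometric_interpolation; first exact: weight_gt0.
  apply: wsys_mono; apply: leq_trans nn1 _; exact: ltnW (ltn_trans n1m mk).
by move=> r; exact: bound.
Qed.

End OmegaNecessary.

Theorem theorem3p7 (R : realType) (d : nat) (d_gt0 : (0 < d)%N)
    (M : weight_sequence R) (V : weight_system R d) :
  (Omega V -> boundedly_retractive (B_spectrum M V)) /\
  (boundedly_retractive (B_spectrum M V) -> lf_complete (B_spectrum M V)) /\
  (lf_complete (B_spectrum M V) -> lf_regular (B_spectrum M V)) /\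
  (lf_regular (B_spectrum M V) -> lf_wQ (B_spectrum M V)) /\
  (regularly_decreasing V ->
     lf_wQ (B_spectrum M V) -> boundedly_retractive (B_spectrum M V)) /\
  (M1 M -> M2 M -> M3 M -> translation_controlled V ->
     lf_wQ (B_spectrum M V) -> Omega V).
Proof.
have Sq := union_spectrum_norms M V.
have cS := @union_steps_complete _ _ M V; have cl := @union_norms_closed _ _ M V.
split; first by move/(Omega_Q M); exact: Q_boundedly_retractive.
split.
  by move/(boundedly_retractive_Q Sq); exact: cond_Q_complete.
split; first exact: complete_regular Sq cl.
split.
  by move/(regular_bounded Sq)/regular_wQ/(lf_wQP Sq).
split.
  move=> rV /(lf_wQP Sq)/(regularly_decreasing_Q rV).
  exact: Q_boundedly_retractive.
move=> m1 m2 m3 tV /(lf_wQP Sq).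
exact: wQ_Omega d_gt0 m1 m2 m3 tV.
Qed.
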